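(* Let $(M,F)$ be a Finsler structure on an oriented three-dimensional manifold $M$, let $p>0$ and $s\neq 0$ be real numbers, and let $SM=F^{-1}(1)$ be the ($5$-dimensional) indicatrix-bundle, whose points are denoted $(x,u)$. Let $\sigma$ be the $2$-form on $SM$ given by $$\sigma=p\,h_{ab}\,\omega^{\bar a}\wedge\omega^b+\tfrac12\,\widehat\Omega(S)-\tfrac12\,S_{ab}\,\omega^{\bar a}\wedge\omega^{\bar b},$$ which is the $2$-form to which $d(p\,\omega^3+s\,\widehat\omega_{12})$, defined on the $SO(2)$-principal bundle $SO_2(SM)\to SM$, descends (all symbols are defined in the context). Define functions on $SM$ by $$\Delta=s\Big[1-\frac{1}{4s^2}\,\widehat Q(S)(S)\Big],$$ $$\Sigma=\frac1\Delta\Big[p^2-\frac12\,p\,P(S)_{ij}\,\mathrm g^{ij}+\frac{1}{8s^2}\,P(S)_{ik}\,P(S)_{jl}\,S^{ij}S^{kl}\Big]+\frac{1}{4s}\,R(S)(S)$$ (the latter where $\Delta\neq0$), with $R(S)(S)=R(S)_{ij}S^{ij}$ and $\widehat Q(S)(S)=\widehat Q(S)_{ij}S^{ij}$. Then, at points of $SM\setminus(\Delta^{-1}(0)\cup\Sigma^{-1}(0))$, a tangent vector $X$ to $SM$ belongs to $\ker(\sigma)$ if and only if $$X=X^3\bigg[\Big(u^i+\frac{1}{2s\Sigma}\,S_j{}^i\,R(S)_k{}^j\,u^k\Big)\frac{\delta}{\delta x^i}+\frac{1}{2s^2\Delta\Sigma}\Big(S_j{}^i\big[p\,\delta^j_k-\tfrac12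 P(S)_k{}^j\big]S_l{}^k\,R(S)_m{}^l\,u^m\Big)\frac{\partial}{\partial u^i}\bigg]$$ for some $X^3\in\mathbb R$. Moreover, $\sigma$ endows $SM\setminus(\Delta^{-1}(0)\cup\Sigma^{-1}(0))$ with a presymplectic structure (a closed $2$-form of constant rank) of rank $4$.
   Context: Summation over repeated indices is understood; $i,j,k,\ldots$ and $a,b,c,\ldots$ run over $1,2,3$. Finsler structure: $F:TM\to\mathbb R^+$ is smooth on $TM\setminus M=\{(x,y): y\in T_xM\setminus\{0\}\}$, positively homogeneous of degree one in $y$, and $\mathrm g_{ij}(x,y)=(\tfrac12F^2)_{y^iy^j}$ is positive definite; $(\mathrm g^{ij})=(\mathrm g_{ij})^{-1}$. Put $u^i=y^i/F$, $u_i=\mathrm g_{ij}u^j$, and let the Cartan tensor be $A_{ijk}=F\,(\tfrac14F^2)_{y^iy^jy^k}$. Coordinate indices are raised and lowered with $\mathrm g$. Nonlinear connection: $G^j=\tfrac12\mathrm g^{jk}\big((F^2)_{y^kx^l}y^l-(F^2)_{x^k}\big)$, $N^i_j=\tfrac12\,\partial G^i/\partial y^j$, $\frac{\delta}{\delta x^i}=\frac{\partial}{\partial x^i}-N^j_i\frac{\partial}{\partial y^j}$, $\delta y^i=dy^i+N^i_j\,dx^j$. Chern connection: $\Gamma^i_{jk}=\tfrac12\mathrm g^{il}\big(\frac{\delta \mathrm g_{kl}}{\delta x^j}+\frac{\delta \mathrm g_{jl}}{\delta x^k}-\frac{\delta \mathrm g_{jk}}{\delta x^l}\big)$, with curvatures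 $R_j{}^i{}_{kl}=\frac{\delta\Gamma^i_{jl}}{\delta x^k}-\frac{\delta\Gamma^i_{jk}}{\delta x^l}+\Gamma^i_{mk}\Gamma^m_{jl}-\Gamma^i_{ml}\Gamma^m_{jk}$ and $P_j{}^i{}_{kl}=-F\,\partial\Gamma^i_{jk}/\partial y^l$. Lowering convention: $R_{jikl}=\mathrm g_{im}R_j{}^m{}_{kl}$, and likewise for $P$ and $\widehat Q$ below. Frame bundle: $SO_2(TM\setminus M)$ is the $SO(2)$-principal bundle over $TM\setminus M$ of all $(x,y,(e_1,e_2,e_3))$ with $(e_a)$ a positively oriented $\mathrm g_{(x,y)}$-orthonormal basis of $T_xM$ such that $e_3=u$; $SO_2(SM)$ is its restriction to $SM=F^{-1}(1)$. Write $e_a=e_a^i\,\partial/\partial x^i$ and $(\omega^a_i)=(e^i_a)^{-1}$. Define the $1$-forms $\omega^a=\omega^a_i\,dx^i$, $\omega^{\bar a}=\omega^a_i\,\delta y^i/F$ (with $\bar a=a+3$), and $\omega_b{}^a=\omega^a_i(de^i_b+\Gamma^i_{jk}e^j_b\,dx^k)$. Frame indices are raised and lowered with $\delta_{ab}$: $\omega_{ab}=\omega_a{}^c\delta_{cb}$. The Cartan connection is $\widehat\omega_{ab}=\omega_{ab}+A_{abc}\,\omega^{\bar c}$ with $A_{abc}=A_{ijk}e^i_ae^j_be^k_c$; it is skew in $a,b$. Its curvature is $\widehat\Omega_b{}^a=d\widehat\omega_b{}^a-\widehat\omega_b{}^c\wedge\widehat\omega_c{}^a$, $\widehat\Omega_{ab}=\widehat\Omega_a{}^c\delta_{cb}$,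 decomposed as $\widehat\Omega_b{}^a=\tfrac12\widehat R_b{}^a{}_{cd}\,\omega^c\wedge\omega^d+\widehat P_b{}^a{}_{cd}\,\omega^c\wedge\omega^{\bar d}+\tfrac12\widehat Q_b{}^a{}_{cd}\,\omega^{\bar c}\wedge\omega^{\bar d}$, with $\widehat R,\widehat Q$ skew in $c,d$; this defines the tensor $\widehat Q$. The same symbols are used for pull-backs to $SO_2(SM)$. Spin tensor: in frame components, $S^{12}=-S^{21}=s$ and all other $S^{ab}=0$; in coordinates (positively oriented), $S_{ij}=s\sqrt{\det(\mathrm g_{lm}(x,u))}\,\epsilon_{ijk}u^k$, $S^{ij}=\mathrm g^{ik}\mathrm g^{jl}S_{kl}$, $S_j{}^i=S_{jk}\mathrm g^{ki}$. Further, $h_{ab}=\delta_{ab}-\delta^3_a\delta^3_b$; $\widehat\Omega(S)=\widehat\Omega_{ab}S^{ab}$; $R(S)_{kl}=R_{ijkl}S^{ij}$, $P(S)_{kl}=P_{ijkl}S^{ij}$, $\widehat Q(S)_{kl}=\widehat Q_{ijkl}S^{ij}$; $R(S)_k{}^j=R(S)_{kl}\mathrm g^{lj}$ and $P(S)_k{}^j=P(S)_{kl}\mathrm g^{lj}$. On $SM$ one has $y=u$, and $\partial/\partial u^i$ denotes the vertical vector $\partial/\partial y^i$ at $y=u$. *)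

(* Defs.v *)
From HB Require Import structures.
From mathcomp Require Import all_boot all_order all_algebra.
From mathcomp Require Import all_classical all_reals all_analysis.
Set Implicit Arguments.
Unset Strict Implicit.
Unset Printing Implicit Defensive.
Import Order.TTheory GRing.Theory Num.Theory.
Import numFieldNormedType.Exports.
Local Open Scope classical_set_scope.
Local Open Scope ring_scope.

Section Calculus.
Context {R : realType} {V W : normedModType R}.

Fixpoint Ck (k : nat) (O : set V) (f : V -> W) : Prop :=
  match k with
  | 0%N => forall z, O z -> {for z, continuous f}
  | k'.+1 => (forall z, O z -> differentiable f z) /\
             (forall v, Ck k' O ('D_v f))
  end.

(* Meant for open sets O of a finite dimensional space. *)
Definition smooth_on (O : set V) (f : V -> W) : Prop := forall k, Ck k O f.

End Calculus.

(* Differential forms on (an open subset of) a normed space V are families of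
   functions of the point and of tangent vectors, with the conventions
     (a /\ b)(v, w) = a(v) b(w) - a(w) b(v)
     da(X, Y) = X(a(Y)) - Y(a(X)) - a([X, Y]);
   d1 and d2 are the exterior derivative in degree 1 and 2, computed with
   constant vector fields. *)
Section Forms.
Context {R : realType} {V : normedModType R}.

Definition one_form := V -> V -> R.
Definition two_form := V -> V -> V -> R.

Definition wedge (a b : one_form) : two_form :=
  fun z v w => a z v * b z w - a z w * b z v.

Definition d1 (a : one_form) : two_form := fun z v w =>
  'D_v (fun z' => a z' w) z - 'D_w (fun z' => a z' v) z.

Definition d2 (b : two_form) (z u v w : V) : R :=
  'D_u (fun z' => b z' v w) z - 'D_v (fun z' => b z' u w) z
  + 'D_w (fun z' => b z' u v) z.

Definition smooth_two_form (O : set V) (b : two_form) : Prop :=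
  [/\ forall z v, O z -> scalar (b z v),
      forall z v w, O z -> b z v w = - b z w v &
      forall v w, smooth_on O (fun z => b z v w)].

(* Forms on an embedded submanifold S of V with tangent spaces T z (z in S):
   they are locally restrictions of smooth forms b on open sets of V, and
   their exterior derivative is the restriction of db, which does not depend
   on the extension b. Only the values of sigma z on T z are relevant. *)
Definition extends (S : set V) (T : V -> set V) (sigma : two_form)
    (O : set V) (b : two_form) : Prop :=
  [/\ open O, smooth_two_form O b &
      forall z v w, O z -> S z -> T z v -> T z w -> b z v w = sigma z v w].

Definition two_form_on (S : set V) (T : V -> set V) (sigma : two_form) : Prop :=
  forall z, S z -> exists O b, O z /\ extends S T sigma O b.

Definition closed_two_form_on (S : set V) (T : V -> set V) (sigma : two_form)
    : Prop :=
  forall z, S z -> exists O b, [/\ O z, extends S T sigma O b &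
    forall z' u v w, O z' -> S z' -> T z' u -> T z' v -> T z' w ->
      d2 b z' u v w = 0].

End Forms.

(* A smooth oriented atlas on a 3-dimensional manifold: chart i is
   meaningful on chart_dom i only, with inverse chart_inv i. *)
Record oriented_atlas (R : realType) (M : topologicalType) := OrientedAtlas {
  chart_index : Type;
  chart_dom : chart_index -> set M;
  chart : chart_index -> M -> 'rV[R]_3;
  chart_inv : chart_index -> 'rV[R]_3 -> M;
  chart_img := fun i => chart i @` chart_dom i;
  chart_cover : forall m, exists i, chart_dom i m;
  chart_dom_open : forall i, open (chart_dom i);
  chart_img_open : forall i, open (chart_img i);
  chartK : forall i m, chart_dom i m -> chart_inv i (chart i m) = m;
  chart_continuous : forall i, {within chart_dom i, continuous (chart i)};
  chart_inv_continuous :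
    forall i, {within chart_img i, continuous (chart_inv i)};
  transition := fun i j => chart j \o chart_inv i;
  transition_smooth : forall i j,
    smooth_on (chart i @` (chart_dom i `&` chart_dom j)) (transition i j);
  transition_oriented : forall i j m, chart_dom i m -> chart_dom j m ->
    0 < \det ('J (transition i j) (chart i m))
}.

Section Coordinates.
Variable R : realType.

(* TV is the model of TM in a chart, with points z = (x, y); it is also the
   model of the tangent spaces of TM. *)
Definition TV : Type := ('rV[R]_3 * 'rV[R]_3)%type.

Definition ix1 : 'I_3 := @Ordinal 3 0 isT.
Definition ix2 : 'I_3 := @Ordinal 3 1 isT.
Definition ix3 : 'I_3 := @Ordinal 3 2 isT.

Definition bv (i : 'I_3) : 'rV[R]_3 := delta_mx 0 i.

Definition kron (a b : 'I_3) : R := (a == b)%:R.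

(* Levi-Civita symbol; the product is 2, -2 or 0. *)
Definition levi (i j k : 'I_3) : R :=
  2^-1 * ((j%:R - i%:R) * (k%:R - i%:R) * (k%:R - j%:R)).

Definition dx (i : 'I_3) (f : TV -> R) : TV -> R := 'D_(bv i, 0) f.
Definition dy (i : 'I_3) (f : TV -> R) : TV -> R := 'D_(0, bv i) f.

(* Tensors with four indices; T j i k l stands for T_j^i_kl. *)
Definition tensor4 : Type := 'I_3 -> 'I_3 -> 'I_3 -> 'I_3 -> R.

(* Points of the frame bundle in a chart (and vectors tangent to it): (z, e)
   where the matrix entry e i a is the component e_a^i of the a-th vector. *)
Definition FB : Type := (TV * 'M[R]_3)%type.

(* F is the local expression of a Finsler function in a chart. *)
Variable F : TV -> R.

Definition gmx (z : TV) : 'M[R]_3 :=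
  \matrix_(i, j) dy j (dy i (fun z' => 2^-1 * F z' ^+ 2)) z.
Definition g (i j : 'I_3) (z : TV) : R := gmx z i j.
Definition ginv (i j : 'I_3) (z : TV) : R := invmx (gmx z) i j.

Definition uvec (z : TV) : 'rV[R]_3 := (F z)^-1 *: z.2.
Definition u (i : 'I_3) (z : TV) : R := uvec z 0 i.

Definition cartan_tensor (i j k : 'I_3) (z : TV) : R :=
  F z * dy k (dy j (dy i (fun z' => 4^-1 * F z' ^+ 2))) z.

Definition spray (j : 'I_3) (z : TV) : R :=
  2^-1 * \sum_k ginv j k z *
    (\sum_l dx l (dy k (fun z' => F z' ^+ 2)) z * z.2 0 l
     - dx k (fun z' => F z' ^+ 2) z).

(* nconn i j = N^i_j *)
Definition nconn (i j : 'I_3) (z : TV) : R := 2^-1 * dy j (spray i) z.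

Definition delta_dx (i : 'I_3) (f : TV -> R) (z : TV) : R :=
  dx i f z - \sum_j nconn j i z * dy j f z.

(* chern i j k = Gamma^i_jk *)
Definition chern (i j k : 'I_3) (z : TV) : R :=
  2^-1 * \sum_l ginv i l z *
    (delta_dx j (g k l) z + delta_dx k (g j l) z - delta_dx l (g j k) z).

Definition chernR (z : TV) : tensor4 := fun j i k l =>
  delta_dx k (chern i j l) z - delta_dx l (chern i j k) z
  + \sum_m (chern i m k z * chern m j l z - chern i m l z * chern m j k z).

Definition chernP (z : TV) : tensor4 := fun j i k l =>
  - F z * dy l (chern i j k) z.

(* T_jikl = g_im T_j^m_kl *)
Definition lower (z : TV) (T : tensor4) : tensor4 := fun j i k l =>
  \sum_m g i m z * T j m k l.

Definition coframe (a : 'I_3) : one_form := fun (q V : FB) =>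
  \sum_i invmx q.2 a i * V.1.1 0 i.

(* omega^{a+3} *)
Definition coframe_v (a : 'I_3) : one_form := fun (q V : FB) =>
  \sum_i invmx q.2 a i *
    ((V.1.2 0 i + \sum_j nconn i j q.1 * V.1.1 0 j) / F q.1).

(* omega_b^a; the first index is the lower one, also when the second index is
   lowered with the Kronecker symbol *)
Definition chern_form (b a : 'I_3) : one_form := fun (q V : FB) =>
  \sum_i invmx q.2 a i *
    (V.2 i b + \sum_j \sum_k chern i j k q.1 * q.2 j b * V.1.1 0 k).

Definition cartan_tensor_frame (a b c : 'I_3) (q : FB) : R :=
  \sum_i \sum_j \sum_k
    cartan_tensor i j k q.1 * q.2 i a * q.2 j b * q.2 k c.

Definition cartan_form (a b : 'I_3) : one_form := fun (q V : FB) =>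
  chern_form a b q V
  + \sum_c cartan_tensor_frame a b c q * coframe_v c q V.

(* The forms above are defined on the bundle of all linear frames; exterior
   derivatives are computed there and restricted to the adapted frames. *)
Definition cartan_curv (b a : 'I_3) : two_form := fun (q V W : FB) =>
  d1 (cartan_form b a) q V W
  - \sum_c wedge (cartan_form b c) (cartan_form c a) q V W.

Definition gram (a b : 'I_3) (q : FB) : R :=
  \sum_i \sum_j g i j q.1 * q.2 i a * q.2 j b.

Definition last_minus_u (i : 'I_3) (q : FB) : R := q.2 i ix3 - u i q.1.

(* SO_2(TM \ M) in the chart *)
Definition SO2_TM : set FB :=
  [set q | [/\ q.1.2 != 0, forall a b, gram a b q = kron a b,
               forall i, last_minus_u i q = 0 & 0 < \det q.2]].

(* The tangent space, as the kernel of the differentials of the defining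
   equations (which have constant rank). *)
Definition T_SO2_TM (q : FB) : set FB :=
  [set V | (forall a b, 'D_V (gram a b) q = 0) /\
           (forall i, 'D_V (last_minus_u i) q = 0)].

(* SM over the chart image O *)
Definition SM (O : set 'rV[R]_3) : set TV := [set z | O z.1 /\ F z = 1].

Definition T_SM (z : TV) : set TV := [set X | 'D_X F z = 0].

Definition SO2_SM (O : set 'rV[R]_3) : set FB :=
  [set q | SO2_TM q /\ SM O q.1].

Definition T_SO2_SM (q : FB) : set FB :=
  [set V | T_SO2_TM q V /\ T_SM q.1 V.1].

(* Components T_b^a_cd in the frame q *)
Definition frame_comp (T : tensor4) (q : FB) : tensor4 := fun b a c d =>
  \sum_j \sum_i \sum_k \sum_l
    T j i k l * q.2 j b * invmx q.2 a i * q.2 k c * q.2 l d.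

Definition skew_last (T : tensor4) : Prop :=
  forall j i k l, T j i k l = - T j i l k.

Definition curvature_decomposition (z : TV) (Rh Ph Qh : tensor4) : Prop :=
  [/\ skew_last Rh, skew_last Qh &
  forall (q V W : FB) (b a : 'I_3),
    SO2_TM q -> q.1 = z -> T_SO2_TM q V -> T_SO2_TM q W ->
    cartan_curv b a q V W =
      2^-1 * (\sum_c \sum_d frame_comp Rh q b a c d *
                wedge (coframe c) (coframe d) q V W)
      + \sum_c \sum_d frame_comp Ph q b a c d *
                wedge (coframe c) (coframe_v d) q V W
      + 2^-1 * (\sum_c \sum_d frame_comp Qh q b a c d *
                wedge (coframe_v c) (coframe_v d) q V W)].

(* The tensor Q of the Cartan connection at z: the decomposition determines
   Rh, Ph and Qh. *)
Definition cartanQ (z : TV) : tensor4 :=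
  get [set Qh | exists Rh Ph, curvature_decomposition z Rh Ph Qh].

Section Spin.
Variables p s : R.

(* frame components S^{ab} = S_{ab} *)
Definition spin_frame (a b : 'I_3) : R :=
  s * (kron a ix1 * kron b ix2 - kron a ix2 * kron b ix1).

(* coordinate components S_ij, S^ij and S_j^i *)
Definition spin_low (i j : 'I_3) (z : TV) : R :=
  s * Num.sqrt (\det (gmx (z.1, uvec z))) * \sum_k levi i j k * u k z.
Definition spin_up (i j : 'I_3) (z : TV) : R :=
  \sum_k \sum_l ginv i k z * ginv j l z * spin_low k l z.
Definition spin_mix (j i : 'I_3) (z : TV) : R :=
  \sum_k spin_low j k z * ginv k i z.

(* T(S)_kl, T(S)(S) and T(S)_k^j *)
Definition on_spin (T : TV -> tensor4) (k l : 'I_3) (z : TV) : R :=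
  \sum_i \sum_j lower z (T z) i j k l * spin_up i j z.
Definition on_spin2 (T : TV -> tensor4) (z : TV) : R :=
  \sum_k \sum_l on_spin T k l z * spin_up k l z.
Definition on_spin_mix (T : TV -> tensor4) (k j : 'I_3) (z : TV) : R :=
  \sum_l on_spin T k l z * ginv l j z.

Definition hframe (a b : 'I_3) : R := kron a b - kron a ix3 * kron b ix3.

(* The 2-form on SO_2(SM) to be pushed down to SM *)
Definition sigma_frame : two_form := fun (q V W : FB) =>
  p * (\sum_a \sum_b hframe a b * wedge (coframe_v a) (coframe b) q V W)
  + 2^-1 * (\sum_a \sum_b spin_frame a b * cartan_curv a b q V W)
  - 2^-1 * (\sum_a \sum_b spin_frame a b *
              wedge (coframe_v a) (coframe_v b) q V W).

Definition potential : one_form := fun (q V : FB) =>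
  p * coframe ix3 q V + s * cartan_form ix1 ix2 q V.

(* beta descends to sigma: beta is the pull-back of sigma by the projection
   SO_2(SM) -> SM *)
Definition descends (O : set 'rV[R]_3) (beta : FB -> FB -> FB -> R)
    (sigma : TV -> TV -> TV -> R) : Prop :=
  forall q V W, SO2_SM O q -> T_SO2_SM q V -> T_SO2_SM q W ->
    sigma q.1 V.1 W.1 = beta q V W.

Definition Delta (z : TV) : R :=
  s * (1 - (4 * s ^+ 2)^-1 * on_spin2 cartanQ z).

Definition Sigma (z : TV) : R :=
  (Delta z)^-1 *
    (p ^+ 2
     - 2^-1 * p * (\sum_i \sum_j on_spin chernP i j z * ginv i j z)
     + (8 * s ^+ 2)^-1 *
       (\sum_i \sum_j \sum_k \sum_l
          on_spin chernP i k z * on_spin chernP j l z *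
          spin_up i j z * spin_up k l z))
  + (4 * s)^-1 * on_spin2 chernR z.

Definition hor_vec (i : 'I_3) (z : TV) : TV :=
  (bv i, - (\sum_j nconn j i z *: bv j)).
Definition ver_vec (i : 'I_3) : TV := (0, bv i).

Definition char_hor (i : 'I_3) (z : TV) : R :=
  u i z + (2 * s * Sigma z)^-1 *
    (\sum_j \sum_k spin_mix j i z * on_spin_mix chernR k j z * u k z).

Definition char_ver (i : 'I_3) (z : TV) : R :=
  (2 * s ^+ 2 * Delta z * Sigma z)^-1 *
    (\sum_j \sum_k \sum_l \sum_m
       spin_mix j i z * (p * kron j k - 2^-1 * on_spin_mix chernP k j z) *
       spin_mix l k z * on_spin_mix chernR m l z * u m z).

Definition char_vec (z : TV) : TV :=
  \sum_i char_hor i z *: hor_vec i z + \sum_i char_ver i z *: ver_vec i.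

(* SM \ (Delta^-1(0) U Sigma^-1(0)) *)
Definition SM_reg (O : set 'rV[R]_3) : set TV :=
  [set z | [/\ SM O z, Delta z != 0 & Sigma z != 0]].

End Spin.

Definition ker_form (T : TV -> set TV) (sigma : TV -> TV -> TV -> R) (z : TV)
    : set TV :=
  [set X | T z X /\ forall Y, T z Y -> sigma z X Y = 0].

(* The rank of sigma at z: the rank of its matrix in a basis of T z. *)
Definition rank_form (T : TV -> set TV) (sigma : TV -> TV -> TV -> R) (z : TV)
    (r : nat) : Prop :=
  exists n (b : n.-tuple TV),
    [/\ free b, forall X, T z X <-> X \in <<b>>%VS &
        \rank (\matrix_(i < n, j < n) sigma z (tnth b i) (tnth b j)) = r].

Definition presymplectic (S : set TV) (T : TV -> set TV)
    (sigma : TV -> TV -> TV -> R) (r : nat) : Prop :=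
  [/\ two_form_on S T sigma, closed_two_form_on S T sigma &
      forall z, S z -> rank_form T sigma z r].

End Coordinates.

(* A Finsler structure on M, given by its local expressions F i (x, y) in the
   charts: together they form one function on TM, the tangent vector with
   components y in the chart i having components 'd (transition i j) y in the
   chart j. *)
Record finsler (R : realType) (M : topologicalType) (At : oriented_atlas R M) :=
  Finsler {
  F_loc :> chart_index At -> TV R -> R;
  F_glue : forall i j m y, chart_dom i m -> chart_dom j m ->
    F_loc j (chart j m, 'd (transition i j) (chart i m) y)
      = F_loc i (chart i m, y);
  F_ge0 : forall i x y, chart_img i x -> 0 <= F_loc i (x, y);
  F_smooth : forall i,
    smooth_on [set z | chart_img i z.1 /\ z.2 != 0] (F_loc i);
  F_homogeneous : forall i x y (k : R), chart_img i x -> 0 < k ->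
    F_loc i (x, k *: y) = k * F_loc i (x, y);
  F_convex : forall i x y (v : 'rV[R]_3), chart_img i x -> y != 0 -> v != 0 ->
    0 < \sum_j \sum_k gmx (F_loc i) (x, y) j k * v 0 j * v 0 k
}.

(* Main.v *)
Require Import Defs.
From HB Require Import structures.
From mathcomp Require Import all_boot all_order all_algebra.
From mathcomp Require Import all_classical all_reals all_analysis.
From mathcomp Require Import ring lra.
Set Implicit Arguments.
Unset Strict Implicit.
Unset Printing Implicit Defensive.
Import Order.TTheory GRing.Theory Num.Theory.
Import numFieldNormedType.Exports.
Local Open Scope classical_set_scope.
Local Open Scope ring_scope.

(* On adapted frames sigma is d(p omega^3 + s omega_12), by the first structure
   equation for omega^3 and the definition of the curvature of omega_12. The
   bivector S^ab e_a e_b is the same for all adapted frames at a point, so that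
   sigma has an expression in coordinates without frames, which is its descent
   to SM. A local adapted frame, obtained by Gram-Schmidt, pulls the potential
   back to a local primitive of sigma; hence sigma is closed.

   In an adapted frame X has components x1, x2, x3 (horizontal) and x1', x2'
   (vertical, the third one vanishes on SM). Since the contraction of the
   P-curvature with u is the Landsberg tensor, which is symmetric, P(S)_3b = 0,
   and pairing X with vertical vectors expresses Delta x1' and Delta x2' by x1
   and x2. Substituting in the remaining equations yields Sigma x1 and Sigma x2
   as multiples of x3. So the kernel is a line in the five-dimensional tangent
   space of SM, and the rank is 4. *)


(** * Smooth functions on open sets *)

(** The Cartan form is skew and the Gram matrix constant on adapted frames only, a set without
    interior, while [cartan_curv] differentiates on the open set of all linear frames. So facts
    about adapted frames come from identities valid on all frames, differentiated in directions
    tangent to the bundle. The decisive one: the symmetrized Cartan form equals the differential of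
    the Gram matrix up to terms that vanish at adapted frames together with their tangential
    derivatives. Symmetry of second derivatives then makes the exterior derivative of the Cartan
    form skew. The tensor Q is given by a choice among decompositions; evaluation on lifts of
    vertical vectors shows that every decomposition has the commutator of Cartan tensors as its Q.
    The functions Delta and Sigma come from an elimination: with [M = p - P(S)/2] on the plane of
    e_1, e_2 and [J] the quarter turn, the vertical equations read [Delta x' = J M^T x], and
    [M J M^T = det M J] reduces the horizontal ones to scalar equations with coefficient
    [Sigma = det M / Delta + R(S)_12 / 2]. *)

Lemma near_open (T : topologicalType) (O : set T) (P : T -> Prop) z :
  open O -> O z -> (forall y, O y -> P y) -> \forall y \near z, P y.
Proof.
by move=> oO Oz OP; apply: filterS (open_nbhs_nbhs (conj oO Oz)).
Qed.

Section SmoothCalculus.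
Context {R : realType} {V : normedModType R}.
Implicit Types (O : set V) (f g : V -> R) (v w z : V).

Lemma derive_congr (W : normedModType R) O (f g : V -> W) v z :
  open O -> O z -> (forall y, O y -> f y = g y) -> 'D_v f z = 'D_v g z.
Proof. by move=> oO Oz fg; apply: near_eq_derive; apply: (near_open oO Oz). Qed.

Lemma differentiable_congr O f g z : open O -> O z ->
  (forall y, O y -> f y = g y) -> differentiable f z -> differentiable g z.
Proof.
move=> oO Oz fg df.
have /eqaddoP dfE := diff_locally df.
have dgE : g \o shift z = cst (g z) + 'd f z +o_ 0 id.
  apply/eqaddoP => e e0; have := dfE e e0; apply: filter_app.
  have : \forall h \near (0 : V), O (h + z).
    have : \forall y \near z, O y by exact: open_nbhs_nbhs.
    by rewrite (near_shift 0) subr0.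
  apply: filterS => h Oh.
  by rewrite /= -![(_ + _ : _ -> _) _]/(_ + _) -![(- _ : _ -> _) _]/(- _) /= !fg.
have dgf : 'd g z = 'd f z :> (V -> R).
  by apply: diff_unique dgE; exact: diff_continuous.
apply/diff_locallyP; split; last by rewrite dgf.
by rewrite dgf; exact: diff_continuous.
Qed.

(** The recursion in [Ck] meets derivatives that agree with the expressions given by the calculus
    rules on [O] only; this lemma exchanges the two. *)
Lemma Ck_ext k O f g : open O -> (forall y, O y -> f y = g y) ->
  Ck k O f -> Ck k O g.
Proof.
move=> oO; elim: k f g => [|k IH] f g fg /=.
  move=> cf z Oz; rewrite /prop_for /continuous_at -(fg _ Oz).
  apply: cvg_trans (cf z Oz); apply: near_eq_cvg.
  by apply: (near_open oO Oz).
case=> df cf; split=> [z Oz|v].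
  exact: (differentiable_congr oO Oz fg (df z Oz)).
apply: IH (cf v) => y Oy; exact: (derive_congr v oO Oy).
Qed.

Lemma CkS k O f : Ck k.+1 O f -> Ck k O f.
Proof.
elim: k f => [|k IH] f /= [df cf]; first by move=> z Oz; apply: differentiable_continuous; exact: df.
by split=> // v; apply: IH; apply: cf.
Qed.

Lemma CkD k O f g : open O -> Ck k O f -> Ck k O g -> Ck k O (fun z => f z + g z).
Proof.
move=> oO; elim: k f g => [|k IH] f g /=.
  by move=> cf cg z Oz; apply: continuousD; [exact: cf|exact: cg].
move=> [df cf] [dg cg]; split=> [z Oz|v]; first by apply: differentiableD; [exact: df|exact: dg].
apply: Ck_ext (IH _ _ (cf v) (cg v)) => // y Oy.
by rewrite deriveD //; apply: diff_derivable; [exact: df|exact: dg].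
Qed.

Lemma CkM k O f g : open O -> Ck k O f -> Ck k O g -> Ck k O (fun z => f z * g z).
Proof.
move=> oO; elim: k f g => [|k IH] f g.
  by move=> cf cg z Oz; apply: continuousM; [exact: cf|exact: cg].
move=> cf cg; have [cf' cg'] := (CkS cf, CkS cg); case: cf cg => [df cf] [dg cg].
split=> [z Oz|v]; first by apply: differentiableM; [exact: df|exact: dg].
apply: Ck_ext (CkD oO (IH _ _ cf' (cg v)) (IH _ _ cg' (cf v))) => // y Oy.
by rewrite deriveM //; apply: diff_derivable; [exact: df|exact: dg].
Qed.

Lemma Ck_cst k O (c : R) : open O -> Ck k O (fun=> c).
Proof.
move=> oO; elim: k c => [|k IH] c /=; first by move=> z _; apply: cst_continuous.
split=> [z Oz|v]; first exact: differentiable_cst.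
by apply: Ck_ext (IH 0) => // y Oy; rewrite derive_cst.
Qed.

(** The derivative of [1/f] contains [1/f] again, which the induction hypothesis covers one order
    lower; [Ck_sqrt] follows the same pattern. *)
Lemma CkV k O f : open O -> (forall z, O z -> f z != 0) -> Ck k O f ->
  Ck k O (fun z => (f z)^-1).
Proof.
move=> oO f0; elim: k => [|k IH].
  by move=> cf z Oz; apply: continuousV; [exact: f0|exact: cf].
move=> cf; have cV := IH (CkS cf); case: cf => df cf.
split=> [z Oz|v]; first by apply: differentiableV; [exact: df|exact: f0].
apply: Ck_ext (CkM oO (Ck_cst k (-1) oO) (CkM oO (CkM oO cV cV) (cf v))) => // y Oy.
rewrite (@deriveV _ _ f y v); [|exact: f0|by apply: diff_derivable; exact: df].
by rewrite -[_ *: _]/(_ * _) expr2 invfM; ring.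
Qed.

Lemma derive_sqrt f v z : differentiable f z -> 0 < f z ->
  differentiable (fun z => Num.sqrt (f z)) z /\
  'D_v (fun z => Num.sqrt (f z)) z = (2 * Num.sqrt (f z))^-1 * 'D_v f z.
Proof.
move=> df f0.
have ds := is_derive1_sqrt f0.
have ds1 : differentiable (@Num.sqrt R) (f z) by apply/derivable1_diffP.
have dc : differentiable (@Num.sqrt R \o f) z by apply: differentiable_comp.
split; first exact: dc.
rewrite -[LHS]/('D_v (Num.sqrt \o f) z) deriveE // diff_comp //= (deriveE _ df).
set y := 'd f z v.
have -> : 'd (@Num.sqrt R) (f z) y = y *: 'd (@Num.sqrt R) (f z) 1.
  by rewrite -linearZ -[_ *: 1]/(y * 1) mulr1.
by rewrite -deriveE // derive_val -[_ *: _]/(y * _) mulrC.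
Qed.

Lemma Ck_sqrt k O f : open O -> (forall z, O z -> 0 < f z) -> Ck k O f ->
  Ck k O (fun z => Num.sqrt (f z)).
Proof.
move=> oO f0; elim: k => [|k IH].
  by move=> cf z Oz; apply: continuous_comp; [exact: cf|exact: sqrt_continuous].
move=> cf; have cs := IH (CkS cf); case: cf => df cf.
split=> [z Oz|v]; first by have [] := derive_sqrt 0 (df z Oz) (f0 z Oz).
have s0 z : O z -> 2 * Num.sqrt (f z) != 0.
  by move=> Oz; rewrite mulf_neq0 // gt_eqF // sqrtr_gt0 f0.
apply: Ck_ext (CkM oO (CkV oO s0 (CkM oO (Ck_cst k 2 oO) cs)) (cf v)) => // y Oy.
by have [_ ->] := derive_sqrt v (df y Oy) (f0 y Oy).
Qed.

Lemma Ck_linear k O f : open O -> scalar f -> continuous f -> Ck k O f.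
Proof.
move=> oO lf cf; pose L : {linear V -> R} :=
  HB.pack_for {linear V -> R} f (GRing.isLinear.Build _ _ _ _ f lf).
have dL z : differentiable f z by exact: (@linear_differentiable _ _ _ L).
case: k => [|k] /=; first by move=> z _; exact: cf.
split=> // v; apply: Ck_ext (Ck_cst k (f v) oO) => // y Oy.
by rewrite deriveE // (@diff_lin _ _ _ L).
Qed.

Lemma smooth_ext O f g : open O -> (forall y, O y -> f y = g y) ->
  smooth_on O f -> smooth_on O g.
Proof. by move=> oO fg sf k; apply: Ck_ext (sf k). Qed.

Lemma smooth_cst O (c : R) : open O -> smooth_on O (fun=> c).
Proof. by move=> oO k; exact: Ck_cst. Qed.

Lemma smoothD O f g : open O -> smooth_on O f -> smooth_on O g ->
  smooth_on O (fun z => f z + g z).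
Proof. by move=> oO sf sg k; exact: CkD. Qed.

Lemma smoothM O f g : open O -> smooth_on O f -> smooth_on O g ->
  smooth_on O (fun z => f z * g z).
Proof. by move=> oO sf sg k; exact: CkM. Qed.

Lemma smoothN O f : open O -> smooth_on O f -> smooth_on O (fun z => - f z).
Proof.
move=> oO sf; apply: smooth_ext (smoothM oO (smooth_cst (-1) oO) sf) => // y _.
by rewrite mulN1r.
Qed.

Lemma smoothB O f g : open O -> smooth_on O f -> smooth_on O g ->
  smooth_on O (fun z => f z - g z).
Proof. by move=> oO sf sg; apply: smoothD => //; exact: smoothN. Qed.

Lemma smoothV O f : open O -> (forall z, O z -> f z != 0) -> smooth_on O f ->
  smooth_on O (fun z => (f z)^-1).
Proof. by move=> oO f0 sf k; exact: CkV. Qed.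

Lemma smooth_sqrt O f : open O -> (forall z, O z -> 0 < f z) -> smooth_on O f ->
  smooth_on O (fun z => Num.sqrt (f z)).
Proof. by move=> oO f0 sf k; exact: Ck_sqrt. Qed.

Lemma smooth_sum O (I : Type) (r : seq I) (P : pred I) (f : I -> V -> R) :
  open O -> (forall i, smooth_on O (f i)) ->
  smooth_on O (fun z => \sum_(i <- r | P i) f i z).
Proof.
move=> oO sf; elim: r => [|i r IH].
  by apply: smooth_ext (smooth_cst 0 oO) => // y _; rewrite big_nil.
case Pi : (P i); last first.
  by apply: smooth_ext IH => // y _; rewrite big_cons Pi.
by apply: smooth_ext (smoothD oO (sf i) IH) => // y _; rewrite big_cons Pi.
Qed.

Lemma smooth_prod O (I : Type) (r : seq I) (P : pred I) (f : I -> V -> R) :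
  open O -> (forall i, smooth_on O (f i)) ->
  smooth_on O (fun z => \prod_(i <- r | P i) f i z).
Proof.
move=> oO sf; elim: r => [|i r IH].
  by apply: smooth_ext (smooth_cst 1 oO) => // y _; rewrite big_nil.
case Pi : (P i); last first.
  by apply: smooth_ext IH => // y _; rewrite big_cons Pi.
by apply: smooth_ext (smoothM oO (sf i) IH) => // y _; rewrite big_cons Pi.
Qed.

Lemma smooth_derive O f v : smooth_on O f -> smooth_on O ('D_v f).
Proof. by move=> sf k; have [_] := sf k.+1; exact. Qed.

Lemma smooth_differentiable O f z : smooth_on O f -> O z -> differentiable f z.
Proof. by move=> sf Oz; have [+ _] := sf 1%N; exact. Qed.

Lemma smooth_derivable O f z v : smooth_on O f -> O z -> derivable f z v.
Proof. by move=> sf Oz; apply: diff_derivable; exact: smooth_differentiable Oz. Qed.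

Lemma smooth_linear O f : open O -> scalar f -> continuous f -> smooth_on O f.
Proof. by move=> oO lf cf k; exact: Ck_linear. Qed.

(** Makes results in one variable, the mean value theorem and the power rule, available along
    lines. *)
Lemma is_derive_line f (a v : V) t : derivable f (t *: v + a) v ->
  is_derive t 1 (fun x : R => f (x *: v + a)) ('D_v f (t *: v + a)).
Proof.
have E : (fun h : R => h^-1 *: ((f \o shift (t *: v + a)) (h *: v) - f (t *: v + a)))
  = (fun h : R => h^-1 *: (((fun x : R => f (x *: v + a)) \o shift t) (h *: 1)
       - f (t *: v + a))).
  apply/funext => h /=; rewrite addrA -scalerDl.
  by rewrite -[h *: 1]/(h * 1) mulr1.
by rewrite /derivable E => d; split; [|rewrite /derive E].
Qed.

Lemma derive_approx f z : differentiable f z -> forall e, 0 < e ->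
  exists2 d, 0 < d & forall k, `|k| < d ->
    `|f (k + z) - f z - 'd f z k| <= e * `|k|.
Proof.
move=> df e e0; have /eqaddoP /(_ e e0) := diff_locally df.
rewrite -nbhs_nearE => /nbhs_ballP[d /= d0 H]; exists d => // k kd.
have : ball (0 : V) d k by rewrite -ball_normE /= sub0r normrN.
move=> /H /=; rewrite -![(_ + _ : _ -> _) _]/(_ + _) -![(- _ : _ -> _) _]/(- _) /=.
by rewrite -![(_ + _ : _ -> _) _]/(_ + _) opprD addrA.
Qed.

(** The mean value theorem reduces the second difference to a first difference of ['D_v f], which
    differentiability at [z] approximates. *)
Lemma second_difference O f v w z : open O -> O z -> smooth_on O f ->
  forall e, 0 < e -> exists2 d, 0 < d & forall h, 0 < h -> h < d ->
    `|f (h *: v + (h *: w + z)) - f (h *: w + z) - (f (h *: v + z) - f z)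
      - h ^+ 2 * 'D_w ('D_v f) z| <= e * h ^+ 2.
Proof.
move=> oO Oz sf e e0.
have dDf : differentiable ('D_v f) z.
  by apply: smooth_differentiable Oz; exact: smooth_derive.
(* Both increments used below have norm at most [h (|v| + |w|)], so their two errors together cost
   twice that; the summand 1 keeps [C] positive when [v] and [w] vanish. *)
set C := (`|v| + `|w|) * 2 + 1.
have C0 : 0 < C by rewrite /C ltr_wpDl // mulr_ge0 // addr_ge0.
have [d1 d10 H1] := derive_approx dDf (divr_gt0 e0 C0).
have /nbhs_ballP[d2 /= d20 H2] : nbhs z O by exact: open_nbhs_nbhs.
have inO k : `|k| < d2 -> O (k + z).
  move=> kd; apply: H2; rewrite -ball_normE /=.
  by rewrite opprD addrCA subrr addr0 normrN.
exists (Num.min d1 d2 / C) => [|h h0]; first by rewrite divr_gt0 // lt_min d10.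
rewrite ltr_pdivlMr // lt_min => /andP[hd1 hd2].
have small t : 0 <= t -> t <= h -> `|t *: v + h *: w| <= h * (`|v| + `|w|).
  move=> t0 th; apply: le_trans (ler_normD _ _) _.
  rewrite !normrZ (ger0_norm t0) (gtr0_norm h0) mulrDr lerD2r.
  exact: ler_wpM2r.
have small' t : 0 <= t -> t <= h -> `|t *: v| <= h * (`|v| + `|w|).
  move=> t0 th; rewrite normrZ (ger0_norm t0).
  apply: (@le_trans _ _ (h * `|v|)); first exact: ler_wpM2r.
  by rewrite mulrDr lerDl mulr_ge0 // ltW.
have hC : h * (`|v| + `|w|) < h * C.
  rewrite ltr_pM2l // /C mulr2n -subr_gt0.
  have : 0 <= `|v| + `|w| by rewrite addr_ge0.
  by move=> ?; lra.
have Ot t : 0 <= t -> t <= h -> O (t *: v + (h *: w + z)) /\ O (t *: v + z).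
  move=> t0 th; split; [rewrite addrA|]; apply: inO.
    exact: le_lt_trans (small t t0 th) (lt_trans hC hd2).
  exact: le_lt_trans (small' t t0 th) (lt_trans hC hd2).
pose phi (t : R) := f (t *: v + (h *: w + z)) - f (t *: v + z).
pose dphi (t : R) := 'D_v f (t *: v + (h *: w + z)) - 'D_v f (t *: v + z).
have dphiP t : 0 <= t -> t <= h -> is_derive t 1 phi (dphi t).
  move=> t0 th; have [in1 in2] := Ot t t0 th.
  by apply: is_deriveB; apply: is_derive_line; exact: smooth_derivable sf _.
have [c [c0 ch] Hc] : exists2 c, 0 < c /\ c < h & phi h - phi 0 = dphi c * (h - 0).
  have [||c] := @MVT R phi dphi 0 h h0.
  - by move=> x; rewrite in_itv /= => /andP[x0 xh]; apply: dphiP; exact: ltW.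
  - apply: derivable_within_continuous => x; rewrite in_itv /= => /andP[x0 xh].
    by have [] := dphiP x x0 xh.
  - by rewrite in_itv /= => /andP[c0 ch] Hc; exists c.
move: Hc; rewrite /phi !scale0r !add0r subr0 => Hphi.
have -> : f (h *: v + (h *: w + z)) - f (h *: w + z) - (f (h *: v + z) - f z)
  = dphi c * h by rewrite -Hphi; ring.
have [cle hle] := (ltW c0, ltW ch).
have K1 := H1 (c *: v + h *: w) (le_lt_trans (small c cle hle) (lt_trans hC hd1)).
have K2 := H1 (c *: v) (le_lt_trans (small' c cle hle) (lt_trans hC hd1)).
have -> : dphi c * h - h ^+ 2 * 'D_w ('D_v f) z = h *
   (('D_v f (c *: v + h *: w + z) - 'D_v f z - 'd ('D_v f) z (c *: v + h *: w))
   - ('D_v f (c *: v + z) - 'D_v f z - 'd ('D_v f) z (c *: v))).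
  have Dw : 'd ('D_v f) z (h *: w) = h * 'D_w ('D_v f) z.
    by rewrite deriveE // [LHS]linearZ.
  rewrite [X in _ - X - _]linearD Dw /dphi -[c *: v + h *: w + z]addrA.
  by ring.
rewrite normrM (gtr0_norm h0) expr2 mulrCA ler_pM2l //.
apply: le_trans (ler_normB _ _) _; apply: le_trans (lerD K1 K2) _.
rewrite -mulrDr -mulrA ler_pM2l // ler_pdivrMl //.
apply: le_trans (lerD (small c cle hle) (small' c cle hle)) _.
rewrite /C; set n := `|v| + `|w|; rewrite -subr_ge0.
have -> : (n * 2 + 1) * h - (h * n + h * n) = h by ring.
exact: ltW.
Qed.

(** The second difference is symmetric in [v] and [w], and divided by [h^2] it is close to either
    mixed derivative. *)
Lemma derive_comm O f v w z : open O -> O z -> smooth_on O f ->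
  'D_v ('D_w f) z = 'D_w ('D_v f) z.
Proof.
move=> oO Oz sf; apply/eqP; rewrite -subr_eq0 -normr_le0; apply/ler_addgt0Pl => e e0.
rewrite addr0; have e20 : 0 < e / 2 by rewrite divr_gt0.
have [d1 d10 H1] := second_difference v w oO Oz sf e20.
have [d2 d20 H2] := second_difference w v oO Oz sf e20.
pose h := Num.min d1 d2 / 2.
have m0 : 0 < Num.min d1 d2 by rewrite lt_min d10.
have h0 : 0 < h by rewrite divr_gt0.
have : h < Num.min d1 d2 by rewrite /h ltr_pdivrMr // ltr_pMr // ltr1n.
rewrite lt_min => /andP[hd1 hd2].
have := H1 h h0 hd1; have := H2 h h0 hd2.
rewrite [h *: w + (h *: v + z)]addrCA.
set A := f _; set B := f _; set B' := f _; set D := f z.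
set X := 'D_w _ z; set Y := 'D_v _ z => K2 K1.
have h20 : 0 < h ^+ 2 by rewrite exprn_gt0.
rewrite -(ler_pM2l h20) -[X in X * `|_|]gtr0_norm // -normrM.
have -> : h ^+ 2 * (Y - X) = (A - B' - (B - D) - h ^+ 2 * X) - (A - B - (B' - D) - h ^+ 2 * Y).
  ring.
apply: le_trans (ler_normB _ _) _; apply: le_trans (lerD K1 K2) _.
by rewrite -mulrDl -splitr mulrC.
Qed.

End SmoothCalculus.

Lemma sum3 (R : nmodType) (f : 'I_3 -> R) :
  \sum_i f i = f ix1 + f ix2 + f ix3.
Proof.
rewrite !big_ord_recl big_ord0 addr0 addrA.
by congr (f _ + f _ + f _); apply: val_inj.
Qed.

Section SmoothDerivatives.
Context {R : realType} {V : normedModType R}.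
Variable (D : set V).
Implicit Types (a b : V -> R) (v z : V).

Lemma sderiveD a b v z : smooth_on D a -> smooth_on D b -> D z ->
  'D_v (fun z => a z + b z) z = 'D_v a z + 'D_v b z.
Proof. by move=> sa sb Dz; rewrite deriveD //; apply: smooth_derivable Dz. Qed.

Lemma sderiveB a b v z : smooth_on D a -> smooth_on D b -> D z ->
  'D_v (fun z => a z - b z) z = 'D_v a z - 'D_v b z.
Proof. by move=> sa sb Dz; rewrite deriveB //; apply: smooth_derivable Dz. Qed.

Lemma sderiveM a b v z : smooth_on D a -> smooth_on D b -> D z ->
  'D_v (fun z => a z * b z) z = a z * 'D_v b z + 'D_v a z * b z.
Proof.
move=> sa sb Dz; rewrite deriveM; try exact: smooth_derivable Dz.
by rewrite -![_ *: _]/(_ * _) [b z * _]mulrC.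
Qed.

Lemma sderiveZ c a v z : smooth_on D a -> D z ->
  'D_v (fun z => c * a z) z = c * 'D_v a z.
Proof. by move=> sa Dz; rewrite deriveZ //; apply: smooth_derivable Dz. Qed.

Lemma sderive_sum n (a : 'I_n -> V -> R) v z : (forall i, smooth_on D (a i)) ->
  D z -> 'D_v (fun z => \sum_i a i z) z = \sum_i 'D_v (a i) z.
Proof.
move=> sa Dz; rewrite -derive_sum; last by move=> i; apply: smooth_derivable Dz.
by congr (derive _ z v); apply/funext => y; rewrite fct_sumE.
Qed.
End SmoothDerivatives.

(** * Partial derivatives on the slit tangent bundle and Euler's relation *)

Section Coordinates.
Context {R : realType}.
Local Notation TV := (TV R).
Implicit Types (D : set TV) (f : TV -> R) (z v : TV).

Lemma sum_kron (f : 'I_3 -> R) j : \sum_i kron R i j * f i = f j.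
Proof.
rewrite (bigD1 j) //= big1 => [|i ij]; first by rewrite /kron eqxx mul1r addr0.
by rewrite /kron (negPf ij) mul0r.
Qed.

Lemma kronC i j : kron R i j = kron R j i.
Proof. by rewrite /kron eq_sym. Qed.

Lemma scalar_ycoord i : scalar (fun z : TV => z.2 0 i).
Proof. by move=> a u v; rewrite !mxE. Qed.

Lemma continuous_ycoord i : continuous (fun z : TV => z.2 0 i).
Proof.
move=> z; apply: (@continuous_comp _ _ _ (@snd _ _) (fun x : 'rV[R]_3 => x 0 i)).
  exact: cvg_snd.
exact: coord_continuous.
Qed.

Lemma smooth_ycoord D i : open D -> smooth_on D (fun z : TV => z.2 0 i).
Proof.
by move=> oD; apply: smooth_linear oD (scalar_ycoord i) (@continuous_ycoord i).
Qed.

Lemma derive_scalar (V : normedModType R) (f : V -> R) (z v : V) :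
  scalar f -> 'D_v f z = f v.
Proof.
move=> lf; rewrite /derive; apply: lim_near_cst => //.
near=> h; have h0 : h != 0 by near: h; exact: nbhs_dnbhs_neq.
by rewrite /= lf addrK -[_ *: (_ *: _)]/(_ * (_ * _)) mulKf.
Unshelve. all: by end_near. Qed.

Lemma dy_ycoord i j z : dy j (fun z => z.2 0 i) z = kron R i j.
Proof.
rewrite /dy derive_scalar; last exact: scalar_ycoord.
by rewrite /= /bv mxE eqxx.
Qed.

Lemma dx_ycoord i j z : dx j (fun z => z.2 0 i) z = 0.
Proof. by rewrite /dx derive_scalar; [rewrite mxE|exact: scalar_ycoord]. Qed.

Lemma TV_basis v : v = \sum_i v.1 0 i *: ((bv R i, 0) : TV)
  + \sum_i v.2 0 i *: ((0, bv R i) : TV).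
Proof.
case: v => v w /=; rewrite !sum3; apply/pair_equal_spec; split=> /=.
  rewrite !scaler0 !addr0; apply/rowP => j; rewrite !mxE /=.
  by case: j => -[|[|[|//]]] ? /=; rewrite ?mulr1 ?mulr0 ?addr0 ?add0r;
    congr (v _ _); apply: val_inj.
rewrite !scaler0 !add0r; apply/rowP => j; rewrite !mxE /=.
by case: j => -[|[|[|//]]] ? /=; rewrite ?mulr1 ?mulr0 ?addr0 ?add0r;
  congr (w _ _); apply: val_inj.
Qed.

Lemma derive_coord f z v : differentiable f z ->
  'D_v f z = \sum_i v.1 0 i * dx i f z + \sum_i v.2 0 i * dy i f z.
Proof.
move=> df; rewrite deriveE // [in LHS](TV_basis v) linearD !linear_sum /=.
congr (_ + _); apply: eq_bigr => i _; rewrite linearZ /= /dx /dy deriveE //.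
Qed.


Section PartialDerivatives.
Variable (D : set TV).
Hypothesis oD : open D.
Implicit Types (a b : TV -> R).

Lemma dy_congr a b j z : D z -> (forall y, D y -> a y = b y) -> dy j a z = dy j b z.
Proof. by move=> Dz ab; apply: (derive_congr _ oD). Qed.

Lemma dx_congr a b j z : D z -> (forall y, D y -> a y = b y) -> dx j a z = dx j b z.
Proof. by move=> Dz ab; apply: (derive_congr _ oD). Qed.

Lemma dyD a b j z : smooth_on D a -> smooth_on D b -> D z ->
  dy j (fun z => a z + b z) z = dy j a z + dy j b z.
Proof. exact: sderiveD. Qed.

Lemma dyB a b j z : smooth_on D a -> smooth_on D b -> D z ->
  dy j (fun z => a z - b z) z = dy j a z - dy j b z.
Proof. exact: sderiveB. Qed.

Lemma dyM a b j z : smooth_on D a -> smooth_on D b -> D z ->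
  dy j (fun z => a z * b z) z = a z * dy j b z + dy j a z * b z.
Proof. exact: sderiveM. Qed.

Lemma dyZ c a j z : smooth_on D a -> D z ->
  dy j (fun z => c * a z) z = c * dy j a z.
Proof. exact: sderiveZ. Qed.

Lemma dy_sum n (a : 'I_n -> TV -> R) j z : (forall i, smooth_on D (a i)) ->
  D z -> dy j (fun z => \sum_i a i z) z = \sum_i dy j (a i) z.
Proof. exact: sderive_sum. Qed.

Lemma dydxC a i j z : smooth_on D a -> D z -> dy i (dx j a) z = dx j (dy i a) z.
Proof. by move=> sa Dz; exact: (derive_comm _ _ oD). Qed.

Lemma smooth_dy a j : smooth_on D a -> smooth_on D (dy j a).
Proof. exact: smooth_derive. Qed.

Lemma smooth_dx a j : smooth_on D a -> smooth_on D (dx j a).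
Proof. exact: smooth_derive. Qed.

End PartialDerivatives.

Section Euler.
Variable (D : set TV).
Hypothesis oD : open D.

(** Infinitesimal form of homogeneity of degree [r] in [y]. The degree is a real number, so that
    differentiation can lower it below 1 without truncation. *)
Definition euler (r : R) f := forall z, D z ->
  \sum_i z.2 0 i * dy i f z = r * f z.

Lemma euler_dy r f j : smooth_on D f -> euler r f -> euler (r - 1) (dy j f).
Proof.
move=> sf ef z Dz.
have sfi i : smooth_on D (dy i f) by exact: smooth_derive.
have syi i := smooth_ycoord i oD.
have := derive_congr ((0, bv R j) : TV) oD Dz ef.
rewrite (@sderive_sum _ _ D) //; last by move=> i; exact: smoothM.
rewrite (sderiveZ r _ sf Dz) -/(dy j f z).
have E i : 'D_((0, bv R j) : TV) (fun z : TV => z.2 0 i * dy i f z) z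
    = z.2 0 i * dy i (dy j f) z + kron R i j * dy i f z.
  by rewrite (sderiveM _ (syi i) (sfi i) Dz) -(dy_ycoord i j z) /dy (derive_comm _ _ oD Dz sf).
rewrite (eq_bigr _ (fun i _ => E i)) big_split /= => H.
apply: (addIr (\sum_i kron R i j * dy i f z)); rewrite H.
by rewrite sum_kron /dy; ring.
Qed.

Lemma euler_dx r f j : smooth_on D f -> euler r f -> euler r (dx j f).
Proof.
move=> sf ef z Dz.
have sfi i : smooth_on D (dy i f) by exact: smooth_derive.
have syi i := smooth_ycoord i oD.
have := derive_congr ((bv R j, 0) : TV) oD Dz ef.
rewrite (@sderive_sum _ _ D) //; last by move=> i; exact: smoothM.
rewrite (sderiveZ r _ sf Dz) -/(dx j f z) => <-; apply: eq_bigr => i _.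
have dx0 : 'D_((bv R j, 0) : TV) (fun z : TV => z.2 0 i) z = 0 by exact: dx_ycoord.
rewrite (sderiveM _ (syi i) (sfi i) Dz) dx0 mul0r addr0.
by rewrite /dy /dx (derive_comm _ _ oD Dz sf).
Qed.

Lemma eulerM r q a b : smooth_on D a -> smooth_on D b ->
  euler r a -> euler q b -> euler (r + q) (fun z => a z * b z).
Proof.
move=> sa sb ea eb z Dz.
transitivity (a z * (\sum_i z.2 0 i * dy i b z) + b z * (\sum_i z.2 0 i * dy i a z)).
  rewrite !mulr_sumr -big_split; apply: eq_bigr => i _ /=.
  by rewrite [dy i _ z](sderiveM _ sa sb Dz) /dy; ring.
by rewrite ea // eb //; ring.
Qed.

Lemma eulerD r a b : smooth_on D a -> smooth_on D b ->
  euler r a -> euler r b -> euler r (fun z => a z + b z).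
Proof.
move=> sa sb ea eb z Dz; rewrite mulrDr -ea // -eb // -big_split.
by apply: eq_bigr => i _ /=; rewrite [dy i _ z](sderiveD _ sa sb Dz) /dy; ring.
Qed.

Lemma euler_ycoord j : euler 1 (fun z => z.2 0 j).
Proof.
move=> z Dz; rewrite mul1r -[RHS](sum_kron (fun i => z.2 0 i)).
by apply: eq_bigr => i _; rewrite dy_ycoord kronC mulrC.
Qed.

Lemma euler_sum r n (a : 'I_n -> TV -> R) : (forall i, smooth_on D (a i)) ->
  (forall i, euler r (a i)) -> euler r (fun z => \sum_i a i z).
Proof.
move=> sa ea z Dz; rewrite mulr_sumr.
under eq_bigr do rewrite [dy _ _ z](@sderive_sum _ _ D) // mulr_sumr.
by rewrite exchange_big /=; apply: eq_bigr => i _; rewrite -ea.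
Qed.

Lemma euler_homogeneous n f : smooth_on D f ->
  (forall z (k : R), D z -> 0 < k -> f (z.1, k *: z.2) = k ^+ n * f z) ->
  euler n%:R f.
Proof.
move=> sf hf z Dz.
have df := smooth_differentiable sf Dz.
have -> : \sum_i z.2 0 i * dy i f z = 'D_((0, z.2) : TV) f z.
  rewrite derive_coord //= [X in X + _]big1 ?add0r // => i _.
  by rewrite mxE mul0r.
have := @is_derive_line _ _ f z ((0, z.2) : TV) 0.
rewrite scale0r add0r => H.
have {H} [_ <-] := H (smooth_derivable sf Dz).
(* Homogeneity concerns positive factors, so along the ray the function is a power of [x + 1] for
   [x > -1] only; this suffices for the derivative at 0. *)
have E : \forall x \near (0 : R), f (x *: ((0, z.2) : TV) + z) = (x + 1) ^+ n * f z.
  near=> x; have x1 : 0 < x + 1.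
    suff : -1 < x by lra.
    by near: x; apply: lt_nbhsr; rewrite oppr_lt0.
  rewrite -hf //; congr f; case: z {hf df Dz x1} => z1 z2 /=.
  by apply/pair_equal_spec; rewrite /= scaler0 add0r scalerDl scale1r.
rewrite (near_eq_derive _ E).
have dr : is_derive (0 : R) 1 (fun x : R => x + 1) 1.
  by rewrite -[X in is_derive _ _ _ X]addr0; apply: is_deriveD.
have drn := @is_deriveX _ _ _ n (0 : R) 1 _ dr.
have -> : (fun x : R => (x + 1) ^+ n * f z) = f z *: ((fun x : R => x + 1) ^+ n).
  by apply/funext => x; rewrite mulrC !fctE.
rewrite deriveZ; last by case: drn.
rewrite derive_val add0r expr1n -![_ *: _]/(_ * _); ring.
Unshelve. all: by end_near. Qed.

End Euler.
End Coordinates.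

(** * Smoothness of determinants and inverse matrices *)

Section SmoothMatrix.
Context {R : realType} {V : normedModType R}.
Variables (D : set V) (oD : open D).

Lemma smooth_det n (A : V -> 'M[R]_n) :
  (forall i j, smooth_on D (fun z => A z i j)) -> smooth_on D (fun z => \det (A z)).
Proof.
move=> sA; apply: smooth_sum => // s; apply: smoothM => //.
  exact: smooth_cst.
by apply: smooth_prod.
Qed.

Lemma smooth_invmx n (A : V -> 'M[R]_n) : (forall z, D z -> A z \in unitmx) ->
  (forall i j, smooth_on D (fun z => A z i j)) ->
  forall i j, smooth_on D (fun z => invmx (A z) i j).
Proof.
move=> uA sA i j.
(* [invmx] returns a singular matrix unchanged, so the cofactor formula holds on [D] but not
   everywhere. *)
apply: (@smooth_ext _ _ D (fun z => (\det (A z))^-1 * ((-1) ^+ (j + i) *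
   \det (row' j (col' i (A z)))))) => //.
  by move=> z Dz; rewrite /invmx uA // !mxE.
apply: smoothM => //.
  apply: smoothV => //; last exact: smooth_det.
  by move=> z Dz; have := uA z Dz; rewrite unitmxE unitfE.
apply: smoothM => //; first exact: smooth_cst.
apply: smooth_det => k l; apply: smooth_ext (sA (lift j k) (lift i l)) => //.
by move=> z Dz; rewrite !mxE.
Qed.
End SmoothMatrix.

(** * Finsler functions *)

Section FinslerIdentities.
Context {R : realType}.
Local Notation TV := (TV R).

Definition slit (O : set 'rV[R]_3) : set TV := [set z | O z.1 /\ z.2 != 0].

Record local_finsler (O : set 'rV[R]_3) (F : TV -> R) : Prop := LocalFinsler {
  lf_open : open O;
  lf_ge0 : forall x y, O x -> 0 <= F (x, y);
  lf_smooth : smooth_on (slit O) F;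
  lf_homogeneous : forall x y (k : R), O x -> 0 < k -> F (x, k *: y) = k * F (x, y);
  lf_convex : forall x y (v : 'rV[R]_3), O x -> y != 0 -> v != 0 ->
    0 < \sum_j \sum_k gmx F (x, y) j k * v 0 j * v 0 k
}.

Lemma open_slit O : open O -> open (slit O).
Proof.
move=> oO.
have -> : slit O = (@fst 'rV[R]_3 'rV[R]_3) @^-1` O `&` (@snd 'rV[R]_3 'rV[R]_3) @^-1` [set y | y != 0].
  by [].
apply: openI.
  by apply: open_comp => // z _; exact: cvg_fst.
apply: open_comp => [z _|]; first exact: cvg_snd.
have -> : [set y : 'rV[R]_3 | y != 0] = ~` [set 0].
  by apply/seteqP; split=> y /= => [/eqP|/eqP].
by apply: closed_openC; apply: accessible_closed_set1; apply: hausdorff_accessible; exact: norm_hausdorff.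
Qed.

Variables (O : set 'rV[R]_3) (F : TV -> R).
Hypothesis HF : local_finsler O F.
Local Notation D := (slit O).
Implicit Types z : TV.

Let oD : open D. Proof. exact/open_slit/lf_open/HF. Qed.

Definition lag (z : TV) : R := 2^-1 * F z ^+ 2.

Lemma smooth_lag : smooth_on D lag.
Proof.
have sF := lf_smooth HF.
by apply: smoothM => //; [exact: smooth_cst|apply: smoothM].
Qed.
Hint Resolve smooth_lag : core.

Lemma gE i j : g F i j = dy j (dy i lag).
Proof. by apply/funext => z; rewrite /g mxE. Qed.

Lemma smooth_g i j : smooth_on D (g F i j).
Proof. by rewrite gE; do 2!apply: smooth_derive. Qed.

Lemma g_sym i j z : D z -> g F i j z = g F j i z.
Proof. by move=> Dz; rewrite !gE; apply: derive_comm smooth_lag. Qed.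

Lemma dg_sym i j v z : D z -> 'D_v (g F i j) z = 'D_v (g F j i) z.
Proof. by move=> Dz; apply: (derive_congr _ oD) => // y Dy; exact: g_sym. Qed.

Lemma dxg_sym i j k z : D z -> dx k (g F i j) z = dx k (g F j i) z.
Proof. exact: dg_sym. Qed.

Lemma dyg_sym i j k z : D z -> dy k (g F i j) z = dy k (g F j i) z.
Proof. exact: dg_sym. Qed.

Lemma dyg_perm i j k z : D z -> dy k (g F i j) z = dy j (g F i k) z.
Proof.
by move=> Dz; rewrite !gE; apply: (derive_comm _ _ oD Dz); apply: smooth_derive.
Qed.

Lemma euler_lag : euler D 2%:R lag.
Proof.
apply: euler_homogeneous => // -[x y] k [/= Ox _] k0.
by rewrite /lag (lf_homogeneous HF) //; ring.
Qed.

Lemma euler_dylag i : euler D 1 (dy i lag).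
Proof.
have -> : 1 = 2%:R - 1 :> R by ring.
by apply: euler_dy euler_lag.
Qed.

Lemma euler_g i j : euler D 0 (g F i j).
Proof.
rewrite gE; have -> : 0 = 1 - 1 :> R by rewrite subrr.
by apply: euler_dy (euler_dylag i) => //; exact: smooth_derive.
Qed.

Lemma sum_g_y i z : D z -> \sum_j g F i j z * z.2 0 j = dy i lag z.
Proof.
move=> Dz; rewrite -[RHS]mul1r -(euler_dylag i Dz).
by apply: eq_bigr => j _; rewrite gE mulrC.
Qed.

Lemma sum_dxg_y i k z : D z -> \sum_j dx k (g F i j) z * z.2 0 j = dx k (dy i lag) z.
Proof.
move=> Dz.
have := derive_congr ((bv R k, 0) : TV) oD Dz (sum_g_y i).
rewrite (@sderive_sum _ _ D) //; last first.
  by move=> j; apply: smoothM => //; [exact: smooth_g|exact: smooth_ycoord].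
rewrite /dx => <-; apply: eq_bigr => j _.
rewrite (sderiveM _ (smooth_g i j) (smooth_ycoord j oD) Dz).
have -> : 'D_((bv R k, 0) : TV) (fun z : TV => z.2 0 j) z = 0 by exact: dx_ycoord.
by rewrite mulr0 add0r.
Qed.

Lemma sum_dyg_y i j z : D z -> \sum_k dy k (g F i j) z * z.2 0 k = 0.
Proof.
move=> Dz; rewrite -[RHS](mul0r (g F i j z)) -(euler_g i j Dz).
by apply: eq_bigr => k _; rewrite mulrC.
Qed.

Lemma sum_dyg_y' i k z : D z -> \sum_j dy k (g F i j) z * z.2 0 j = 0.
Proof.
move=> Dz; rewrite -[RHS](sum_dyg_y i k Dz).
by apply: eq_bigr => j _; rewrite dyg_perm.
Qed.

Lemma sum_g_yy z : D z -> \sum_i \sum_j g F i j z * z.2 0 i * z.2 0 j = F z ^+ 2.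
Proof.
move=> Dz; have -> : F z ^+ 2 = 2%:R * lag z by rewrite /lag mulVKf ?pnatr_eq0.
rewrite -(euler_lag Dz).
apply: eq_bigr => i _; rewrite -[dy _ _ _](sum_g_y i Dz) mulr_sumr.
by apply: eq_bigr => j _; ring.
Qed.

(** By Euler's relation [F^2] is [g(y, y)], which convexity makes positive. *)
Lemma F_gt0 z : D z -> 0 < F z.
Proof.
move=> Dz; have [Oz z0] := Dz; rewrite lt_neqAle.
have Fge : 0 <= F z by case: z {Dz z0} Oz => x y Ox; exact: lf_ge0 HF _ _ Ox.
rewrite Fge andbT; apply/negP => /eqP F0.
have := lf_convex HF Oz z0 z0.
have -> : (z.1, z.2) = z by case: (z).
have E : \sum_j \sum_k gmx F z j k * z.2 0 j * z.2 0 k = F z ^+ 2 := sum_g_yy Dz.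
by rewrite E -F0 expr0n ltxx.
Qed.

(** A nonzero row [v] with [v g = 0] would satisfy [g(v, v) = 0], against convexity. *)
Lemma gmx_unit z : D z -> gmx F z \in unitmx.
Proof.
move=> Dz; have [Oz z0] := Dz; rewrite -row_free_unit -kermx_eq0; apply/eqP/row_matrixP => i.
rewrite row0; apply/eqP; apply/negPn/negP => v0.
have := lf_convex HF Oz z0 v0; have -> : (z.1, z.2) = z by case: (z).
set v := row i _; have vg : v *m gmx F z = 0 by rewrite /v -row_mul mulmx_ker row0.
clearbody v.
have -> : \sum_j \sum_k gmx F z j k * v 0 j * v 0 k = \sum_k (v *m gmx F z) 0 k * v 0 k.
  rewrite exchange_big; apply: eq_bigr => k _; rewrite [(v *m _) 0 k]mxE mulr_suml.
  by apply: eq_bigr => j _; rewrite [v 0 j * _]mulrC.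
by rewrite vg big1 ?ltxx // => k _; rewrite mxE mul0r.
Qed.

Lemma smooth_ginv i j : smooth_on D (ginv F i j).
Proof.
apply: smooth_invmx => //; first exact: gmx_unit.
exact: smooth_g.
Qed.

Lemma sum_g_ginv i j z : D z -> \sum_k g F i k z * ginv F k j z = kron R i j.
Proof.
by move=> Dz; have := congr1 (fun A : 'M[R]_3 => A i j) (mulmxV (gmx_unit Dz)); rewrite !mxE.
Qed.

Lemma sum_ginv_g i j z : D z -> \sum_k ginv F i k z * g F k j z = kron R i j.
Proof.
by move=> Dz; have := congr1 (fun A : 'M[R]_3 => A i j) (mulVmx (gmx_unit Dz)); rewrite !mxE.
Qed.

Lemma sum_g_raise (h : 'I_3 -> R) i z : D z ->
  \sum_j g F i j z * (\sum_k ginv F j k z * h k) = h i.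
Proof.
move=> Dz; under eq_bigr do rewrite mulr_sumr.
rewrite exchange_big -[RHS](sum_kron h i) /=; apply: eq_bigr => k _.
by rewrite kronC -(sum_g_ginv i k Dz) mulr_suml; apply: eq_bigr => j _; rewrite mulrA.
Qed.

Lemma sum_ginv_lower (h : 'I_3 -> R) i z : D z ->
  \sum_j ginv F i j z * (\sum_k g F j k z * h k) = h i.
Proof.
move=> Dz; under eq_bigr do rewrite mulr_sumr.
rewrite exchange_big -[RHS](sum_kron h i) /=; apply: eq_bigr => k _.
by rewrite kronC -(sum_ginv_g i k Dz) mulr_suml; apply: eq_bigr => j _; rewrite mulrA.
Qed.

(** Identities with an upper index are proved with that index lowered, where no derivative of [ginv]
    occurs. *)
Lemma g_inj (a b : 'I_3 -> R) z : D z ->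
  (forall i, \sum_j g F i j z * a j = \sum_j g F i j z * b j) -> a =1 b.
Proof.
move=> Dz ab i; rewrite -(sum_ginv_lower a i Dz) -(sum_ginv_lower b i Dz).
by apply: eq_bigr => j _; rewrite ab.
Qed.

(** The covariant spray coefficients [g_ij G^j]; the factor 1/2 of [spray] is absorbed by [lag]. *)
Definition spray_low i z := \sum_l dx l (dy i lag) z * z.2 0 l - dx i lag z.

Lemma sprayE j z : D z -> spray F j z = \sum_k ginv F j k z * spray_low k z.
Proof.
move=> Dz; rewrite /spray mulr_sumr; apply: eq_bigr => k _; rewrite mulrCA; congr (_ * _).
have sF2 : smooth_on D (fun z => F z ^+ 2).
  by apply: smoothM => //; exact: lf_smooth HF.
have dlag v y : D y -> 'D_v lag y = 2^-1 * 'D_v (fun z => F z ^+ 2) y.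
  exact: sderiveZ.
have dlag2 v w y : D y -> 'D_w ('D_v lag) y = 2^-1 * 'D_w ('D_v (fun z => F z ^+ 2)) y.
  move=> Dy; rewrite -(@sderiveZ _ _ D) //; last exact: smooth_derive.
  by apply: (derive_congr _ oD) => // x Dx; exact: dlag.
rewrite /spray_low [dx k lag z]dlag // mulrBr mulr_sumr; congr (_ - _).
by apply: eq_bigr => l _; rewrite [dx l _ z in RHS]dlag2 // mulrA.
Qed.

Lemma smooth_spray_low i : smooth_on D (spray_low i).
Proof.
apply: smoothB => //; last exact: smooth_derive.
apply: smooth_sum => // l; apply: smoothM => //; last exact: smooth_ycoord.
by do 2!apply: smooth_derive.
Qed.

Lemma smooth_spray j : smooth_on D (spray F j).
Proof.
apply: (@smooth_ext _ _ D (fun z => \sum_k ginv F j k z * spray_low k z)) => //.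
  by move=> z Dz; rewrite sprayE.
by apply: smooth_sum => // k; apply: smoothM => //; [exact: smooth_ginv|exact: smooth_spray_low].
Qed.

Lemma smooth_nconn i j : smooth_on D (nconn F i j).
Proof.
apply: smoothM => //; first exact: smooth_cst.
by apply: smooth_derive; exact: smooth_spray.
Qed.

Lemma sum_g_spray i z : D z -> \sum_j g F i j z * spray F j z = spray_low i z.
Proof.
by move=> Dz; under eq_bigr do rewrite sprayE //; exact: sum_g_raise.
Qed.

Lemma euler_spray_low i : euler D 2 (spray_low i).
Proof.
have sd l : smooth_on D (dx l (dy i lag)) by do 2!apply: smooth_derive.
have sdx := smooth_derive ((bv R i, 0) : TV) smooth_lag.
have e1 : euler D 2 (fun z => \sum_l dx l (dy i lag) z * z.2 0 l).
  apply: euler_sum => [l|l]; first by apply: smoothM => //; exact: smooth_ycoord.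
  have -> : 2 = 1 + 1 :> R by ring.
  apply: eulerM => //; [exact: smooth_ycoord| |exact: euler_ycoord].
  by apply: euler_dx; [by []|exact: smooth_derive|exact: euler_dylag].
have e2 : euler D 2 (fun z => (-1) * dx i lag z).
  have -> : 2 = 0 + 2 :> R by ring.
  apply: eulerM => //; [exact: smooth_cst| |by apply: euler_dx euler_lag].
  move=> z Dz; rewrite mul0r big1 // => k _.
  by rewrite /dy derive_cst mulr0.
move=> z Dz.
have -> : spray_low i = fun z => \sum_l dx l (dy i lag) z * z.2 0 l + (-1) * dx i lag z.
  by apply/funext => y; rewrite mulN1r.
have := @eulerD _ D 2 (fun z => \sum_l dx l (dy i lag) z * z.2 0 l) (fun z => (-1) * dx i lag z).
move=> H; rewrite H //.
  by apply: smooth_sum => // l; apply: smoothM => //; exact: smooth_ycoord.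
by apply: smoothM => //; exact: smooth_cst.
Qed.

(** After lowering the index this follows from the degrees 0 of [g] and 2 of [spray_low]. *)
Lemma euler_spray j : euler D 2 (spray F j).
Proof.
move=> z Dz.
suff : (fun j => \sum_i z.2 0 i * dy i (spray F j) z) =1 (fun j => 2 * spray F j z) by exact.
apply: (g_inj Dz) => i.
have sgs k : smooth_on D (fun z => g F i k z * spray F k z).
  by apply: smoothM => //; [exact: smooth_g|exact: smooth_spray].
transitivity (\sum_l z.2 0 l * dy l (fun z => \sum_k g F i k z * spray F k z) z).
  under [RHS]eq_bigr do rewrite [dy _ _ z](@sderive_sum _ _ D) // mulr_sumr.
  rewrite exchange_big; apply: eq_bigr => k _ /=.
  transitivity (\sum_l (g F i k z * (z.2 0 l * dy l (spray F k) z) +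
     z.2 0 l * dy l (g F i k) z * spray F k z)).
    by rewrite big_split /= -mulr_suml euler_g // !mul0r addr0 mulr_sumr.
  apply: eq_bigr => l _.
  by rewrite (sderiveM _ (smooth_g i k) (smooth_spray k) Dz) /dy; ring.
transitivity (\sum_l z.2 0 l * dy l (spray_low i) z).
  apply: eq_bigr => l _; congr (_ * _); apply: (derive_congr _ oD) => // y Dy.
  exact: sum_g_spray.
rewrite euler_spray_low // -sum_g_spray // mulr_sumr.
by apply: eq_bigr => k _; ring.
Qed.

Lemma sum_nconn_y i z : D z -> \sum_j nconn F i j z * z.2 0 j = spray F i z.
Proof.
move=> Dz; have := euler_spray i Dz => /(congr1 ( *%R 2^-1)).
rewrite mulKf ?pnatr_eq0 // => <-; rewrite mulr_sumr; apply: eq_bigr => j _.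
by rewrite /nconn; ring.
Qed.

Lemma dy_spray j k z : dy k (spray F j) z = 2 * nconn F j k z.
Proof. by rewrite /nconn mulVKf ?pnatr_eq0. Qed.

End FinslerIdentities.

(** * The Chern connection *)

(* [ring] compares atoms up to conversion, which diverges on derivatives. *)
Ltac abstract_atoms := repeat match goal with
  | |- context [@dx ?R ?i ?f ?z] => generalize (@dx R i f z); intro
  | |- context [@dy ?R ?i ?f ?z] => generalize (@dy R i f z); intro
  | |- context [@derive ?R ?V ?W ?f ?z ?v] => generalize (@derive R V W f z v); intro
  | |- context [@delta_dx ?R ?F ?i ?f ?z] => generalize (@delta_dx R F i f z); intro
  | |- context [@g ?R ?F ?i ?j ?z] => generalize (@g R F i j z); intro
  | |- context [@ginv ?R ?F ?i ?j ?z] => generalize (@ginv R F i j z); intro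
  | |- context [@nconn ?R ?F ?i ?j ?z] => generalize (@nconn R F i j z); intro
  | |- context [@spray ?R ?F ?i ?z] => generalize (@spray R F i z); intro
  | |- context [@chern ?R ?F ?i ?j ?k ?z] => generalize (@chern R F i j k z); intro
  | |- context [@bigop.body ?R ?I ?x ?r ?f] => generalize (@bigop.body R I x r f); intro
  end.
Ltac aring := abstract_atoms; ring.

Section ChernConnection.
Local Opaque dx dy derive g ginv spray.
Context {R : realType}.
Local Notation TV := (TV R).
Variables (O : set 'rV[R]_3) (F : TV -> R).
Hypothesis HF : local_finsler O F.
Local Notation D := (slit O).
Implicit Types z : TV.

Let oD : open D. Proof. exact/open_slit/lf_open/HF. Qed.
Let sL := smooth_lag HF.
Let sg := smooth_g HF.
Let sN := smooth_nconn HF.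
Let sG := smooth_spray HF.

(** This is the [y^k]-derivative of [sum_g_spray], in which the derivative of the spray is twice
    [nconn]. *)
Lemma nconn_low i k z : D z ->
  2 * \sum_j g F i j z * nconn F j k z =
  \sum_l z.2 0 l * dx l (g F i k) z + dx k (dy i (lag F)) z
  - dx i (dy k (lag F)) z - \sum_j dy k (g F i j) z * spray F j z.
Proof.
move=> Dz; have := dy_congr oD k Dz (sum_g_spray HF i).
have sgG j : smooth_on D (fun z => g F i j z * spray F j z) by apply: smoothM.
rewrite (dy_sum k sgG Dz).
have E1 j : dy k (fun z => g F i j z * spray F j z) z =
    2 * (g F i j z * nconn F j k z) + dy k (g F i j) z * spray F j z.
  by rewrite (dyM k (sg i j) (sG j) Dz) dy_spray; aring.
rewrite (eq_bigr _ (fun j _ => E1 j)) big_split /= -mulr_sumr => H.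
apply: (addIr (\sum_j dy k (g F i j) z * spray F j z)); rewrite H subrK.
have sLi l : smooth_on D (dx l (dy i (lag F))) by apply: smooth_dx; exact: smooth_dy.
have sLy l : smooth_on D (fun z => dx l (dy i (lag F)) z * z.2 0 l).
  by apply: smoothM => //; exact: smooth_ycoord.
have ssLy : smooth_on D (fun z => \sum_l dx l (dy i (lag F)) z * z.2 0 l).
  exact: smooth_sum.
rewrite /spray_low (dyB k ssLy (smooth_dx i sL) Dz) (dy_sum k sLy Dz).
have E2 l : dy k (fun z => dx l (dy i (lag F)) z * z.2 0 l) z =
    z.2 0 l * dx l (g F i k) z + kron R l k * dx l (dy i (lag F)) z.
  rewrite (dyM k (sLi l) (smooth_ycoord l oD) Dz) dy_ycoord.
  by rewrite (dydxC oD k l (smooth_dy i sL) Dz) gE; aring.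
rewrite (eq_bigr _ (fun l _ => E2 l)) big_split /= (sum_kron (fun l => dx l (dy i (lag F)) z)).
by rewrite (dydxC oD k i sL Dz).
Qed.

Lemma smooth_delta_dx i f : smooth_on D f -> smooth_on D (delta_dx F i f).
Proof.
move=> sf; apply: smoothB => //; first exact: smooth_derive.
by apply: smooth_sum => // j; apply: smoothM => //; exact: smooth_derive.
Qed.

Lemma smooth_chern i j k : smooth_on D (chern F i j k).
Proof.
apply: smoothM => //; first exact: smooth_cst.
apply: smooth_sum => // l; apply: smoothM => //; first exact: smooth_ginv.
by apply: smoothB => //; [apply: smoothD => //|]; apply: smooth_delta_dx; exact: sg.
Qed.

Lemma delta_g_sym i j k z : D z -> delta_dx F k (g F i j) z = delta_dx F k (g F j i) z.
Proof.
move=> Dz; rewrite /delta_dx (dxg_sym HF _ _ _ Dz).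
by congr (_ - _); apply: eq_bigr => l _; rewrite (dyg_sym HF _ _ _ Dz).
Qed.

Lemma chern_low i j k z : D z ->
  \sum_m g F i m z * chern F m j k z =
  2^-1 * (delta_dx F j (g F k i) z + delta_dx F k (g F j i) z - delta_dx F i (g F j k) z).
Proof.
move=> Dz; rewrite -[RHS](sum_g_raise HF (fun i => 2^-1 * (delta_dx F j (g F k i) z +
  delta_dx F k (g F j i) z - delta_dx F i (g F j k) z)) i Dz).
apply: eq_bigr => m _; congr (_ * _); rewrite /chern mulr_sumr.
by apply: eq_bigr => l _; aring.
Qed.

Lemma chern_sym i j k z : D z -> chern F i j k z = chern F i k j z.
Proof.
move=> Dz; rewrite /chern; congr (_ * _); apply: eq_bigr => l _; congr (_ * _).
by rewrite (delta_g_sym j k l Dz); aring.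
Qed.

(** Horizontal metric compatibility: the two Koszul formulas [chern_low] with [i] and [j] exchanged
    add up to the derivative of [g]. *)
Lemma delta_g i j k z : D z -> delta_dx F k (g F i j) z =
  \sum_m g F j m z * chern F m i k z + \sum_m g F i m z * chern F m j k z.
Proof.
move=> Dz; rewrite !chern_low // (delta_g_sym j i k Dz) (delta_g_sym k j i Dz) (delta_g_sym k i j Dz).
by abstract_atoms; lra.
Qed.

(** The vertical correction in [delta_dx] drops out because [y^j] contracted with a y-derivative of
    [g_ij] is zero. In [sum_y_delta_g'] the vector [y] meets the index of the derivative instead,
    and [N^m_j y^j = G^m] turns the correction into the spray. *)
Lemma sum_y_delta_g i k z : D z ->
  \sum_j z.2 0 j * delta_dx F k (g F j i) z = dx k (dy i (lag F)) z.
Proof.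
move=> Dz; rewrite -(sum_dxg_y HF i k Dz).
transitivity (\sum_j (dx k (g F i j) z * z.2 0 j -
   \sum_m nconn F m k z * (dy m (g F i j) z * z.2 0 j))).
  apply: eq_bigr => j _; rewrite delta_g_sym // /delta_dx mulrBr mulr_sumr.
  congr (_ - _); first by rewrite mulrC.
  by apply: eq_bigr => m _; aring.
rewrite sumrB exchange_big /= [X in _ - X]big1 ?subr0 // => m _.
by rewrite -mulr_sumr (sum_dyg_y' HF) // mulr0.
Qed.

Lemma sum_y_delta_g' i k z : D z ->
  \sum_j z.2 0 j * delta_dx F j (g F k i) z =
  \sum_j z.2 0 j * dx j (g F i k) z - \sum_j dy k (g F i j) z * spray F j z.
Proof.
move=> Dz; transitivity (\sum_j (z.2 0 j * dx j (g F i k) z -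
   \sum_m dy k (g F i m) z * (nconn F m j z * z.2 0 j))).
  apply: eq_bigr => j _; rewrite delta_g_sym // /delta_dx mulrBr mulr_sumr.
  congr (_ - _); apply: eq_bigr => m _; rewrite (dyg_perm HF _ _ _ Dz); aring.
rewrite sumrB exchange_big /=; congr (_ - _); apply: eq_bigr => m _.
by rewrite -mulr_sumr (sum_nconn_y HF).
Qed.

(** With the index lowered, contracting the Koszul formula with [y] leaves exactly the four terms of
    [nconn_low]. *)
Lemma sum_chern_y i k z : D z -> \sum_j chern F i j k z * z.2 0 j = nconn F i k z.
Proof.
move=> Dz.
suff : (fun i => \sum_j chern F i j k z * z.2 0 j) =1 (fun i => nconn F i k z) by exact.
apply: (g_inj HF Dz) => {}i.
transitivity (\sum_j z.2 0 j * \sum_m g F i m z * chern F m j k z).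
  under eq_bigr do rewrite mulr_sumr; rewrite exchange_big /=.
  by apply: eq_bigr => j _; rewrite mulr_sumr; apply: eq_bigr => m _; aring.
under eq_bigr do rewrite chern_low //.
transitivity (2^-1 * (\sum_j z.2 0 j * delta_dx F j (g F k i) z +
  \sum_j z.2 0 j * delta_dx F k (g F j i) z - \sum_j z.2 0 j * delta_dx F i (g F j k) z)).
  rewrite mulrBr mulrDr !mulr_sumr -big_split -sumrB /=.
  by apply: eq_bigr => j _; aring.
by rewrite sum_y_delta_g' // !sum_y_delta_g //; have := nconn_low i k Dz; abstract_atoms; move=> ?; lra.
Qed.

Lemma sum_chern_y' i j z : D z -> \sum_k chern F i j k z * z.2 0 k = nconn F i j z.
Proof.
move=> Dz; rewrite -(sum_chern_y i j Dz); apply: eq_bigr => k _.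
by rewrite (chern_sym _ _ _ Dz).
Qed.

(** The product rule in [Γ^i_jk y^k = N^i_j]. Up to the factor [-F] the left-hand side is the
    P-curvature contracted with [y], so the right-hand side represents the Landsberg tensor. *)
Lemma sum_dy_chern_y i j l z : D z ->
  \sum_k dy l (chern F i j k) z * z.2 0 k = dy l (nconn F i j) z - chern F i j l z.
Proof.
move=> Dz; have := dy_congr oD l Dz (sum_chern_y' i j).
have sy k := smooth_ycoord k oD.
have sc k : smooth_on D (fun z => chern F i j k z * z.2 0 k).
  by apply: smoothM => //; exact: smooth_chern.
rewrite (dy_sum l sc Dz).
have E k : dy l (fun z => chern F i j k z * z.2 0 k) z =
    dy l (chern F i j k) z * z.2 0 k + kron R k l * chern F i j k z.
  by rewrite (dyM l (smooth_chern i j k) (sy k) Dz) dy_ycoord; aring.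
rewrite (eq_bigr _ (fun k _ => E k)) big_split /= (sum_kron (fun k => chern F i j k z)).
by move=> <-; rewrite addrK.
Qed.

Lemma dy_y_dxg i k l m z : D z -> dy l (fun z => z.2 0 m * dx m (g F i k) z) z =
  z.2 0 m * dx m (dy l (g F i k)) z + kron R m l * dx m (g F i k) z.
Proof.
move=> Dz; rewrite (dyM l (smooth_ycoord m oD) (smooth_dx m (sg i k)) Dz) dy_ycoord.
by rewrite (dydxC oD l m (sg i k) Dz).
Qed.

Lemma dy_dyg_spray i j k l z : D z -> dy l (fun z => dy k (g F i j) z * spray F j z) z =
  dy l (dy k (g F i j)) z * spray F j z + 2 * (dy k (g F i j) z * nconn F j l z).
Proof.
by move=> Dz; rewrite (dyM l (smooth_dy k (sg i j)) (sG j) Dz) dy_spray; aring.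
Qed.

Lemma dy_dx_dylag n m l z : D z -> dy l (dx m (dy n (lag F))) z = dx m (g F n l) z.
Proof. by move=> Dz; rewrite gE (dydxC oD l m (smooth_dy n sL) Dz). Qed.

Lemma dy_nconn_low i k l z : D z ->
  2 * \sum_j g F i j z * dy l (nconn F j k) z =
  dx l (g F i k) z + \sum_m z.2 0 m * dx m (dy l (g F i k)) z
  + dx k (g F i l) z - dx i (g F k l) z
  - \sum_j (dy l (dy k (g F i j)) z * spray F j z + 2 * (dy k (g F i j) z * nconn F j l z))
  - 2 * \sum_j dy l (g F i j) z * nconn F j k z.
Proof.
move=> Dz; have := dy_congr oD l Dz (nconn_low i k).
have sy m := smooth_ycoord m oD.
have sLi m n : smooth_on D (dx m (dy n (lag F))) by apply: smooth_dx; exact: smooth_dy.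
have sdxg m : smooth_on D (dx m (g F i k)) by apply: smooth_dx; exact: sg.
have sdyg m : smooth_on D (dy k (g F i m)) by apply: smooth_dy; exact: sg.
have sgN j : smooth_on D (fun z => g F i j z * nconn F j k z).
  exact: (smoothM oD (sg i j) (sN j k)).
have sydg m : smooth_on D (fun z => z.2 0 m * dx m (g F i k) z).
  exact: (smoothM oD (sy m) (sdxg m)).
have sdgG j : smooth_on D (fun z => dy k (g F i j) z * spray F j z).
  exact: (smoothM oD (sdyg j) (sG j)).
have s1 := smooth_sum (index_enum 'I_3) xpredT oD sgN.
have s2 := smooth_sum (index_enum 'I_3) xpredT oD sydg.
have s3 := smooth_sum (index_enum 'I_3) xpredT oD sdgG.
have s4 := smoothD oD s2 (sLi k i).
have s5 := smoothB oD s4 (sLi i k).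
rewrite (dyZ _ l s1 Dz) (dy_sum l sgN Dz) (dyB l s5 s3 Dz) (dyB l s4 (sLi i k) Dz).
rewrite (dyD l s2 (sLi k i) Dz) (dy_sum l sydg Dz) (dy_sum l sdgG Dz).
rewrite (eq_bigr _ (fun j _ => dyM l (sg i j) (sN j k) Dz)).
rewrite (eq_bigr _ (fun m _ => dy_y_dxg i k l m Dz)) (eq_bigr _ (fun j _ => dy_dyg_spray i j k l Dz)).
rewrite [X in _ = _ + X - _ - _](dy_dx_dylag i k l Dz) [X in _ = _ + _ - X - _](dy_dx_dylag k i l Dz).
rewrite big_split /= [X in _ = X + _ - _ - _]big_split /= (sum_kron (fun m => dx m (g F i k) z)).
by rewrite !sum3; abstract_atoms; move=> ?; lra.
Qed.

(** The plain x-derivatives of [g] in [dy_nconn_low] cancel against those of the Christoffel symbol.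
    What remains shows the symmetry in [i], [k], [l], because y-derivatives of [g] are derivatives
    of [F^2]. *)
Lemma landsberg_low i k l z : D z ->
  2 * \sum_m g F i m z * (dy l (nconn F m k) z - chern F m k l z) =
  \sum_m z.2 0 m * dx m (dy l (g F i k)) z
  - \sum_j dy l (dy k (g F i j)) z * spray F j z
  - \sum_m (nconn F m l z * dy m (g F i k) z + nconn F m k z * dy m (g F i l) z
      + nconn F m i z * dy m (g F k l) z).
Proof.
move=> Dz; under eq_bigr do rewrite mulrBr.
rewrite sumrB mulrBr dy_nconn_low // chern_low //.
rewrite (delta_g_sym l i k Dz) (delta_g_sym k i l Dz) /delta_dx.
rewrite !sum3.
rewrite (dyg_perm HF i ix1 k Dz) (dyg_perm HF i ix2 k Dz) (dyg_perm HF i ix3 k Dz).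
rewrite (dyg_perm HF i ix1 l Dz) (dyg_perm HF i ix2 l Dz) (dyg_perm HF i ix3 l Dz).
by abstract_atoms; field.
Qed.

Lemma landsberg_sym i k l z : D z ->
  \sum_m g F i m z * (dy l (nconn F m k) z - chern F m k l z) =
  \sum_m g F k m z * (dy l (nconn F m i) z - chern F m i l z).
Proof.
move=> Dz; apply: (mulfI (_ : 2 != 0 :> R)); first by rewrite pnatr_eq0.
rewrite (landsberg_low i k l Dz) (landsberg_low k i l Dz).
have dxdy m : dx m (dy l (g F i k)) z = dx m (dy l (g F k i)) z.
  by apply: (dx_congr oD _ Dz) => y Dy; exact: (dyg_sym HF).
have dydy j : dy l (dy k (g F i j)) z = dy l (dy i (g F k j)) z.
  apply: (dy_congr oD _ Dz) => y Dy.
  by rewrite (dyg_perm HF _ _ _ Dy) [RHS](dyg_perm HF _ _ _ Dy) (dyg_sym HF _ _ _ Dy).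
apply: (f_equal2 (fun a b => a - b)); [apply: (f_equal2 (fun a b => a - b))|].
- by apply: eq_bigr => m _; apply: (f_equal2 *%R); [|exact: dxdy].
- by apply: eq_bigr => j _; apply: (f_equal2 *%R); [exact: dydy|].
apply: eq_bigr => m _; apply: (etrans _ (addrAC _ _ _)).
apply: (f_equal2 +%R); last by []; apply: (f_equal2 +%R); last by [].
by apply: (f_equal2 *%R); [|exact: (dyg_sym HF)].
Qed.

End ChernConnection.

(** * The frame bundle *)

Section MatrixCalculus.
Context {R : realType} {V : normedModType R}.
Variables (D : set V) (oD : open D).

Definition msmooth m n (A : V -> 'M[R]_(m, n)) :=
  forall i j, smooth_on D (fun z => A z i j).

(** Taken entrywise, so that the product and inverse rules rest on scalar smoothness; [Dm_diff]
    identifies it with the differential. *)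
Definition Dm m n (v : V) (A : V -> 'M[R]_(m, n)) (z : V) : 'M[R]_(m, n) :=
  \matrix_(i, j) 'D_v (fun z => A z i j) z.

Lemma Dm_congr m n v (A B : V -> 'M[R]_(m, n)) z : D z ->
  (forall y, D y -> A y = B y) -> Dm v A z = Dm v B z.
Proof.
move=> Dz AB; apply/matrixP => i j; rewrite !mxE; apply: (derive_congr v oD Dz) => y Dy.
by rewrite AB.
Qed.

Lemma msmooth_cst m n (A : 'M[R]_(m, n)) : msmooth (fun=> A).
Proof. by move=> i j; exact: smooth_cst. Qed.

Lemma Dm_cst m n v (A : 'M[R]_(m, n)) z : Dm v (fun=> A) z = 0.
Proof. by apply/matrixP => i j; rewrite !mxE derive_cst. Qed.

Lemma msmoothD m n (A B : V -> 'M[R]_(m, n)) : msmooth A -> msmooth B ->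
  msmooth (fun z => A z + B z).
Proof.
move=> sA sB i j; apply: (smooth_ext oD _ (smoothD oD (sA i j) (sB i j))) => z _.
by rewrite mxE.
Qed.

Lemma DmD m n v (A B : V -> 'M[R]_(m, n)) z : msmooth A -> msmooth B -> D z ->
  Dm v (fun z => A z + B z) z = Dm v A z + Dm v B z.
Proof.
move=> sA sB Dz; apply/matrixP => i j; rewrite !mxE -(sderiveD v (sA i j) (sB i j) Dz).
by congr (derive _ z v); apply/funext => y; rewrite mxE.
Qed.

Lemma msmoothN m n (A : V -> 'M[R]_(m, n)) : msmooth A -> msmooth (fun z => - A z).
Proof.
move=> sA i j; apply: (smooth_ext oD _ (smoothN oD (sA i j))) => z _.
by rewrite mxE.
Qed.

Lemma DmN m n v (A : V -> 'M[R]_(m, n)) z : msmooth A -> D z ->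
  Dm v (fun z => - A z) z = - Dm v A z.
Proof.
move=> sA Dz; apply/matrixP => i j; rewrite !mxE -(deriveN (smooth_derivable (sA i j) Dz)).
by congr (derive _ z v); apply/funext => y; rewrite mxE.
Qed.

Lemma msmoothB m n (A B : V -> 'M[R]_(m, n)) : msmooth A -> msmooth B ->
  msmooth (fun z => A z - B z).
Proof. by move=> sA sB; apply: msmoothD => //; exact: msmoothN. Qed.

Lemma DmB m n v (A B : V -> 'M[R]_(m, n)) z : msmooth A -> msmooth B -> D z ->
  Dm v (fun z => A z - B z) z = Dm v A z - Dm v B z.
Proof. by move=> sA sB Dz; rewrite (DmD v sA (msmoothN sB) Dz) (DmN v sB Dz). Qed.

Lemma msmoothM m n p (A : V -> 'M[R]_(m, n)) (B : V -> 'M[R]_(n, p)) :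
  msmooth A -> msmooth B -> msmooth (fun z => A z *m B z).
Proof.
move=> sA sB i j; apply: (smooth_ext oD (f := fun z => \sum_k A z i k * B z k j)).
  by move=> z _; rewrite mxE.
by apply: smooth_sum => // k; exact: smoothM.
Qed.

Lemma DmM m n p v (A : V -> 'M[R]_(m, n)) (B : V -> 'M[R]_(n, p)) z :
  msmooth A -> msmooth B -> D z ->
  Dm v (fun z => A z *m B z) z = Dm v A z *m B z + A z *m Dm v B z.
Proof.
move=> sA sB Dz; apply/matrixP => i j; rewrite !mxE -big_split /=.
transitivity ('D_v (fun z => \sum_k A z i k * B z k j) z).
  by congr (derive _ z v); apply/funext => y; rewrite mxE.
rewrite (sderive_sum v (fun k => smoothM oD (sA i k) (sB k j)) Dz).
apply: eq_bigr => k _; rewrite (sderiveM v (sA i k) (sB k j) Dz) !mxE.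
by rewrite addrC.
Qed.

Lemma msmoothT m n (A : V -> 'M[R]_(m, n)) : msmooth A -> msmooth (fun z => (A z)^T).
Proof.
move=> sA i j; apply: (smooth_ext oD _ (sA j i)) => z _.
by rewrite mxE.
Qed.

Lemma DmT m n v (A : V -> 'M[R]_(m, n)) z : Dm v (fun z => (A z)^T) z = (Dm v A z)^T.
Proof.
apply/matrixP => i j; rewrite !mxE.
by congr (derive _ z v); apply/funext => y; rewrite mxE.
Qed.

Lemma msmoothV n (A : V -> 'M[R]_n) : (forall z, D z -> A z \in unitmx) ->
  msmooth A -> msmooth (fun z => invmx (A z)).
Proof. by move=> uA sA i j; exact: smooth_invmx. Qed.

Lemma DmV n v (A : V -> 'M[R]_n) z : (forall z, D z -> A z \in unitmx) ->
  msmooth A -> D z ->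
  Dm v (fun z => invmx (A z)) z = - (invmx (A z) *m Dm v A z *m invmx (A z)).
Proof.
move=> uA sA Dz; have sV := msmoothV uA sA.
have : Dm v (fun z => invmx (A z) *m A z) z = 0.
  rewrite -(Dm_cst v 1%:M z); apply: Dm_congr => // y Dy; apply: mulVmx; exact: uA.
rewrite (DmM v sV sA Dz) => /(congr1 (fun M => M *m invmx (A z))).
rewrite mulmxDl -(mulmxA (Dm _ _ _)) mulmxV ?mulmx1 ?mul0mx; last exact: uA.
by move=> /eqP; rewrite addr_eq0 => /eqP.
Qed.

Lemma msmooth_Dm m n v (A : V -> 'M[R]_(m, n)) : msmooth A -> msmooth (Dm v A).
Proof.
move=> sA i j; apply: (smooth_ext oD _ (smooth_derive v (sA i j))) => z _.
by rewrite mxE.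
Qed.

Lemma Dm_comm m n v w (A : V -> 'M[R]_(m, n)) z : msmooth A -> D z ->
  Dm v (Dm w A) z = Dm w (Dm v A) z.
Proof.
move=> sA Dz; apply/matrixP => i j; rewrite [LHS]mxE [RHS]mxE.
have E u : (fun y => Dm u A y i j) = 'D_u (fun y => A y i j).
  by apply/funext => y; rewrite mxE.
by rewrite !E; exact: derive_comm (sA i j).
Qed.

End MatrixCalculus.

Section PullbackFst.
Context {R : realType} {U W : normedModType R}.

Lemma differentiable_fst (q : U * W) : differentiable (@fst U W) q.
Proof.
pose L : {linear (U * W)%type -> U} := HB.pack_for {linear (U * W)%type -> U} (@fst U W)
  (GRing.isLinear.Build _ _ _ _ (@fst U W) (fun a x y => erefl)).
apply: (@linear_differentiable _ _ _ L) => x; exact: cvg_fst.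
Qed.

Lemma smooth_fst (D : set U) (f : U -> R) : smooth_on D f ->
  smooth_on [set q : U * W | D q.1] (fun q => f q.1).
Proof.
move=> sf k; elim: k f sf => [|k IH] f sf.
  move=> q Dq; apply: (@continuous_comp _ _ _ (@fst U W) f); first exact: cvg_fst.
  exact: (sf 0%N).
split=> [q Dq|v].
  apply: (@differentiable_comp _ _ _ _ (@fst U W) f); first exact: differentiable_fst.
  exact: smooth_differentiable sf Dq.
have -> : 'D_v (fun q : U * W => f q.1) = (fun q => 'D_v.1 f q.1) by [].
exact: (IH _ (smooth_derive v.1 sf)).
Qed.

End PullbackFst.

Lemma smooth_sub (R : realType) (V : normedModType R) (O O' : set V) (f : V -> R) :
  O' `<=` O -> smooth_on O f -> smooth_on O' f.
Proof.
move=> sO sf k; elim: k f sf => [|k IH] f sf.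
  by move=> z O'z; exact: (sf 0%N z (sO z O'z)).
split=> [z O'z|v]; first exact: smooth_differentiable sf (sO z O'z).
exact: (IH _ (smooth_derive v sf)).
Qed.

Lemma contract3 (R : comRingType) (T : 'I_3 -> 'I_3 -> 'I_3 -> R) (x y v : 'I_3 -> R)
  (w : 'I_3 -> 'I_3 -> R) :
  \sum_c (\sum_i \sum_j \sum_k T i j k * x i * y j * w k c) * v c =
  \sum_j \sum_i x i * (\sum_k T i j k * (\sum_c w k c * v c)) * y j.
Proof. by rewrite !sum3; ring. Qed.

(** The index algebra of [Dm_gmx]: [d] stands for the y-derivatives of [g_ij], and the term with [N]
    joins [v2] to form [δy / f], which carries twice the Cartan tensor. *)
Lemma metric_compatibility_sum (R : fieldType) (v1 v2 gi gj d : 'I_3 -> R)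
  (Gi Gj N : 'I_3 -> 'I_3 -> R) (f : R) : (2 : R) != 0 -> f != 0 ->
  \sum_k v1 k * (\sum_m gj m * Gi m k + \sum_m gi m * Gj m k + \sum_l N l k * d l)
    + \sum_k v2 k * d k =
  \sum_m (\sum_k Gi m k * v1 k) * gj m + \sum_m gi m * (\sum_k Gj m k * v1 k)
    + (\sum_k (2^-1 * f * d k) * ((v2 k + \sum_l N k l * v1 l) / f)) *+ 2.
Proof. by move=> t0 f0; rewrite !sum3; field; rewrite t0 f0. Qed.

(** * Structure equations of the Chern connection on all linear frames *)

Section StructureEquations.
Context {R : realType}.
Local Notation TV := (TV R).
Local Notation FB := (FB R).
Variables (O : set 'rV[R]_3) (F : TV -> R).
Hypothesis HF : local_finsler O F.
Local Notation D := (slit O).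
Implicit Types (z v w : TV) (q V W : FB).

Let oD : open D. Proof. exact/open_slit/lf_open/HF. Qed.

(** The open set on which derivatives are taken; an identity known on adapted frames alone could be
    differentiated only in tangent directions. *)
Definition frames : set FB := [set q | D q.1 /\ q.2 \in unitmx].

Lemma scalar_frame_entry i j : scalar (fun q : FB => q.2 i j).
Proof. by move=> a x y; rewrite !mxE. Qed.

Lemma continuous_frame_entry i j : continuous (fun q : FB => q.2 i j).
Proof.
move=> q; apply: (@continuous_comp _ _ _ (@snd _ _) (fun E : 'M[R]_3 => E i j)).
  exact: cvg_snd.
exact: coord_continuous.
Qed.

Lemma msmooth_frame U : open U -> msmooth U (fun q : FB => q.2).
Proof.
by move=> oU i j; apply: smooth_linear oU (scalar_frame_entry i j) (@continuous_frame_entry i j).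
Qed.

Lemma Dm_frame q V : Dm V (fun q : FB => q.2) q = V.2.
Proof.
apply/matrixP => i j; rewrite mxE; exact: (derive_scalar _ _ (scalar_frame_entry i j)).
Qed.

Lemma open_frames : open frames.
Proof.
have -> : frames = (@fst TV 'M[R]_3) @^-1` D `&` (fun q : FB => \det q.2) @^-1` [set x | x != 0].
  by apply/seteqP; split=> q [Dq uq]; split=> //; move: uq; rewrite /= unitmxE unitfE.
apply: openI; first by apply: open_comp => // z _; exact: cvg_fst.
apply: open_comp => [q _|].
  have := smooth_det openT (msmooth_frame openT); move=> /(_ 0%N) /=; exact.
have -> : [set x : R | x != 0] = ~` [set 0].
  by apply/seteqP; split=> y /= => [/eqP|/eqP].
by apply: closed_openC; apply: accessible_closed_set1; apply: hausdorff_accessible; exact: norm_hausdorff.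
Qed.

Lemma smooth_base (f : TV -> R) : smooth_on D f -> smooth_on frames (fun q : FB => f q.1).
Proof. by move=> sf; apply: smooth_sub (smooth_fst (W := 'M[R]_3) sf) => q []. Qed.

Definition gam z v : 'M[R]_3 := \matrix_(i, j) \sum_k chern F i j k z * v.1 0 k.
(** The form [δy / F] evaluated on [v], that is, the vertical part of [v]. *)
Definition vform z v : 'cV[R]_3 :=
  \col_i ((v.2 0 i + \sum_j nconn F i j z * v.1 0 j) / F z).
Definition cartan_mx z v : 'M[R]_3 :=
  \matrix_(i, j) \sum_k cartan_tensor F i j k z * vform z v k 0.

(* In [om] and [kh], the Chern and Cartan connection forms, the row is the upper
   index: [om q V a b] is omega_b^a. *)
Definition cof q V : 'cV[R]_3 := invmx q.2 *m (V.1.1)^T.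
Definition covf q V : 'cV[R]_3 := invmx q.2 *m vform q.1 V.1.
Definition om q V : 'M[R]_3 := invmx q.2 *m (V.2 + gam q.1 V.1 *m q.2).
Definition cartan_fmx q V : 'M[R]_3 := q.2^T *m cartan_mx q.1 V.1 *m q.2.
Definition kh q V : 'M[R]_3 := om q V + cartan_fmx q V.
Definition grm q : 'M[R]_3 := q.2^T *m gmx F q.1 *m q.2.

Lemma coframeE a q V : coframe a q V = cof q V a 0.
Proof. by rewrite mxE; apply: eq_bigr => i _; rewrite [V.1.1^T i 0]mxE. Qed.

Lemma coframe_vE a q V : coframe_v F a q V = covf q V a 0.
Proof. by rewrite mxE; apply: eq_bigr => i _; rewrite [vform _ _ i 0]mxE. Qed.

Lemma chern_formE b a q V : chern_form F b a q V = om q V a b.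
Proof.
rewrite mxE; apply: eq_bigr => i _; congr (_ * _); rewrite [RHS]mxE; congr (_ + _).
rewrite [RHS]mxE; apply: eq_bigr => j _; rewrite [gam _ _ i j]mxE mulr_suml.
by apply: eq_bigr => k _; rewrite mulrAC.
Qed.

Lemma gramE a b q : gram F a b q = grm q a b.
Proof.
rewrite /gram exchange_big [RHS]mxE; apply: eq_bigr => j _ /=.
rewrite [(_ *m _) a j]mxE mulr_suml; apply: eq_bigr => i _.
by rewrite [q.2^T a i]mxE [q.2 i a * _]mulrC.
Qed.

Lemma cartan_dy i j k z : D z -> cartan_tensor F i j k z = 2^-1 * F z * dy k (g F i j) z.
Proof.
move=> Dz; rewrite /cartan_tensor gE.
have sF2 : smooth_on D (fun z => F z ^+ 2).
  by have sF := lf_smooth HF; apply: smoothM.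
have sc (c : R) : smooth_on D (fun z => c * F z ^+ 2).
  by apply: smoothM => //; exact: smooth_cst.
have E (c : R) : dy k (dy j (dy i (fun z => c * F z ^+ 2))) z = c * dy k (dy j (dy i (fun z => F z ^+ 2))) z.
  rewrite -(dyZ c k (smooth_dy j (smooth_dy i sF2)) Dz).
  apply: (dy_congr oD k Dz) => y Dy; rewrite -(dyZ c j (smooth_dy i sF2) Dy).
  by apply: (dy_congr oD j Dy) => x Dx; rewrite (dyZ c i sF2 Dx).
apply: (etrans (congr1 ( *%R (F z)) (E 4^-1))).
apply: (etrans _ (congr1 ( *%R (2^-1 * F z)) (esym (E 2^-1)))).
by abstract_atoms; field.
Qed.

Lemma cartan_sym12 i j k z : D z -> cartan_tensor F i j k z = cartan_tensor F j i k z.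
Proof. by move=> Dz; rewrite !cartan_dy // (dyg_sym HF i j k Dz). Qed.

Lemma sum_cartan_y i k z : D z -> \sum_j cartan_tensor F i j k z * z.2 0 j = 0.
Proof.
move=> Dz.
transitivity (\sum_j 2^-1 * F z * (dy k (g F i j) z * z.2 0 j)).
  by apply: eq_bigr => j _; rewrite (cartan_dy i j k Dz); apply/esym; exact: mulrA.
by rewrite -mulr_sumr (sum_dyg_y' HF) // mulr0.
Qed.

Lemma cartan_mxT z v : D z -> (cartan_mx z v)^T = cartan_mx z v.
Proof.
move=> Dz; apply/matrixP => i j; rewrite !mxE; apply: eq_bigr => k _.
by rewrite cartan_sym12.
Qed.

Lemma cartan_fmxT q V : D q.1 -> (cartan_fmx q V)^T = cartan_fmx q V.
Proof.
by move=> Dq; rewrite /cartan_fmx !trmx_mul trmxK cartan_mxT // mulmxA.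
Qed.

Lemma frame_covf q V : frames q -> q.2 *m covf q V = vform q.1 V.1.
Proof. by move=> [_ uq]; rewrite /covf mulmxA mulmxV // mul1mx. Qed.

Lemma cartan_tensor_frameE a b q V : frames q ->
  \sum_c cartan_tensor_frame F a b c q * coframe_v F c q V = cartan_fmx q V a b.
Proof.
move=> fq; have [Dq uq] := fq.
transitivity (\sum_j \sum_i q.2 i a * (\sum_k cartan_tensor F i j k q.1 *
   (\sum_c q.2 k c * covf q V c 0)) * q.2 j b).
  rewrite -(contract3 (fun i j k => cartan_tensor F i j k q.1) (fun i => q.2 i a)
    (fun j => q.2 j b) (fun c => covf q V c 0) (fun k c => q.2 k c)).
  by apply: eq_bigr => c _; rewrite coframe_vE.
rewrite [RHS]mxE; apply: eq_bigr => j _; rewrite [(_ *m _) a j]mxE mulr_suml.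
apply: eq_bigr => i _; rewrite [q.2^T a i]mxE [cartan_mx _ _ i j]mxE; congr (_ * _ * _).
apply: eq_bigr => k _; congr (_ * _).
by have := congr1 (fun M : 'cV[R]_3 => M k 0) (frame_covf V fq); rewrite mxE.
Qed.

Lemma cartan_formE b a q V : frames q -> cartan_form F b a q V = kh q V a b.
Proof.
move=> fq; have [Dq uq] := fq.
rewrite /cartan_form chern_formE cartan_tensor_frameE // [RHS]mxE; congr (_ + _).
by rewrite -{1}cartan_fmxT // mxE.
Qed.

Let s_frame := msmooth_frame open_frames.
Let u_frame q : frames q -> q.2 \in unitmx. Proof. by case. Qed.
Let s_inv := msmoothV open_frames u_frame s_frame.

Lemma msmooth_gam v : msmooth frames (fun q => gam q.1 v).
Proof.
move=> i j; apply: (smooth_ext open_frames (f := fun q : FB => \sum_k chern F i j k q.1 * v.1 0 k)).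
  by move=> q _; rewrite mxE.
apply: smooth_sum; first exact: open_frames.
  move=> k; apply: smoothM; first exact: open_frames.
  exact: (smooth_base (smooth_chern HF i j k)).
by apply: smooth_cst; exact: open_frames.
Qed.

Lemma smooth_cartan_tensor i j k : smooth_on D (cartan_tensor F i j k).
Proof.
apply: (smooth_ext oD (f := fun z => 2^-1 * F z * dy k (g F i j) z)).
  by move=> z Dz; rewrite cartan_dy.
apply: smoothM => //; last by apply: smooth_dy; exact: smooth_g.
by apply: smoothM => //; [exact: smooth_cst|exact: lf_smooth HF].
Qed.

Lemma smooth_vform v i : smooth_on D (fun z => vform z v i 0).
Proof.
apply: (smooth_ext oD (f := fun z => (v.2 0 i + \sum_j nconn F i j z * v.1 0 j) * (F z)^-1)).
  by move=> z Dz; rewrite mxE.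
apply: smoothM => //; last first.
  by apply: smoothV => //; [move=> z Dz; rewrite gt_eqF // (F_gt0 HF)|exact: lf_smooth HF].
apply: smoothD => //; first exact: smooth_cst.
by apply: smooth_sum => // k; apply: smoothM => //; [exact: smooth_nconn|exact: smooth_cst].
Qed.

Lemma msmooth_cartan_mx v : msmooth frames (fun q => cartan_mx q.1 v).
Proof.
move=> i j; apply: (smooth_ext open_frames (f := fun q : FB => \sum_k cartan_tensor F i j k q.1 * vform q.1 v k 0)).
  by move=> q _; rewrite mxE.
apply: smooth_sum; first exact: open_frames.
  move=> k; apply: smoothM; first exact: open_frames.
  exact: (smooth_base (smooth_cartan_tensor i j k)).
exact: (smooth_base (smooth_vform v k)).
Qed.

Lemma msmooth_g : msmooth frames (fun q => gmx F q.1).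
Proof.
by move=> i j; apply: (smooth_base (f := fun z => gmx F z i j)); exact: smooth_g.
Qed.

Lemma msmooth_om W : msmooth frames (fun q => om q W).
Proof.
apply: (msmoothM open_frames s_inv); apply: (msmoothD open_frames).
  exact: (msmooth_cst open_frames W.2).
exact: (msmoothM open_frames (msmooth_gam _) s_frame).
Qed.

Lemma msmooth_cartan_fmx W : msmooth frames (fun q => cartan_fmx q W).
Proof.
apply: (msmoothM open_frames _ s_frame).
exact: (msmoothM open_frames (msmoothT open_frames s_frame) (msmooth_cartan_mx _)).
Qed.

Lemma msmooth_kh W : msmooth frames (fun q => kh q W).
Proof. exact: (msmoothD open_frames (msmooth_om W) (msmooth_cartan_fmx W)). Qed.

Lemma msmooth_grm : msmooth frames grm.
Proof.
apply: (msmoothM open_frames _ s_frame).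
exact: (msmoothM open_frames (msmoothT open_frames s_frame) msmooth_g).
Qed.

Lemma msmooth_cof W : msmooth frames (fun q => cof q W).
Proof. exact: (msmoothM open_frames s_inv (msmooth_cst open_frames _)). Qed.

Definition Dgam z v w : 'M[R]_3 :=
  \matrix_(i, j) \sum_k 'D_v (chern F i j k) z * w.1 0 k.

Lemma Dm_gam q V w : frames q -> Dm V (fun q => gam q.1 w) q = Dgam q.1 V.1 w.
Proof.
move=> fq; apply/matrixP => i j; rewrite [LHS]mxE [RHS]mxE.
transitivity ('D_V (fun q : FB => \sum_k chern F i j k q.1 * w.1 0 k) q).
  by congr (derive _ q V); apply/funext => p; rewrite mxE.
have sc k : smooth_on frames (fun q : FB => chern F i j k q.1).
  exact: (smooth_base (smooth_chern HF i j k)).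
have s1 k := smooth_cst (w.1 0 k) open_frames.
rewrite (sderive_sum V (fun k => smoothM open_frames (sc k) (s1 k)) fq).
apply: eq_bigr => k _; rewrite (sderiveM V (sc k) (s1 k) fq) derive_cst mulr0 add0r.
by [].
Qed.

Lemma om_frame q V : frames q -> q.2 *m om q V = V.2 + gam q.1 V.1 *m q.2.
Proof. by move=> [_ uq]; rewrite /om mulmxA mulmxV // mul1mx. Qed.

(** The curvature [dΓ + Γ ∧ Γ] in the coordinate frame, with the upper index as the row. *)
Definition curv_mx z v w : 'M[R]_3 :=
  Dgam z v w - Dgam z w v + gam z v *m gam z w - gam z w *m gam z v.

Lemma Dm_om q V W : frames q -> Dm V (fun q => om q W) q =
  - (invmx q.2 *m V.2 *m om q W)
  + invmx q.2 *m (Dgam q.1 V.1 W.1 *m q.2 + gam q.1 W.1 *m V.2).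
Proof.
move=> fq; have oU := open_frames.
have sgq := msmoothM oU (msmooth_gam W.1) s_frame.
have sin := msmoothD oU (msmooth_cst oU W.2) sgq.
rewrite (DmM oU V s_inv sin fq) (DmV oU V u_frame s_frame fq) Dm_frame.
rewrite (DmD V (msmooth_cst oU W.2) sgq fq) Dm_cst add0r.
rewrite (DmM oU V (msmooth_gam W.1) s_frame fq) Dm_frame (Dm_gam V W.1 fq).
by rewrite mulNmx /om !mulmxA.
Qed.

(** The equation [dω_b^a = ω_b^c ∧ ω_c^a + Ω_b^a]. The product [om W *m om V] has the plus sign
    because the upper index is the row. *)
Lemma d_om q V W : frames q ->
  Dm V (fun q => om q W) q - Dm W (fun q => om q V) q =
  om q W *m om q V - om q V *m om q W + invmx q.2 *m curv_mx q.1 V.1 W.1 *m q.2.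
Proof.
move=> fq; have [_ uq] := fq; rewrite (Dm_om V W fq) (Dm_om W V fq).
have oE X : om q X = invmx q.2 *m X.2 + invmx q.2 *m gam q.1 X.1 *m q.2.
  by rewrite /om mulmxDr !mulmxA.
(* By [om_frame], [q.2 *m om q Y] is again [Y.2] plus the connection term; so the products expand
   into the very terms produced by differentiating [invmx q.2] and [gam]. *)
have e1 X Y : om q X *m om q Y = invmx q.2 *m X.2 *m om q Y
   + (invmx q.2 *m gam q.1 X.1 *m Y.2 + invmx q.2 *m (gam q.1 X.1 *m gam q.1 Y.1) *m q.2).
  rewrite {1}oE mulmxDl; congr (_ + _).
  by rewrite -(mulmxA _ q.2 (om q Y)) (om_frame Y fq) mulmxDr !mulmxA.
rewrite !e1 /curv_mx !mulmxDr !mulmxN !mulmxDl !mulNmx !mulmxA.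
move: (invmx q.2 *m V.2 *m om q W) (invmx q.2 *m W.2 *m om q V).
move: (invmx q.2 *m gam q.1 V.1 *m W.2) (invmx q.2 *m gam q.1 W.1 *m V.2).
move: (invmx q.2 *m gam q.1 V.1 *m gam q.1 W.1 *m q.2) (invmx q.2 *m gam q.1 W.1 *m gam q.1 V.1 *m q.2).
move: (invmx q.2 *m Dgam q.1 V.1 W.1 *m q.2) (invmx q.2 *m Dgam q.1 W.1 V.1 *m q.2).
by move=> A1 A2 A3 A4 A5 A6 A7 A8; apply/matrixP => i j; rewrite !mxE; ring.
Qed.

Lemma gam_sym z v w : D z -> gam z v *m (w.1)^T = gam z w *m (v.1)^T.
Proof.
move=> Dz; apply/matrixP => i j; rewrite (ord1 j) [LHS]mxE [RHS]mxE.
transitivity (\sum_l \sum_k chern F i l k z * v.1 0 k * w.1 0 l).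
  by apply: eq_bigr => l _; rewrite [gam _ _ i l]mxE [(w.1^T) l 0]mxE mulr_suml.
rewrite exchange_big; apply: eq_bigr => k _ /=.
rewrite [gam _ _ i k]mxE [(v.1^T) k 0]mxE mulr_suml.
by apply: eq_bigr => l _; rewrite (chern_sym HF i l k Dz) mulrAC.
Qed.

(** The first structure equation [dω^a = ω^b ∧ ω_b^a]: there is no torsion, by [gam_sym]. *)
Lemma d_cof q V W : frames q ->
  Dm V (fun q => cof q W) q - Dm W (fun q => cof q V) q =
  om q W *m cof q V - om q V *m cof q W.
Proof.
move=> fq; have [Dq uq] := fq; have oU := open_frames.
have e X Y : Dm X (fun q => cof q Y) q = - (invmx q.2 *m X.2 *m cof q Y).
  rewrite (DmM oU X s_inv (msmooth_cst oU _) fq) (DmV oU X u_frame s_frame fq) Dm_frame.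
  by rewrite Dm_cst mulmx0 addr0 mulNmx /cof !mulmxA.
have oE X Y : om q X *m cof q Y = invmx q.2 *m X.2 *m cof q Y
    + invmx q.2 *m (gam q.1 X.1 *m Y.1.1^T).
  rewrite /om mulmxDr mulmxDl; congr (_ + _); rewrite /cof !mulmxA.
  by congr (_ *m _); rewrite -!mulmxA mulmxV // mulmx1.
rewrite !e !oE (gam_sym V.1 W.1 Dq).
move: (_ *m cof q V) (_ *m cof q W) (invmx q.2 *m (gam q.1 W.1 *m _)) => A B C.
by apply/matrixP => i j; rewrite !mxE; ring.
Qed.

(** The Chern connection is metric in horizontal directions by [delta_g]; vertically the derivative
    of [g] is [2 A / F], which gives the last term. *)
Lemma Dm_gmx z v : D z -> Dm v (gmx F) z =
  (gam z v)^T *m gmx F z + gmx F z *m gam z v + (cartan_mx z v *+ 2).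
Proof.
move=> Dz; apply/matrixP => i j; rewrite mxE.
rewrite (derive_coord v (smooth_differentiable (smooth_g HF i j) Dz)).
have dxE k : dx k (g F i j) z = \sum_m g F j m z * chern F m i k z
   + \sum_m g F i m z * chern F m j k z + \sum_l nconn F l k z * dy l (g F i j) z.
  by rewrite -(delta_g HF i j k Dz) /delta_dx subrK.
have F0 : F z != 0 by rewrite gt_eqF // (F_gt0 HF).
have two0 : (2 : R) != 0 by rewrite pnatr_eq0.
apply: (etrans (f_equal2 +%R (eq_bigr _ (fun k _ => congr1 ( *%R (v.1 0 k)) (dxE k))) erefl)).
apply: (etrans (metric_compatibility_sum (fun k => v.1 0 k) (fun k => v.2 0 k)
  (fun m => g F i m z) (fun m => g F j m z) (fun l => dy l (g F i j) z)
  (fun m k => chern F m i k z) (fun m k => chern F m j k z)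
  (fun l k => nconn F l k z) two0 F0)).
rewrite [RHS]mxE [X in _ = X + _]mxE; apply: (f_equal2 +%R); [apply: (f_equal2 +%R)|].
- rewrite [RHS]mxE; apply: eq_bigr => m _.
  by rewrite [_^T i m]mxE [gam _ _ m i]mxE -[gmx F z m j]/(g F m j z) (g_sym HF m j Dz).
- by rewrite [RHS]mxE; apply: eq_bigr => m _; rewrite [gam _ _ m j]mxE.
rewrite mulmxnE [cartan_mx _ _ i j]mxE; apply: (f_equal (fun x => x *+ 2)).
by apply: eq_bigr => k _; rewrite (cartan_dy i j k Dz) [vform _ _ k 0]mxE.
Qed.

(** [Dm_gmx] carried over to frames. Where [grm] is constant it says that [om] plus the Cartan
    tensor term is skew, which is the origin of the Cartan connection. *)
Lemma Dm_grm q V : frames q -> Dm V grm q =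
  (om q V)^T *m grm q + grm q *m om q V + (cartan_fmx q V *+ 2).
Proof.
move=> fq; have [Dq uq] := fq; have oU := open_frames.
have sT := msmoothT oU s_frame.
rewrite (DmM oU V (msmoothM oU sT msmooth_g) s_frame fq) (DmM oU V sT msmooth_g fq).
rewrite DmT Dm_frame.
have -> : Dm V (fun q : FB => gmx F q.1) q = Dm V.1 (gmx F) q.1.
  by apply/matrixP => i j; rewrite [LHS]mxE [RHS]mxE.
rewrite (Dm_gmx V.1 Dq).
have V2 : V.2 = q.2 *m om q V - gam q.1 V.1 *m q.2 by rewrite om_frame // addrK.
rewrite {}V2 /grm /cartan_fmx; move: (om q V) => w; rewrite linearB /= !trmx_mul !mulr2n.
rewrite !(mulmxDl, mulmxBl, mulmxDr, mulmxBr, mulNmx, mulmxN) !mulmxA.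
move: (w^T *m q.2^T *m gmx F q.1 *m q.2) (q.2^T *m (gam q.1 V.1)^T *m gmx F q.1 *m q.2).
move: (q.2^T *m gmx F q.1 *m gam q.1 V.1 *m q.2) (q.2^T *m gmx F q.1 *m q.2 *m w).
move: (q.2^T *m cartan_mx q.1 V.1 *m q.2) => A B C E G.
by apply/matrixP => i j; rewrite !mxE; ring.
Qed.

End StructureEquations.

(** * Skewness and curvature of the Cartan connection on adapted frames *)

Section AdaptedFrames.
Context {R : realType}.
Local Notation TV := (TV R).
Local Notation FB := (FB R).
Variables (O : set 'rV[R]_3) (F : TV -> R).
Hypothesis HF : local_finsler O F.
Local Notation D := (slit O).
Implicit Types (z v w : TV) (q V W : FB).

Let oD : open D. Proof. exact/open_slit/lf_open/HF. Qed.
Let oU := open_frames HF.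

Definition adapted : set FB := [set q | D q.1 /\ SO2_TM F q].

Lemma adapted_frames q : adapted q -> frames O q.
Proof.
move=> [Dq [_ _ _ dq]]; split=> //.
by rewrite unitmxE unitfE gt_eqF.
Qed.

Lemma adapted_grm q : adapted q -> grm F q = 1%:M.
Proof.
by move=> [_ [_ gq _ _]]; apply/matrixP => i j; rewrite -gramE gq mxE.
Qed.

Lemma tangent_grm q V : T_SO2_TM F q V -> Dm V (grm F) q = 0.
Proof.
move=> [tg _]; apply/matrixP => i j; rewrite [LHS]mxE [RHS]mxE -(tg i j).
by congr (derive _ q V); apply/funext => p; rewrite gramE.
Qed.

Lemma kh_skew q V : adapted q -> T_SO2_TM F q V -> (kh F q V)^T = - kh F q V.
Proof.
move=> aq tV; have fq := adapted_frames aq; have [Dq _] := aq.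
have := Dm_grm HF V fq; rewrite tangent_grm // adapted_grm // mulmx1 mul1mx /kh.
rewrite linearD /= (cartan_fmxT HF V Dq); move: (om F q V) (cartan_fmx F q V) => A C /matrixP E.
by apply/matrixP => i j; have := E i j; rewrite mulr2n !mxE => ?; lra.
Qed.

Lemma kh_skew_entry q V i j : adapted q -> T_SO2_TM F q V -> kh F q V i j = - kh F q V j i.
Proof.
move=> aq tV; have := congr1 (fun M : 'M[R]_3 => M j i) (kh_skew aq tV).
by rewrite mxE [in RHS]mxE.
Qed.

Definition dom q V W := Dm V (fun q => om F q W) q - Dm W (fun q => om F q V) q.
Definition dkh q V W := Dm V (fun q => kh F q W) q - Dm W (fun q => kh F q V) q.

Lemma dkh_skew_part q V W : frames O q ->
  dkh q V W - (dkh q V W)^T = dom q V W - (dom q V W)^T.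
Proof.
move=> fq; have sk X := msmooth_kh HF X; have so X := msmooth_om HF X.
have e X Y : Dm X (fun q => kh F q Y) q - (Dm X (fun q => kh F q Y) q)^T
    = Dm X (fun q => om F q Y) q - (Dm X (fun q => om F q Y) q)^T.
  rewrite -!DmT -(DmB oU X (sk Y) (msmoothT oU (sk Y)) fq).
  rewrite -(DmB oU X (so Y) (msmoothT oU (so Y)) fq).
  apply: (Dm_congr oU X fq) => p [Dp up]; rewrite /kh linearD /= (cartan_fmxT HF Y Dp).
  by rewrite opprD addrACA subrr addr0.
have sw (A B : 'M[R]_3) : A - B - (A - B)^T = (A - A^T) - (B - B^T).
  by apply/matrixP => i j; rewrite !mxE; ring.
apply: (etrans (sw _ _)); apply: (etrans _ (esym (sw _ _))).
by apply: (f_equal2 (fun a b => a - b)); exact: e.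
Qed.

(** By [Dm_grm], [kh] plus its transpose is the derivative of [grm] up to multiples of [1 - grm].
    The latter vanish to first order along the bundle, and the second derivatives of [grm] cancel by
    symmetry. *)
Lemma dkh_skew q V W : adapted q -> T_SO2_TM F q V -> T_SO2_TM F q W ->
  (dkh q V W)^T = - dkh q V W.
Proof.
move=> aq tV tW; have fq := adapted_frames aq.
have sk X := msmooth_kh HF X; have so X := msmooth_om HF X; have sg := msmooth_grm HF.
pose Z p := 1%:M - grm F p.
have sZ : msmooth (frames O) Z := msmoothB oU (msmooth_cst oU 1%:M) sg.
have Zq : Z q = 0 by rewrite /Z adapted_grm // subrr.
have DZ X : T_SO2_TM F q X -> Dm X Z q = 0.
  move=> tX; rewrite (DmB oU X (msmooth_cst oU 1%:M) sg fq) Dm_cst tangent_grm //.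
  by rewrite subrr.
have e X Y : T_SO2_TM F q X ->
    Dm X (fun q => kh F q Y) q + (Dm X (fun q => kh F q Y) q)^T = Dm X (Dm Y (grm F)) q.
  move=> tX; rewrite -DmT -(DmD X (sk Y) (msmoothT oU (sk Y)) fq).
  have sD := msmooth_Dm oU Y sg.
  have sA := msmoothM oU sZ (so Y).
  have sB := msmoothM oU (msmoothT oU (so Y)) sZ.
  (* [Z] and its derivative along [X] vanish at [q], so the two products with [Z] contribute nothing
     to the derivative. *)
  transitivity (Dm X (fun p => Dm Y (grm F) p + Z p *m om F p Y + (om F p Y)^T *m Z p) q).
    apply: (Dm_congr oU X fq) => p fp; rewrite (Dm_grm HF Y fp) /kh /Z linearD /=.
    rewrite (cartan_fmxT HF Y (proj1 fp)) mulmxBl mulmxBr mul1mx mulmx1 mulr2n.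
    move: (om F p Y) (cartan_fmx F p Y) => A C; move: (A^T *m _) (_ *m A) => P Q.
    by apply/matrixP => i j; rewrite !mxE; ring.
  rewrite (DmD X (msmoothD oU sD sA) sB fq) (DmD X sD sA fq).
  rewrite (DmM oU X sZ (so Y) fq) (DmM oU X (msmoothT oU (so Y)) sZ fq).
  by rewrite (DZ X tX) Zq !mul0mx !mulmx0 !addr0.
have sw (A B : 'M[R]_3) : A - B + (A - B)^T = (A + A^T) - (B + B^T).
  by apply/matrixP => i j; rewrite !mxE; ring.
apply/eqP; rewrite -addr_eq0 addrC; apply/eqP; apply: (etrans (sw _ _)).
apply: (etrans (f_equal2 (fun a b => a - b) (e V W tV) (e W V tW))).
by apply/eqP; rewrite subr_eq0; apply/eqP; exact: (Dm_comm oU V W sg fq).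
Qed.

Definition ccurv q V W := dkh q V W - kh F q W *m kh F q V + kh F q V *m kh F q W.

Lemma cartan_curvE b a q V W : frames O q -> cartan_curv F b a q V W = ccurv q V W a b.
Proof.
move=> fq; rewrite /cartan_curv /d1 /ccurv /dkh.
have e X Y : 'D_X (fun p : FB => cartan_form F b a p Y) q = Dm X (fun q => kh F q Y) q a b.
  rewrite mxE; apply: (derive_congr X oU fq) => p fp.
  exact: (cartan_formE HF b a Y fp).
rewrite !e [RHS]mxE [X in _ = X + _]mxE [X in _ = X + _ + _]mxE.
rewrite [X in _ = _ + X + _ + _]mxE [X in _ = _ + X + _]mxE -[RHS]addrA; congr (_ + _).
rewrite ![(_ *m _) a b]mxE -sumrN -sumrN -big_split; apply: eq_bigr => c _ /=.
by rewrite /wedge !(cartan_formE HF _ _ _ fq); ring.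
Qed.

Definition curv_frame q V W := invmx q.2 *m curv_mx F q.1 V.1 W.1 *m q.2.

(* The symmetric part of the Chern connection form is the Cartan tensor, whose
   differential drops out of the skew-symmetric Cartan curvature. *)
Lemma ccurvE q V W : adapted q -> T_SO2_TM F q V -> T_SO2_TM F q W ->
  ccurv q V W = 2^-1 *: (curv_frame q V W - (curv_frame q V W)^T)
    + (cartan_fmx F q W *m cartan_fmx F q V - cartan_fmx F q V *m cartan_fmx F q W).
Proof.
move=> aq tV tW; have fq := adapted_frames aq; have [Dq _] := aq.
have H : dkh q V W = 2^-1 *: (dom q V W - (dom q V W)^T).
  rewrite -(dkh_skew_part V W fq) (dkh_skew aq tV tW); move: (dkh q V W) => A.
  by apply/matrixP => i j; rewrite !mxE; field.
rewrite /ccurv H /dom (d_om HF V W fq) -/(curv_frame q V W).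
have oE X : om F q X = kh F q X - cartan_fmx F q X by rewrite /kh addrK.
have kV := kh_skew aq tV; have kW := kh_skew aq tW.
have cV := cartan_fmxT HF V Dq; have cW := cartan_fmxT HF W Dq.
rewrite !oE; move: (curv_frame q V W) => K.
move: (kh F q V) (kh F q W) (cartan_fmx F q V) (cartan_fmx F q W) kV kW cV cW.
move=> {}kV {}kW {}cV {}cW eV eW fV fW.
have tr (X Y : 'M[R]_3) : (X *m Y)^T = Y^T *m X^T by exact: trmx_mul.
have trD (X Y : 'M[R]_3) : (X + Y)^T = X^T + Y^T by exact: linearD.
have trN (X : 'M[R]_3) : (- X)^T = - X^T by exact: linearN.
rewrite !(trD, trN, tr) eV eW fV fW.
rewrite !(mulmxDl, mulmxBl, mulmxDr, mulmxBr, mulNmx, mulmxN).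
move: (kV *m kW) (kW *m kV) (cV *m cW) (cW *m cV) (kV *m cW) (cW *m kV) (kW *m cV) (cV *m kW).
move=> A1 A2 A3 A4 A5 A6 A7 A8; apply/matrixP => i j; rewrite !mxE.
by field.
Qed.

Lemma ccurv_skew q V W i j : adapted q -> T_SO2_TM F q V -> T_SO2_TM F q W ->
  ccurv q V W i j = - ccurv q V W j i.
Proof.
move=> aq tV tW.
have kV := kh_skew aq tV; have kW := kh_skew aq tW.
suff /matrixP /(_ j i) : (ccurv q V W)^T = - ccurv q V W by rewrite mxE [in RHS]mxE.
have tr (X Y : 'M[R]_3) : (X *m Y)^T = Y^T *m X^T by exact: trmx_mul.
have trD (X Y : 'M[R]_3) : (X + Y)^T = X^T + Y^T by exact: linearD.
have trN (X : 'M[R]_3) : (- X)^T = - X^T by exact: linearN.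
have dk := dkh_skew aq tV tW; rewrite /ccurv.
move: (dkh q V W) (kh F q V) (kh F q W) dk kV kW => A B C eA eB eC.
rewrite !(trD, trN, tr) eA eB eC !mulNmx !mulmxN !opprK.
by move: (B *m C) (C *m B) => P Q; apply/matrixP => k l; rewrite !mxE; ring.
Qed.

(** On SM the third frame vector is [y], and the Cartan tensor contracted with [y] vanishes by
    homogeneity. *)
Lemma cartan_fmx_col3 q V a : adapted q -> F q.1 = 1 -> cartan_fmx F q V a ix3 = 0.
Proof.
move=> [Dq [_ _ uq _]] F1; rewrite /cartan_fmx -mulmxA mxE big1 // => i _.
rewrite [X in _ * X]mxE.
have -> : \sum_j cartan_mx F q.1 V.1 i j * q.2 j ix3 =
   \sum_k vform F q.1 V.1 k 0 * (\sum_j cartan_tensor F i j k q.1 * q.1.2 0 j).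
  under [RHS]eq_bigr do rewrite mulr_sumr; rewrite exchange_big; apply: eq_bigr => j _ /=.
  have -> : q.2 j ix3 = q.1.2 0 j.
    have /eqP := uq j; rewrite /last_minus_u subr_eq0 => /eqP ->.
    by rewrite /u /uvec F1 invr1 scale1r.
  rewrite [cartan_mx _ _ _ i j]mxE mulr_suml; apply: eq_bigr => k _.
  by rewrite mulrCA mulrA.
by rewrite big1 ?mulr0 // => k _; rewrite (sum_cartan_y HF) // mulr0.
Qed.

Lemma tangent_last q V i : adapted q -> F q.1 = 1 -> T_SO2_TM F q V ->
  V.2 i ix3 = V.1.2 0 i - 'D_V.1 F q.1 * q.1.2 0 i.
Proof.
move=> aq F1 [_ /(_ i)]; have fq := adapted_frames aq; have [Dq _] := aq.
have sF := lf_smooth HF.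
have F0 y : D y -> F y != 0 by move=> Dy; rewrite gt_eqF // (F_gt0 HF).
have sV := smoothV oD F0 sF; have sy := smooth_ycoord i oD.
have su : smooth_on D (u F i).
  apply: (smooth_ext oD _ (smoothM oD sV sy)) => y _.
  by rewrite /u /uvec mxE.
have s1 : smooth_on (frames O) (fun q : FB => q.2 i ix3) := msmooth_frame oU i ix3.
have s2 := smooth_base su.
have -> : last_minus_u F i = (fun q : FB => q.2 i ix3 - u F i q.1) by [].
rewrite (sderiveB V s1 s2 fq) [X in X - _](derive_scalar q V (scalar_frame_entry i ix3)).
have -> : 'D_V (fun q : FB => u F i q.1) q = 'D_V.1 (u F i) q.1 by [].
have -> : 'D_V.1 (u F i) q.1 = V.1.2 0 i - 'D_V.1 F q.1 * q.1.2 0 i.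
  transitivity ('D_V.1 (fun z => (F z)^-1 * z.2 0 i) q.1).
    by congr (derive _ q.1 V.1); apply/funext => y; rewrite /u /uvec mxE.
  rewrite (sderiveM V.1 sV sy Dq) (derive_scalar _ _ (scalar_ycoord i)).
  have dF : derivable F q.1 V.1 := smooth_derivable sF Dq.
  rewrite (deriveV (F0 _ Dq) dF) F1 expr1n invr1 -[_ *: _]/(_ * _).
  by rewrite mul1r; move: ('D__ _ _) => t; ring.
by move=> /eqP; rewrite subr_eq0 => /eqP.
Qed.

Lemma adapted_col3 q i : adapted q -> F q.1 = 1 -> q.2 i ix3 = q.1.2 0 i.
Proof.
move=> [_ [_ _ uq _]] F1; have /eqP := uq i; rewrite /last_minus_u subr_eq0 => /eqP ->.
by rewrite /u /uvec F1 invr1 scale1r.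
Qed.

(** Differentiating [e_3 = y / F] and using [Γ y = N] gives [δy] minus its radial part, whence the
    correction by [dF] in the third component. *)
Lemma om_col3 q V a : adapted q -> F q.1 = 1 -> T_SO2_TM F q V ->
  om F q V a ix3 = covf F q V a 0 - kron R a ix3 * 'D_V.1 F q.1.
Proof.
move=> aq F1 tV; have [Dq uq] := adapted_frames aq.
have -> : kron R a ix3 = (invmx q.2 *m q.2) a ix3.
  by rewrite mulVmx // mxE.
rewrite /om /covf !mxE mulr_suml -sumrB; apply: eq_bigr => i _.
rewrite -mulrA -mulrBr; congr (_ * _); rewrite !mxE F1 divr1.
rewrite (tangent_last i aq F1 tV) (adapted_col3 i aq F1).
have -> : \sum_j gam F q.1 V.1 i j * q.2 j ix3 = \sum_j nconn F i j q.1 * V.1.1 0 j.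
  transitivity (\sum_k (\sum_j chern F i j k q.1 * q.1.2 0 j) * V.1.1 0 k).
    under [RHS]eq_bigr do rewrite mulr_suml.
    rewrite exchange_big; apply: eq_bigr => j _ /=.
    rewrite [gam _ _ _ i j]mxE mulr_suml (adapted_col3 j aq F1).
    by apply: eq_bigr => k _; rewrite mulrAC.
  by apply: eq_bigr => k _; rewrite (sum_chern_y HF).
by rewrite [q.1.2 0 i * _]mulrC addrAC.
Qed.

Lemma kh_col3 q V a : adapted q -> F q.1 = 1 -> T_SO2_TM F q V ->
  kh F q V a ix3 = covf F q V a 0 - kron R a ix3 * 'D_V.1 F q.1.
Proof.
by move=> aq F1 tV; rewrite mxE om_col3 // cartan_fmx_col3 // addr0.
Qed.

(** The diagonal entry of the skew matrix [kh] is zero, while [kh_col3] computes it as the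
    difference of the two sides. *)
Lemma covf3 q V : adapted q -> F q.1 = 1 -> T_SO2_TM F q V ->
  covf F q V ix3 0 = 'D_V.1 F q.1.
Proof.
move=> aq F1 tV; have := kh_skew_entry ix3 ix3 aq tV; rewrite kh_col3 //.
have -> : kron R ix3 ix3 = 1 by rewrite /kron eqxx.
by move: (covf _ _ _ _ _) ('D__ _ _) => x y ?; lra.
Qed.

End AdaptedFrames.

(** * The form in coordinates *)

Section SigmaCoordinates.
Context {R : realType}.
Local Notation TV := (TV R).
Local Notation FB := (FB R).
Variables (O : set 'rV[R]_3) (F : TV -> R).
Hypothesis HF : local_finsler O F.
Local Notation D := (slit O).
Variables p s : R.
Implicit Types (z v w : TV) (q V W : FB).


Lemma kron_values : ((kron R ix1 ix1 = 1) * (kron R ix2 ix2 = 1) * (kron R ix3 ix3 = 1)) *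
  ((kron R ix1 ix2 = 0) * (kron R ix1 ix3 = 0) * (kron R ix2 ix1 = 0)
  * (kron R ix2 ix3 = 0) * (kron R ix3 ix1 = 0) * (kron R ix3 ix2 = 0)).
Proof. by do !split. Qed.

Definition Jmx : 'M[R]_3 := \matrix_(a, b) spin_frame s a b.

Lemma adapted_ginv q : adapted O F q -> invmx (gmx F q.1) = q.2 *m q.2^T.
Proof.
move=> aq; have [Dq uq] := adapted_frames aq; have := adapted_grm aq; rewrite /grm => E.
have Eg : q.2^T *m gmx F q.1 = invmx q.2.
  by rewrite -[LHS]mulmx1 -(mulmxV uq) mulmxA E mul1mx.
have gu := gmx_unit HF Dq.
rewrite -[RHS]mulmx1 -(mulmxV gu) mulmxA -(mulmxA q.2) Eg mulmxV //.
by rewrite mul1mx.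
Qed.

Lemma adapted_inv q : adapted O F q -> q.2^T *m gmx F q.1 = invmx q.2.
Proof.
move=> aq; have [Dq uq] := adapted_frames aq; have := adapted_grm aq; rewrite /grm => E.
by rewrite -[LHS]mulmx1 -(mulmxV uq) mulmxA E mul1mx.
Qed.

Lemma adapted_g q : adapted O F q -> gmx F q.1 = (invmx q.2)^T *m invmx q.2.
Proof.
move=> aq; have [Dq uq] := adapted_frames aq.
by rewrite -{2}(adapted_inv aq) mulmxA -trmx_mul (mulmxV uq) trmx1 mul1mx.
Qed.

Lemma det2 (A : 'M[R]_2) : \det A = A 0 0 * A 1 1 - A 0 1 * A 1 0.
Proof.
rewrite (expand_det_row _ 0) !big_ord_recl big_ord0 /cofactor !det_mx11 !mxE /=.
transitivity (A 0 0 * (1 * A 1 1) + (A 0 1 * (-1 * A 1 0) + 0)); last by ring.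
congr (_ * (_ * _) + (_ * (_ * _) + _)).
all: by [congr (A _ _); apply: val_inj | rewrite ?expr0 ?expr1].
Qed.

(* The first two rows of a matrix and the last column of its inverse are
   related by the cross product. *)
Lemma cross_rows (B E : 'M[R]_3) i j : B *m E = 1%:M ->
  \det B * \sum_k levi R i j k * E k ix3 = B ix1 i * B ix2 j - B ix2 i * B ix1 j.
Proof.
move=> BE.
have EB : E *m B = 1%:M by exact: mulmx1C.
have adjE k : \det B * E k ix3 = cofactor B ix3 k.
  have : \adj B = \det B *: E.
    by rewrite -[LHS]mul1mx -EB -mulmxA mul_mx_adj mul_mx_scalar.
  by move/matrixP/(_ k ix3); rewrite !mxE => ->.
rewrite mulr_sumr; under eq_bigr do rewrite mulrCA adjE.
rewrite sum3 /cofactor !det2 !mxE.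
have l0 : lift ix3 0 = ix1 by apply: val_inj.
have l1 : lift ix3 1 = ix2 by apply: val_inj.
have m0 : lift ix1 0 = ix2 by apply: val_inj.
have m1 : lift ix1 1 = ix3 by apply: val_inj.
have n0 : lift ix2 0 = ix1 by apply: val_inj.
have n1 : lift ix2 1 = ix3 by apply: val_inj.
rewrite l0 l1 m0 m1 n0 n1 /levi /= !addn1 ?addn0 ?addn2.
have [->|->|->] : [\/ i = ix1, i = ix2 | i = ix3].
- by case: i => -[|[|[|//]]] ?; [constructor 1|constructor 2|constructor 3]; apply: val_inj.
- have [->|->|->] : [\/ j = ix1, j = ix2 | j = ix3].
  + by case: j => -[|[|[|//]]] ?; [constructor 1|constructor 2|constructor 3]; apply: val_inj.
  + by rewrite /= !exprS !expr0; field.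
  + by rewrite /= !exprS !expr0; field.
  + by rewrite /= !exprS !expr0; field.
- have [->|->|->] : [\/ j = ix1, j = ix2 | j = ix3].
  + by case: j => -[|[|[|//]]] ?; [constructor 1|constructor 2|constructor 3]; apply: val_inj.
  + by rewrite /= !exprS !expr0; field.
  + by rewrite /= !exprS !expr0; field.
  + by rewrite /= !exprS !expr0; field.
- have [->|->|->] : [\/ j = ix1, j = ix2 | j = ix3].
  + by case: j => -[|[|[|//]]] ?; [constructor 1|constructor 2|constructor 3]; apply: val_inj.
  + by rewrite /= !exprS !expr0; field.
  + by rewrite /= !exprS !expr0; field.
  + by rewrite /= !exprS !expr0; field.
Qed.

Definition SLmx z : 'M[R]_3 := \matrix_(i, j) spin_low F s i j z.
Definition SUmx z : 'M[R]_3 := \matrix_(i, j) spin_up F s i j z.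

Lemma adapted_spin_low q : adapted O F q -> F q.1 = 1 ->
  SLmx q.1 = (invmx q.2)^T *m Jmx *m invmx q.2.
Proof.
move=> aq F1; have [Dq uq] := adapted_frames aq; have [_ [_ _ _ dq]] := aq.
apply/matrixP => i j; rewrite [LHS]mxE /spin_low.
have -> : uvec F q.1 = q.1.2 by rewrite /uvec F1 invr1 scale1r.
have -> : (q.1.1, q.1.2) = q.1 by case: (q.1).
(* The determinant of [g] is the square of that of the inverse frame; the positive orientation of
   the frame removes the absolute value. *)
have -> : Num.sqrt (\det (gmx F q.1)) = \det (invmx q.2).
  rewrite (adapted_g aq) det_mulmx det_tr -expr2 sqrtr_sqr gtr0_norm //.
  by rewrite det_inv invr_gt0.
rewrite -mulrA.
have -> : \sum_k levi R i j k * u F k q.1 = \sum_k levi R i j k * q.2 k ix3.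
  by apply: eq_bigr => k _; rewrite (adapted_col3 k aq F1) /u /uvec F1 invr1 scale1r.
rewrite (cross_rows i j (mulVmx uq)).
rewrite mxE sum3 ![(_ *m Jmx) i _]mxE !sum3 !mxE /spin_frame !kron_values.
ring.
Qed.

Lemma adapted_spin_up q : adapted O F q -> F q.1 = 1 -> SUmx q.1 = q.2 *m Jmx *m q.2^T.
Proof.
move=> aq F1; have [Dq uq] := adapted_frames aq.
have -> : SUmx q.1 = invmx (gmx F q.1) *m SLmx q.1 *m (invmx (gmx F q.1))^T.
  apply/matrixP => i j; rewrite [LHS]mxE /spin_up exchange_big [RHS]mxE.
  apply: eq_bigr => l _ /=; rewrite [(_ *m SLmx _) i l]mxE mulr_suml.
  by apply: eq_bigr => k _; rewrite [SLmx _ k l]mxE [_^T l j]mxE /ginv mulrAC.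
rewrite (adapted_spin_low aq F1) (adapted_ginv aq) trmx_mul trmxK !mulmxA.
rewrite -(mulmxA q.2 q.2^T) -trmx_mul mulVmx // trmx1 mulmx1.
by rewrite -(mulmxA _ (invmx q.2) q.2) mulVmx // mulmx1.
Qed.

End SigmaCoordinates.

Section SigmaForm.
Context {R : realType}.
Local Notation TV := (TV R).
Local Notation FB := (FB R).
Variables (O : set 'rV[R]_3) (F : TV -> R).
Hypothesis HF : local_finsler O F.
Local Notation D := (slit O).
Variables p s : R.
Implicit Types (z v w : TV) (q V W : FB).

Let oU := open_frames HF.

(** The trace against the skew [SUmx] discards the g-symmetric part of the Chern curvature. The
    second trace is the commutator of Cartan tensors from [ccurvE]. *)
Definition sigma_coord z v w : R :=
  p * (((vform F z v)^T *m gmx F z *m w.1^T) 0 0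
       - ((vform F z w)^T *m gmx F z *m v.1^T) 0 0)
  + 2^-1 * \tr (SUmx F s z *m gmx F z *m curv_mx F z v w)
  + 2^-1 * \tr (SUmx F s z *m
      (cartan_mx F z w *m invmx (gmx F z) *m cartan_mx F z v
       - cartan_mx F z v *m invmx (gmx F z) *m cartan_mx F z w))
  - ((vform F z v)^T *m SLmx F s z *m vform F z w) 0 0.

Lemma tr_Jmx (X : 'M[R]_3) : \tr (Jmx s *m X) = s * (X ix2 ix1 - X ix1 ix2).
Proof.
by rewrite /mxtrace sum3 ![(_ *m _) _ _]mxE !sum3 !mxE /spin_frame !kron_values; ring.
Qed.

Lemma sigma_frame_explicit q V W : adapted O F q -> F q.1 = 1 ->
  T_SO2_TM F q V -> T_SO2_TM F q W ->
  sigma_frame F p s q V W =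
    p * (covf F q V ix1 0 * cof q W ix1 0 - covf F q W ix1 0 * cof q V ix1 0
       + (covf F q V ix2 0 * cof q W ix2 0 - covf F q W ix2 0 * cof q V ix2 0))
    + s * ccurv F q V W ix2 ix1
    - s * (covf F q V ix1 0 * covf F q W ix2 0 - covf F q W ix1 0 * covf F q V ix2 0).
Proof.
move=> aq F1 tV tW; have fq := adapted_frames aq.
have c12 := ccurv_skew HF ix1 ix2 aq tV tW.
rewrite /sigma_frame !sum3 !(cartan_curvE HF _ _ _ _ fq) /wedge !coframe_vE !coframeE.
rewrite /hframe /spin_frame !kron_values c12.
move: (ccurv F q V W ix2 ix1) (ccurv F q V W ix1 ix1) (ccurv F q V W ix2 ix2) (ccurv F q V W ix3 ix3).
move: (ccurv F q V W ix3 ix1) (ccurv F q V W ix1 ix3) (ccurv F q V W ix3 ix2) (ccurv F q V W ix2 ix3).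
move: (covf F q V) (covf F q W) (cof q V) (cof q W) => {c12 tV tW fq} a b c e.
by move=> ? ? ? ? ? ? ? ?; field.
Qed.

(** In each term the frame matrices cancel, by orthonormality or by cyclicity of the trace. Tangency
    to SM kills the third vertical component, so the full metric in [sigma_coord] agrees with
    [hframe] in [sigma_frame]. *)
Lemma sigma_frameE q V W : adapted O F q -> F q.1 = 1 ->
  T_SO2_TM F q V -> T_SO2_TM F q W -> T_SM F q.1 V.1 -> T_SM F q.1 W.1 ->
  sigma_frame F p s q V W = sigma_coord q.1 V.1 W.1.
Proof.
move=> aq F1 tV tW sV sW; have fq := adapted_frames aq; have [Dq uq] := fq.
rewrite sigma_frame_explicit //.
have cV3 : covf F q V ix3 0 = 0 by rewrite (covf3 HF aq F1 tV); exact: sV.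
have cW3 : covf F q W ix3 0 = 0 by rewrite (covf3 HF aq F1 tW); exact: sW.
have vE X : vform F q.1 X.1 = q.2 *m covf F q X by rewrite (frame_covf _ _ fq).
have xE X : X.1.1^T = q.2 *m cof q X by rewrite /cof mulmxA mulmxV // mul1mx.
have gE' := adapted_grm aq; rewrite /grm in gE'.
have t1 X Y : ((vform F q.1 X.1)^T *m gmx F q.1 *m Y.1.1^T) 0 0 =
    \sum_a covf F q X a 0 * cof q Y a 0.
  rewrite vE xE; move: (covf F q X) (cof q Y) => a b; rewrite trmx_mul !mulmxA.
  rewrite -(mulmxA a^T) -(mulmxA a^T) gE' mulmx1 mxE.
  by apply: eq_bigr => i _; rewrite mxE.
have t2 : \tr (SUmx F s q.1 *m gmx F q.1 *m curv_mx F q.1 V.1 W.1) =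
    \tr (Jmx s *m curv_frame F q V W).
  rewrite (adapted_spin_up HF s aq F1) -(mulmxA _ q.2^T) (adapted_inv aq).
  rewrite -!(mulmxA q.2) mxtrace_mulC /curv_frame; congr (\tr _).
  by rewrite !mulmxA.
have t3 X Y : \tr (SUmx F s q.1 *m (cartan_mx F q.1 X.1 *m invmx (gmx F q.1)
    *m cartan_mx F q.1 Y.1)) = \tr (Jmx s *m (cartan_fmx F q X *m cartan_fmx F q Y)).
  rewrite (adapted_spin_up HF s aq F1) (adapted_ginv HF aq) -!(mulmxA q.2) mxtrace_mulC.
  by congr (\tr _); rewrite /cartan_fmx !mulmxA.
have t4 : ((vform F q.1 V.1)^T *m SLmx F s q.1 *m vform F q.1 W.1) 0 0 =
    s * (covf F q V ix1 0 * covf F q W ix2 0 - covf F q W ix1 0 * covf F q V ix2 0).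
  rewrite (adapted_spin_low s aq F1) !vE; move: (covf F q V) (covf F q W) => a b.
  rewrite trmx_mul !mulmxA -(mulmxA a^T) -trmx_mul mulVmx // trmx1 mulmx1.
  rewrite -(mulmxA _ (invmx q.2)) mulVmx // mulmx1.
  by rewrite mxE sum3 ![(_ *m Jmx s) 0 _]mxE !sum3 !mxE /spin_frame !kron_values; ring.
have t5 : s * ccurv F q V W ix2 ix1 = 2^-1 * \tr (Jmx s *m curv_frame F q V W)
   + 2^-1 * (\tr (Jmx s *m (cartan_fmx F q W *m cartan_fmx F q V))
     - \tr (Jmx s *m (cartan_fmx F q V *m cartan_fmx F q W))).
  have c12 := ccurv_skew HF ix1 ix2 aq tV tW.
  have -> : s * ccurv F q V W ix2 ix1 = 2^-1 * \tr (Jmx s *m ccurv F q V W).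
    by rewrite tr_Jmx c12; move: (ccurv _ _ _ _ _ _) => t; field.
  rewrite (ccurvE HF aq tV tW); move: (curv_frame F q V W) => K.
  move: (cartan_fmx F q W *m _) (_ *m cartan_fmx F q W) => X Y.
  by rewrite !tr_Jmx !mxE; field.
rewrite /sigma_coord t2 mulmxBr linearB /= !t3 t4 t5 !t1 !sum3 cV3 cW3.
move: (\tr _) (\tr _) (\tr _) (covf F q V) (covf F q W) (cof q V) (cof q W).
by move=> x y z a b c e; ring.
Qed.

(** On SM, [ω_3^a] is the vertical coframe. Hence [dω^3] is the first term of sigma. In
    [ω_1^c ∧ ω_c^2] skewness leaves [c = 3] only, which is the last term. *)
Lemma sigma_potential q V W : adapted O F q -> F q.1 = 1 ->
  T_SO2_TM F q V -> T_SO2_TM F q W -> T_SM F q.1 V.1 -> T_SM F q.1 W.1 ->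
  sigma_frame F p s q V W = d1 (potential F p s) q V W.
Proof.
move=> aq F1 tV tW sV sW; have fq := adapted_frames aq; have [Dq uq] := fq.
have sc X a := msmooth_cof HF X a 0; have sk X a b := msmooth_kh HF X a b.
have dp X Y : 'D_X (fun r : FB => potential F p s r Y) q =
    p * Dm X (fun r => cof r Y) q ix3 0 + s * Dm X (fun r => kh F r Y) q ix2 ix1.
  transitivity ('D_X (fun r : FB => p * cof r Y ix3 0 + s * kh F r Y ix2 ix1) q).
    apply: (derive_congr X oU fq) => r fr.
    by rewrite /potential coframeE (cartan_formE HF _ _ _ fr).
  have s1 := smoothM oU (smooth_cst p oU) (sc Y ix3).
  have s2 := smoothM oU (smooth_cst s oU) (sk Y ix2 ix1).
  rewrite (sderiveD X s1 s2 fq) (sderiveZ p X (sc Y ix3) fq) (sderiveZ s X (sk Y ix2 ix1) fq).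
  by rewrite [in RHS]mxE [X in _ = _ + s * X]mxE.
have e1 := congr1 (fun M : 'cV[R]_3 => M ix3 0) (d_cof HF V W fq).
have e2 : ccurv F q V W ix2 ix1 = dkh F q V W ix2 ix1
   - (kh F q W *m kh F q V) ix2 ix1 + (kh F q V *m kh F q W) ix2 ix1.
  by rewrite /ccurv [LHS]mxE [X in X + _]mxE [X in _ + X + _]mxE.
(* [om] alone is not skew, but its third row coincides with that of the skew [kh], since the Cartan
   tensor vanishes on [u]. *)
have om3 X b : T_SO2_TM F q X -> T_SM F q.1 X.1 -> om F q X ix3 b = - covf F q X b 0.
  move=> tX sX; have -> : om F q X ix3 b = kh F q X ix3 b - cartan_fmx F q X ix3 b.
    by rewrite [kh _ _ _ _ _]mxE addrK.
  rewrite (kh_skew_entry HF ix3 b aq tX) (kh_col3 HF b aq F1 tX).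
  have -> : cartan_fmx F q X ix3 b = cartan_fmx F q X b ix3.
    by rewrite -{1}(cartan_fmxT HF X Dq) mxE.
  by rewrite (cartan_fmx_col3 HF X b aq F1) (sX : 'D_X.1 F q.1 = 0) mulr0 !subr0.
have k3 X b : T_SO2_TM F q X -> T_SM F q.1 X.1 -> kh F q X b ix3 = covf F q X b 0.
  by move=> tX sX; rewrite (kh_col3 HF b aq F1 tX) (sX : 'D_X.1 F q.1 = 0) mulr0 subr0.
have cV3 : covf F q V ix3 0 = 0 by rewrite (covf3 HF aq F1 tV); exact: sV.
have cW3 : covf F q W ix3 0 = 0 by rewrite (covf3 HF aq F1 tW); exact: sW.
have subE m n (A B : 'M[R]_(m, n)) i j : (A - B) i j = A i j - B i j by rewrite !mxE.
have mul3 m n (A : 'M[R]_(m, 3)) (B : 'M[R]_(3, n)) i j :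
    (A *m B) i j = A i ix1 * B ix1 j + A i ix2 * B ix2 j + A i ix3 * B ix3 j.
  by rewrite mxE sum3.
rewrite (sigma_frame_explicit aq F1 tV tW) /d1 (dp V W) (dp W V) e2.
transitivity (p * (Dm V (fun r => cof r W) q - Dm W (fun r => cof r V) q) ix3 0
   + s * dkh F q V W ix2 ix1); last first.
  by rewrite /dkh !subE !mulrBr opprD addrACA.
rewrite e1; move: (dkh F q V W ix2 ix1) => d.
rewrite subE (mul3 _ _ (om F q W) (cof q V)) (mul3 _ _ (om F q V) (cof q W)).
rewrite (mul3 _ _ (kh F q W) (kh F q V)) (mul3 _ _ (kh F q V) (kh F q W)).
rewrite !(om3 V) // !(om3 W) // !(k3 V) // !(k3 W) //.
rewrite (kh_skew_entry HF ix3 ix1 aq tV) (kh_skew_entry HF ix3 ix1 aq tW) !(k3 V) // !(k3 W) //.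
rewrite cV3 cW3.
have z0 X i : T_SO2_TM F q X -> kh F q X i i = 0.
  by move=> tX; have := kh_skew_entry HF i i aq tX; move: (kh _ _ _ _ _) => t ?; lra.
rewrite !(z0 V) // !(z0 W) //.
move: (covf F q V) (covf F q W) (cof q V) (cof q W) (kh F q V) (kh F q W) => a b c e f h.
by ring.
Qed.

End SigmaForm.

(** * Local adapted frames *)

Section GramSchmidt.
Context {R : realType}.
Implicit Types (G : 'I_3 -> 'I_3 -> R) (a b c u : 'I_3 -> R).

Definition ip G a b := \sum_i \sum_j G i j * a i * b j.
Definition normalized G a i := (Num.sqrt (ip G a a))^-1 * a i.
Definition reject1 G c u i := c i - ip G c u * u i.
Definition reject2 G c u b i := c i - ip G c u * u i - ip G c b * b i.

Lemma ip_sym G a b : (forall i j, G i j = G j i) -> ip G a b = ip G b a.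
Proof.
move=> sG; rewrite /ip exchange_big; apply: eq_bigr => i _; apply: eq_bigr => j _ /=.
by rewrite sG mulrAC.
Qed.

Lemma ip_scale G k a b : ip G (fun i => k * a i) b = k * ip G a b.
Proof. by rewrite /ip !sum3; ring. Qed.

Lemma ip_comb G c u b d k l :
  ip G (fun i => c i - k * u i - l * b i) d = ip G c d - k * ip G u d - l * ip G b d.
Proof. by rewrite /ip !sum3; ring. Qed.

Lemma ip_comb1 G c u d k : ip G (fun i => c i - k * u i) d = ip G c d - k * ip G u d.
Proof. by rewrite /ip !sum3; ring. Qed.

Lemma ip_normalized G a b : ip G (normalized G a) b = (Num.sqrt (ip G a a))^-1 * ip G a b.
Proof. exact: ip_scale. Qed.

Lemma ip_normalized2 G a : (forall i j, G i j = G j i) -> 0 < ip G a a ->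
  ip G (normalized G a) (normalized G a) = 1.
Proof.
move=> sG a0; rewrite ip_normalized ip_sym // ip_normalized mulrA -invfM -expr2.
by rewrite sqr_sqrtr ?ltW // mulVf // gt_eqF.
Qed.

Lemma ip_reject1 G c u : ip G u u = 1 -> ip G (reject1 G c u) u = 0.
Proof. by move=> u1; rewrite /reject1 ip_comb1 u1 mulr1 subrr. Qed.

Lemma ip_reject2 G c u b : (forall i j, G i j = G j i) ->
  ip G u u = 1 -> ip G b b = 1 -> ip G b u = 0 ->
  ip G (reject2 G c u b) u = 0 /\ ip G (reject2 G c u b) b = 0.
Proof.
move=> sG u1 b1 bu; rewrite /reject2 !ip_comb u1 b1 bu (ip_sym u b sG) bu.
by split; ring.
Qed.

Lemma det3 (A : 'M[R]_3) : \det A =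
  A ix1 ix1 * (A ix2 ix2 * A ix3 ix3 - A ix2 ix3 * A ix3 ix2)
  - A ix1 ix2 * (A ix2 ix1 * A ix3 ix3 - A ix2 ix3 * A ix3 ix1)
  + A ix1 ix3 * (A ix2 ix1 * A ix3 ix2 - A ix2 ix2 * A ix3 ix1).
Proof.
rewrite (expand_det_row _ ix1) sum3 /cofactor !det2 !mxE.
have m0 : lift ix1 0 = ix2 by apply: val_inj.
have m1 : lift ix1 1 = ix3 by apply: val_inj.
have n0 : lift ix2 0 = ix1 by apply: val_inj.
have n1 : lift ix2 1 = ix3 by apply: val_inj.
have l0 : lift ix3 0 = ix1 by apply: val_inj.
have l1 : lift ix3 1 = ix2 by apply: val_inj.
by rewrite l0 l1 m0 m1 n0 n1 /= !exprS !expr0; ring.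
Qed.

Definition columns a b c : 'M[R]_3 := \matrix_(i, j)
  if j == ix1 then a i else if j == ix2 then b i else c i.

Lemma det_columns a b c : \det (columns a b c) =
  a ix1 * (b ix2 * c ix3 - c ix2 * b ix3) - b ix1 * (a ix2 * c ix3 - c ix2 * a ix3)
  + c ix1 * (a ix2 * b ix3 - b ix2 * a ix3).
Proof. by rewrite det3 !mxE. Qed.

(** If [y i] is nonzero, the two basis vectors following the i-th in cyclic order complete [y] to a
    basis; the sign of [y i] corrects the orientation. *)
Lemma exists_positive_columns (y : 'I_3 -> R) : (exists i, y i != 0) ->
  exists a b, 0 < \det (columns a b y).
Proof.
case=> i yi; pose t := Num.sg (y i).
have ty : 0 < t * y i by rewrite -normrEsg normr_gt0.
have [ei|ei|ei] : [\/ i = ix1, i = ix2 | i = ix3].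
- by case: (i) => -[|[|[|//]]] ?; [constructor 1|constructor 2|constructor 3]; apply: val_inj.
- exists (fun j => t * kron R j ix2), (fun j => kron R j ix3).
  by rewrite det_columns !kron_values; move: ty; rewrite ei => ty; lra.
- exists (fun j => t * kron R j ix3), (fun j => kron R j ix1).
  by rewrite det_columns !kron_values; move: ty; rewrite ei => ty; lra.
- exists (fun j => t * kron R j ix1), (fun j => kron R j ix2).
  by rewrite det_columns !kron_values; move: ty; rewrite ei => ty; lra.
Qed.

Lemma exists_nonzero (a : 'I_3 -> R) : (forall i, a i = 0) \/ exists i, a i != 0.
Proof.
have [/forallP H|] := boolP [forall i, a i == 0]; first by left=> i; apply/eqP.
by rewrite negb_forall => /existsP; right.
Qed.

End GramSchmidt.

Section LocalFrame.
Context {R : realType}.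
Local Notation TV := (TV R).
Local Notation FB := (FB R).
Variables (O : set 'rV[R]_3) (F : TV -> R).
Hypothesis HF : local_finsler O F.
Local Notation D := (slit O).
Implicit Types (z v w : TV) (q V W : FB).

Let oD : open D. Proof. exact/open_slit/lf_open/HF. Qed.

Definition gz z i j := g F i j z.

Lemma gz_sym z i j : D z -> gz z i j = gz z j i.
Proof. by move=> Dz; exact: (g_sym HF). Qed.

Lemma ip_gt0 z (a : 'I_3 -> R) : D z -> (exists i, a i != 0) -> 0 < ip (gz z) a a.
Proof.
move=> Dz [i ai]; have [Oz z0] := Dz.
pose v : 'rV[R]_3 := \row_i a i.
have v0 : v != 0.
  by apply/negP => /eqP/rowP/(_ i); rewrite !mxE => /eqP; rewrite (negPf ai).
have := lf_convex HF Oz z0 v0; have -> : (z.1, z.2) = z by case: (z).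
have -> // : \sum_j \sum_k gmx F z j k * v 0 j * v 0 k = ip (gz z) a a.
by apply: eq_bigr => j _; apply: eq_bigr => k _; rewrite [v 0 j]mxE [v 0 k]mxE.
Qed.

Lemma ip_u z : D z -> ip (gz z) (u F ^~ z) (u F ^~ z) = 1.
Proof.
move=> Dz; have F0 : F z != 0 by rewrite gt_eqF // (F_gt0 HF).
have ui i : u F i z = (F z)^-1 * z.2 0 i by rewrite /u /uvec mxE.
transitivity ((F z)^-1 ^+ 2 * \sum_i \sum_j g F i j z * z.2 0 i * z.2 0 j).
  rewrite mulr_sumr; apply: eq_bigr => i _; rewrite mulr_sumr; apply: eq_bigr => j _.
  by rewrite !ui /gz; move: (g F i j z) => t; ring.
by rewrite (sum_g_yy HF Dz) -exprMn mulVf // expr1n.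
Qed.

Section Smooth.
Variables (U : set TV) (oU' : open U) (sU : U `<=` D).
Implicit Types a b c : TV -> 'I_3 -> R.
Local Notation vsmooth a := (forall i, smooth_on U (fun z => a z i)).

Lemma smooth_ip a b : vsmooth a -> vsmooth b ->
  smooth_on U (fun z => ip (gz z) (a z) (b z)).
Proof.
move=> sa sb; apply: smooth_sum => // i; apply: smooth_sum => // j.
apply: smoothM => //; apply: smoothM => //.
by apply: (smooth_sub sU); exact: (smooth_g HF).
Qed.

Lemma smooth_normalized a : vsmooth a -> (forall z, U z -> 0 < ip (gz z) (a z) (a z)) ->
  vsmooth (fun z => normalized (gz z) (a z)).
Proof.
move=> sa a0 i; apply: smoothM => //; apply: smoothV => //.
  by move=> z Uz; rewrite gt_eqF // sqrtr_gt0 a0.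
by apply: smooth_sqrt => //; exact: smooth_ip.
Qed.

Lemma smooth_reject1 c b : vsmooth c -> vsmooth b ->
  vsmooth (fun z => reject1 (gz z) (c z) (b z)).
Proof.
move=> sc sb i; apply: smoothB => //; apply: smoothM => //; exact: smooth_ip.
Qed.

Lemma smooth_reject2 c b a : vsmooth c -> vsmooth b -> vsmooth a ->
  vsmooth (fun z => reject2 (gz z) (c z) (b z) (a z)).
Proof.
move=> sc sb sa i; apply: smoothB => //; last by apply: smoothM => //; exact: smooth_ip.
by apply: smoothB => //; apply: smoothM => //; exact: smooth_ip.
Qed.

Lemma smooth_u : vsmooth (fun z i => u F i z).
Proof.
move=> i; apply: (smooth_ext oU' (f := fun z => (F z)^-1 * z.2 0 i)).
  by move=> z _; rewrite /u /uvec mxE.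
apply: smoothM => //; last exact: smooth_ycoord.
apply: smoothV => //; last by apply: (smooth_sub sU); exact: lf_smooth HF.
by move=> z /sU Dz; rewrite gt_eqF // (F_gt0 HF).
Qed.
End Smooth.

(* Gram-Schmidt applied to constant vector fields, starting from u. *)
Lemma exists_local_frame z0 : D z0 -> exists (U : set TV) (e : TV -> 'M[R]_3),
  [/\ open U, U z0, U `<=` D, msmooth U e & forall z, U z -> adapted O F (z, e z)].
Proof.
move=> Dz0.
have [c1 [c2 c0]] : exists a b, 0 < \det (columns a b (fun i => z0.2 0 i)).
  apply: exists_positive_columns; have [_ y0] := Dz0.
  have [H|//] := exists_nonzero (fun i => z0.2 0 i).
  by case/eqP: y0; apply/rowP => i; rewrite H mxE.
pose dt z := \det (columns c1 c2 (fun i => z.2 0 i)).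
(* On this set [c1], [c2], [y] form a positive basis, which keeps the norms in Gram-Schmidt nonzero
   and also yields the orientation of the frame. *)
pose U := D `&` dt @^-1` [set x | 0 < x].
have sUD : U `<=` D by move=> z [].
have oU1 : open U.
  apply: openI => //; apply: open_comp; last exact: open_gt.
  move=> z _; have : smooth_on [set: TV] dt.
    apply: (smooth_det openT (A := fun z : TV => columns c1 c2 (fun i => z.2 0 i))) => i j.
    apply: (smooth_ext openT (f := fun z : TV => if j == ix1 then c1 i else if j == ix2 then c2 i else z.2 0 i)).
      by move=> y _; rewrite mxE.
    case: (j == ix1); first exact: (smooth_cst _ openT).
    case: (j == ix2); first exact: (smooth_cst _ openT).
    exact: (smooth_ycoord _ openT).
  by move=> /(_ 0%N); exact.
pose f1 z := reject1 (gz z) c1 (u F ^~ z).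
pose e1 z := normalized (gz z) (f1 z).
pose f2 z := reject2 (gz z) c2 (u F ^~ z) (e1 z).
pose e2 z := normalized (gz z) (f2 z).
pose e z := columns (e1 z) (e2 z) (u F ^~ z).
have F0 z : U z -> 0 < F z by move=> /sUD; exact: (F_gt0 HF).
have uE z i : u F i z = (F z)^-1 * z.2 0 i by rewrite /u /uvec mxE.
have yE z i : U z -> z.2 0 i = F z * u F i z.
  by move=> /F0 Fz; rewrite uE mulrA mulfV ?gt_eqF // mul1r.
have dtE z : U z -> dt z = F z * \det (columns c1 c2 (u F ^~ z)).
  move=> Uz; rewrite /dt !det_columns !(yE z _ Uz); move: (u F ix1 z) (u F ix2 z) (u F ix3 z) => a b c.
  by ring.
have du z : U z -> 0 < \det (columns c1 c2 (u F ^~ z)).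
  by move=> Uz; have [_ /=] := Uz; rewrite dtE // pmulr_rgt0 // F0.
have f10 z : U z -> 0 < ip (gz z) (f1 z) (f1 z).
  (* If [f1] vanished, [c1] would be a multiple of [u] and the positive determinant would be zero;
     the same argument serves for [f2] below. *)
  move=> Uz; apply: ip_gt0; first exact: sUD.
  have [H|//] := exists_nonzero (f1 z); exfalso.
  have cE i : c1 i = ip (gz z) c1 (u F ^~ z) * u F i z.
    by have /eqP := H i; rewrite /f1 /reject1 subr_eq0 => /eqP.
  have := du z Uz; rewrite det_columns !cE; move: (ip _ _ _) (u F ix1 z) (u F ix2 z) (u F ix3 z) => k a b c.
  by rewrite lt_neqAle => /andP[/negP + _]; apply; apply/eqP; ring.
have f20 z : U z -> 0 < ip (gz z) (f2 z) (f2 z).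
  move=> Uz; apply: ip_gt0; first exact: sUD.
  have [H|//] := exists_nonzero (f2 z); exfalso.
  have cE i : c2 i = ip (gz z) c2 (u F ^~ z) * u F i z + ip (gz z) c2 (e1 z) * ((Num.sqrt (ip (gz z) (f1 z) (f1 z)))^-1
      * (c1 i - ip (gz z) c1 (u F ^~ z) * u F i z)).
    have /eqP := H i; rewrite /f2 /reject2 -addrA -opprD subr_eq0 => /eqP ->.
    by [].
  have := du z Uz; rewrite det_columns !cE.
  move: (ip _ c2 _) (ip _ c2 _) (ip _ c1 _) (Num.sqrt _)^-1 (u F ix1 z) (u F ix2 z) (u F ix3 z) => k l m n a b c.
  by rewrite lt_neqAle => /andP[/negP + _]; apply; apply/eqP; ring.
have su := smooth_u oU1 sUD.
have sc (c : 'I_3 -> R) i : smooth_on U (fun=> c i) by exact: smooth_cst.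
have sf1 := smooth_reject1 oU1 sUD (sc c1) su.
have se1 := smooth_normalized oU1 sUD sf1 f10.
have sf2 := smooth_reject2 oU1 sUD (sc c2) su se1.
have se2 := smooth_normalized oU1 sUD sf2 f20.
exists U, e; split=> //.
  move=> i j; apply: (smooth_ext oU1 (f := fun z : TV => if j == ix1 then e1 z i else if j == ix2 then e2 z i else u F i z)).
    by move=> y _; rewrite mxE.
  by case: (j == ix1); [exact: se1|case: (j == ix2); [exact: se2|exact: su]].
move=> z Uz; have Dz := sUD z Uz; split=> //.
have sG i j : gz z i j = gz z j i by exact: gz_sym.
have u1 := ip_u Dz.
have e11 : ip (gz z) (e1 z) (e1 z) = 1 by apply: ip_normalized2 => //; exact: f10.
have e1u : ip (gz z) (e1 z) (u F ^~ z) = 0 by rewrite ip_normalized ip_reject1 ?mulr0.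
have [f2u f2e] := ip_reject2 c2 sG u1 e11 e1u.
have e22 : ip (gz z) (e2 z) (e2 z) = 1 by apply: ip_normalized2 => //; exact: f20.
have e2u : ip (gz z) (e2 z) (u F ^~ z) = 0 by rewrite ip_normalized f2u mulr0.
have e2e1 : ip (gz z) (e2 z) (e1 z) = 0 by rewrite ip_normalized f2e mulr0.
have cases (i : 'I_3) : [\/ i = ix1, i = ix2 | i = ix3].
  by case: i => -[|[|[|//]]] ?; [constructor 1|constructor 2|constructor 3]; apply: val_inj.
split=> /=.
- by have [_ ->] := Dz.
- move=> a b; have -> : gram F a b (z, e z) = ip (gz z) (fun i => e z i a) (fun i => e z i b) by [].
  have c1E : (fun i => e z i ix1) = e1 z by apply/funext => i; rewrite mxE.
  have c2E : (fun i => e z i ix2) = e2 z by apply/funext => i; rewrite mxE.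
  have c3E : (fun i => e z i ix3) = u F ^~ z by apply/funext => i; rewrite mxE.
  have [->|->|->] := cases a; have [->|->|->] := cases b;
    rewrite ?c1E ?c2E ?c3E ?kron_values // ip_sym //.
- by move=> i; rewrite /last_minus_u /= mxE subrr.
(* Subtracting projections is a column operation, so only the two normalizing factors change the
   determinant. *)
- have -> : \det (e z) = (Num.sqrt (ip (gz z) (f1 z) (f1 z)))^-1 *
    (Num.sqrt (ip (gz z) (f2 z) (f2 z)))^-1 * \det (columns c1 c2 (u F ^~ z)).
    rewrite !det_columns /e2 /e1 /normalized -/(e1 z).
    have f2E i : f2 z i = c2 i - ip (gz z) c2 (u F ^~ z) * u F i z - ip (gz z) c2 (e1 z) *
      ((Num.sqrt (ip (gz z) (f1 z) (f1 z)))^-1 * (c1 i - ip (gz z) c1 (u F ^~ z) * u F i z)) by [].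
    have f1E i : f1 z i = c1 i - ip (gz z) c1 (u F ^~ z) * u F i z by [].
    move: (Num.sqrt (ip (gz z) (f2 z) (f2 z)))^-1 => r2; rewrite !f2E.
    move: (ip (gz z) c2 (e1 z)) => l.
    move: (Num.sqrt (ip (gz z) (f1 z) (f1 z)))^-1 => r1; rewrite !f1E.
    move: (ip _ c2 _) (ip _ c1 _) (u F ix1 z) (u F ix2 z) (u F ix3 z) => k m a b c.
    by ring.
  by rewrite !mulr_gt0 ?invr_gt0 ?sqrtr_gt0 ?f10 ?f20 ?du.
Qed.

End LocalFrame.

(** * Smooth sections and lifts of tangent vectors to adapted frames *)

Section Sections.
Context {R : realType}.
Local Notation TV := (TV R).
Local Notation FB := (FB R).
Implicit Types (z v w : TV) (q V W : FB).

Lemma msmooth_differentiable (V : normedModType R) (U : set V) (e : V -> 'M[R]_3) (x : V) :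
  msmooth U e -> U x -> differentiable e x.
Proof.
move=> se Ux.
have -> : e = \sum_(i < 3) \sum_(j < 3) (fun y => e y i j *: (delta_mx i j : 'M[R]_3)).
  apply/funext => y; rewrite fct_sumE {1}[e y]matrix_sum_delta.
  by apply: eq_bigr => i _; rewrite fct_sumE.
apply: differentiable_sum => i; apply: differentiable_sum => j.
by apply: differentiableZl; exact: smooth_differentiable (se i j) Ux.
Qed.

Lemma Dm_diff (V : normedModType R) (U : set V) (e : V -> 'M[R]_3) (x v : V) :
  msmooth U e -> U x -> 'd e x v = Dm v e x.
Proof.
move=> se Ux; have de := msmooth_differentiable se Ux.
by rewrite -deriveE // derive_mx //; exact: diff_derivable.
Qed.

Lemma derive_section (U : set TV) (e : TV -> 'M[R]_3) (f : FB -> R) z v :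
  msmooth U e -> U z -> differentiable f (z, e z) ->
  'D_v (fun y => f (y, e y)) z = 'D_((v, Dm v e z) : FB) f (z, e z).
Proof.
move=> se Uz df; have de := msmooth_differentiable se Uz.
pose s (y : TV) : FB := (y, e y).
have di : differentiable (@idfun TV) z by exact: ex_diff.
have ds : differentiable s z by apply: differentiable_pair.
have dsE : 'd s z v = (v, Dm v e z).
  have -> : 'd s z = (fun y => ('d (@idfun TV) z y, 'd e z y)) :> (TV -> FB).
    by apply: diff_pair.
  rewrite (Dm_diff v se Uz); congr (_, _).
  by have -> : 'd (@idfun TV) z = idfun :> (TV -> TV) by exact: diff_val.
have dfs : differentiable (f \o s) z by exact: differentiable_comp.
by rewrite -[LHS]/('D_v (f \o s) z) deriveE // diff_comp //= dsE deriveE.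
Qed.

Variables (O : set 'rV[R]_3) (F : TV -> R).
Hypothesis HF : local_finsler O F.
Local Notation D := (slit O).
Let oD : open D. Proof. exact/open_slit/lf_open/HF. Qed.
Let oU := open_frames HF.

Lemma smooth_u_slit i : smooth_on D (u F i).
Proof. exact: (smooth_u HF oD (fun z Dz => Dz) i). Qed.

(** The functions defining the bundle are constant along an adapted section, so their derivatives
    along it vanish. *)
Lemma section_tangent (U : set TV) (e : TV -> 'M[R]_3) z v :
  open U -> msmooth U e -> U z -> (forall y, U y -> adapted O F (y, e y)) ->
  T_SO2_TM F (z, e z) (v, Dm v e z).
Proof.
move=> oU1 se Uz ae; have fz := adapted_frames (ae z Uz).
split=> [a b|i].
  have df : differentiable (gram F a b) (z, e z).
    have -> : gram F a b = (fun q => grm F q a b) by apply/funext => q; rewrite gramE.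
    exact: (smooth_differentiable (msmooth_grm HF a b) fz).
  rewrite -(derive_section v se Uz df) -(derive_cst (kron R a b) z v).
  apply: (derive_congr _ oU1 Uz) => y /ae [_ [_ + _ _]]; exact.
have sl : smooth_on (frames O) (last_minus_u F i).
  exact: (smoothB oU (msmooth_frame oU i ix3) (smooth_base (smooth_u_slit i))).
have df := smooth_differentiable sl fz.
rewrite -(derive_section v se Uz df) -[RHS](derive_cst (0 : R) z v).
by apply: (derive_congr _ oU1 Uz) => y /ae [_ [_ _ + _]]; exact.
Qed.

(** One frame over [z] serves for all tangent vectors; thus identities on the bundle determine forms
    on the base at [z]. *)
Lemma exists_adapted_lift z : D z -> exists E : 'M[R]_3, adapted O F (z, E) /\
  forall v, exists B : 'M[R]_3, T_SO2_TM F (z, E) (v, B).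
Proof.
move=> Dz; have [U [e [oU1 Uz sUD se ae]]] := exists_local_frame HF Dz.
exists (e z); split=> [|v]; first exact: ae.
by exists (Dm v e z); exact: section_tangent oU1 se Uz ae.
Qed.

End Sections.

Lemma chain_rule_sum (R : comRingType) (x y a d : 'I_3 -> R) (N : 'I_3 -> 'I_3 -> R) :
  \sum_l x l * (a l + \sum_m N m l * d m) + \sum_l y l * d l =
  \sum_l (x l * a l + (y l + \sum_j N l j * x j) * d l).
Proof. by rewrite !sum3; ring. Qed.

(** The index algebra of [curv_mxE]: [a] and [d] are the horizontal and vertical derivatives of
    [Γ^i_jk], [x] and [y] are the values of [δy / F], and [f] is [F]. *)
Lemma curvature_sum (R : comRingType) (f : R) (v w x y : 'I_3 -> R)
  (a d G H : 'I_3 -> 'I_3 -> R) :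
  \sum_k (\sum_l (v l * a l k + f * x l * d l k)) * w k
  - \sum_k (\sum_l (w l * a l k + f * y l * d l k)) * v k
  + \sum_m (\sum_k G m k * v k) * (\sum_l H m l * w l)
  - \sum_m (\sum_k G m k * w k) * (\sum_l H m l * v l) =
  \sum_k \sum_l (a k l - a l k + \sum_m (G m k * H m l - G m l * H m k)) * v k * w l
  + \sum_k \sum_l (- f * d l k) * v k * y l
  - \sum_k \sum_l (- f * d l k) * w k * x l.
Proof. by rewrite !sum3; ring. Qed.

(** * The vertical curvature of the Cartan connection *)

Section CartanQ.
Context {R : realType}.
Local Notation TV := (TV R).
Local Notation FB := (FB R).
Variables (O : set 'rV[R]_3) (F : TV -> R).
Hypothesis HF : local_finsler O F.
Local Notation D := (slit O).
Implicit Types (z v w : TV) (q V W : FB) (T : tensor4 R).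
Let oD : open D. Proof. exact/open_slit/lf_open/HF. Qed.

(** [T_j^i] is read as an endomorphism with the upper index as the row, hence the exchange of [i]
    and [j]. *)
Definition tensor_mx T (x y : 'cV[R]_3) : 'M[R]_3 :=
  \matrix_(i, j) \sum_k \sum_l T j i k l * x k 0 * y l 0.

Lemma exchange_big4 (f : 'I_3 -> 'I_3 -> 'I_3 -> 'I_3 -> R) :
  \sum_c \sum_d \sum_j \sum_i f c d j i = \sum_j \sum_i \sum_c \sum_d f c d j i.
Proof.
transitivity (\sum_c \sum_j \sum_d \sum_i f c d j i).
  by apply: eq_bigr => c _; rewrite exchange_big.
rewrite exchange_big; apply: eq_bigr => j _ /=.
transitivity (\sum_c \sum_i \sum_d f c d j i).
  by apply: eq_bigr => c _; rewrite exchange_big.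
by rewrite exchange_big.
Qed.

(** Passing to frame components conjugates the endomorphism by the frame. *)
Lemma frame_compE T q (x y : 'cV[R]_3) b a :
  \sum_c \sum_d frame_comp T q b a c d * (x c 0 * y d 0) =
  (invmx q.2 *m tensor_mx T (q.2 *m x) (q.2 *m y) *m q.2) a b.
Proof.
pose t j i c d := \sum_k \sum_l T j i k l * q.2 k c * q.2 l d.
transitivity (\sum_j \sum_i \sum_c \sum_d
    invmx q.2 a i * (t j i c d * (x c 0 * y d 0)) * q.2 j b).
  rewrite -exchange_big4; apply: eq_bigr => c _; apply: eq_bigr => d _.
  rewrite mulr_suml; apply: eq_bigr => j _; rewrite mulr_suml; apply: eq_bigr => i _.
  have -> : \sum_k \sum_l T j i k l * q.2 j b * invmx q.2 a i * q.2 k c * q.2 l d =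
      invmx q.2 a i * q.2 j b * t j i c d.
    rewrite /t mulr_sumr; apply: eq_bigr => k _; rewrite mulr_sumr; apply: eq_bigr => l _.
    by move: (T j i k l) (invmx q.2 a i) => r m; ring.
  by move: (t j i c d) (invmx q.2 a i) => r m; ring.
rewrite [RHS]mxE; apply: eq_bigr => j _; rewrite [(_ *m _) a j]mxE mulr_suml.
apply: eq_bigr => i _; rewrite [tensor_mx _ _ _ i j]mxE.
have -> : \sum_k \sum_l T j i k l * (q.2 *m x) k 0 * (q.2 *m y) l 0 =
    \sum_c \sum_d t j i c d * (x c 0 * y d 0).
  have -> : \sum_c \sum_d t j i c d * (x c 0 * y d 0) =
      \sum_c \sum_d \sum_k \sum_l T j i k l * (q.2 k c * x c 0) * (q.2 l d * y d 0).
    apply: eq_bigr => c _; apply: eq_bigr => d _; rewrite mulr_suml; apply: eq_bigr => k _.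
    by rewrite mulr_suml; apply: eq_bigr => l _; move: (T j i k l) => r; ring.
  rewrite exchange_big4; apply: eq_bigr => k _; apply: eq_bigr => l _.
  rewrite [(q.2 *m x) k 0]mxE [(q.2 *m y) l 0]mxE [LHS]mulr_sumr [RHS]exchange_big.
  by apply: eq_bigr => d _ /=; rewrite mulr_sumr mulr_suml.
rewrite mulr_sumr mulr_suml; apply: eq_bigr => c _.
by rewrite mulr_sumr mulr_suml.
Qed.

Lemma tensor_mx_skew T x y : skew_last T -> tensor_mx T y x = - tensor_mx T x y.
Proof.
move=> sT; apply/matrixP => i j; rewrite !mxE exchange_big -sumrN; apply: eq_bigr => k _.
rewrite -sumrN; apply: eq_bigr => l _.
by rewrite (sT j i l k); ring.
Qed.

(** Splitting the derivatives of [Γ] into horizontal and vertical ones gives [R] and [P]. There is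
    no purely vertical part because [Γ] involves [dx] only. *)
Lemma curv_mxE z v w : D z -> curv_mx F z v w =
  tensor_mx (chernR F z) v.1^T w.1^T + tensor_mx (chernP F z) v.1^T (vform F z w)
  - tensor_mx (chernP F z) w.1^T (vform F z v).
Proof.
move=> Dz; have F0 : F z != 0 by rewrite gt_eqF // (F_gt0 HF).
have DgamE v' w' i j : Dgam F z v' w' i j = \sum_k (\sum_l (v'.1 0 l * delta_dx F l (chern F i j k) z
     + F z * vform F z v' l 0 * dy l (chern F i j k) z)) * w'.1 0 k.
  rewrite mxE; apply: eq_bigr => k _; congr (_ * _).
  rewrite (derive_coord v' (smooth_differentiable (smooth_chern HF i j k) Dz)).
  have vE l : F z * vform F z v' l 0 = v'.2 0 l + \sum_j nconn F l j z * v'.1 0 j.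
    by rewrite mxE mulrCA mulfV // mulr1.
  have dE l : dx l (chern F i j k) z = delta_dx F l (chern F i j k) z
     + \sum_m nconn F m l z * dy m (chern F i j k) z by rewrite /delta_dx subrK.
  transitivity (\sum_l v'.1 0 l * (delta_dx F l (chern F i j k) z
     + \sum_m nconn F m l z * dy m (chern F i j k) z) + \sum_l v'.2 0 l * dy l (chern F i j k) z).
    by apply: (f_equal2 +%R) => //; apply: eq_bigr => l _; apply: (f_equal2 *%R).
  transitivity (\sum_l (v'.1 0 l * delta_dx F l (chern F i j k) z
     + (v'.2 0 l + \sum_j nconn F l j z * v'.1 0 j) * dy l (chern F i j k) z)); last first.
    by apply: eq_bigr => l _; apply: (f_equal2 +%R) => //; apply: (f_equal2 *%R) => //; rewrite vE.
  exact: (chain_rule_sum (fun l => v'.1 0 l) (fun l => v'.2 0 l)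
    (fun l => delta_dx F l (chern F i j k) z) (fun l => dy l (chern F i j k) z)
    (fun m l => nconn F m l z)).
apply/matrixP => i j.
transitivity (Dgam F z v w i j - Dgam F z w v i j
  + (gam F z v *m gam F z w) i j - (gam F z w *m gam F z v) i j).
  by rewrite /curv_mx [LHS]mxE [X in X + _]mxE [X in X + _ + _]mxE
    [X in _ + X + _ + _]mxE [X in _ + X = _]mxE.
rewrite !DgamE [RHS]mxE [X in _ = X + _]mxE [X in _ = _ + X]mxE.
rewrite [tensor_mx (chernR F z) _ _ i j]mxE ![tensor_mx (chernP F z) _ _ i j]mxE.
rewrite ![(_ *m _) i j]mxE.
under [X in _ + X - _ = _]eq_bigr do rewrite [gam _ _ _ i _]mxE [gam _ _ _ _ j]mxE.
under [X in _ - X = _]eq_bigr do rewrite [gam _ _ _ i _]mxE [gam _ _ _ _ j]mxE.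
under [X in _ = X + _ - _]eq_bigr do under eq_bigr do rewrite ![_^T _ 0]mxE.
under [X in _ = _ + X - _]eq_bigr do under eq_bigr do rewrite [_^T _ 0]mxE.
under [X in _ = _ - X]eq_bigr do under eq_bigr do rewrite [_^T _ 0]mxE.
exact: (curvature_sum (F z) (fun l => v.1 0 l) (fun l => w.1 0 l)
  (fun l => vform F z v l 0) (fun l => vform F z w l 0)
  (fun l k => delta_dx F l (chern F i j k) z) (fun l k => dy l (chern F i j k) z)
  (fun m k => chern F i m k z) (fun m k => chern F m j k z)).
Qed.

End CartanQ.

Section CartanDecomposition.
Context {R : realType}.
Local Notation TV := (TV R).
Local Notation FB := (FB R).
Variables (O : set 'rV[R]_3) (F : TV -> R).
Hypothesis HF : local_finsler O F.
Local Notation D := (slit O).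
Implicit Types (z v w : TV) (q V W : FB) (T : tensor4 R).

Definition slice T k l : 'M[R]_3 := \matrix_(i, j) T j i k l.

Lemma tensor_mx_slice T (x y : 'cV[R]_3) :
  tensor_mx T x y = \sum_k \sum_l (x k 0 * y l 0) *: slice T k l.
Proof.
apply/matrixP => i j; rewrite mxE summxE; apply: eq_bigr => k _.
rewrite summxE; apply: eq_bigr => l _; rewrite !mxE -mulrA mulrC.
by [].
Qed.

(* [invmx g *m M^T *m g] is the adjoint of M for g. *)
Definition skew_part z (M : 'M[R]_3) : 'M[R]_3 :=
  2^-1 *: (M - invmx (gmx F z) *m M^T *m gmx F z).

Lemma skew_partZ z k M : skew_part z (k *: M) = k *: skew_part z M.
Proof.
by rewrite /skew_part linearZ /= -scalemxAr -scalemxAl -scalerBr !scalerA mulrC.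
Qed.

Lemma skew_partD z M N : skew_part z (M + N) = skew_part z M + skew_part z N.
Proof.
have trD (X Y : 'M[R]_3) : (X + Y)^T = X^T + Y^T by exact: linearD.
by rewrite /skew_part trD mulmxDr mulmxDl -scalerDr opprD addrACA.
Qed.

Lemma skew_partN z M : skew_part z (- M) = - skew_part z M.
Proof. by rewrite -scaleN1r skew_partZ scaleN1r. Qed.

Lemma skew_part0 z : skew_part z 0 = 0.
Proof. by rewrite -[X in skew_part z X](scale0r 0) skew_partZ scale0r. Qed.

Definition skew_tensor z T : tensor4 R := fun j i k l => skew_part z (slice T k l) i j.

Lemma tensor_mx_skew_tensor z T x y :
  tensor_mx (skew_tensor z T) x y = skew_part z (tensor_mx T x y).
Proof.
rewrite !tensor_mx_slice.
rewrite (big_morph _ (skew_partD z) (skew_part0 z)); apply: eq_bigr => k _.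
rewrite (big_morph _ (skew_partD z) (skew_part0 z)); apply: eq_bigr => l _.
rewrite skew_partZ; congr (_ *: _); apply/matrixP => i j.
by rewrite [LHS]mxE.
Qed.

Lemma skew_last_skew_tensor z T : skew_last T -> skew_last (skew_tensor z T).
Proof.
move=> sT j i k l; rewrite /skew_tensor.
have -> : slice T k l = - slice T l k.
  by apply/matrixP => a b; rewrite !mxE sT.
by rewrite skew_partN mxE.
Qed.

Lemma chernR_skew z : skew_last (chernR F z).
Proof.
move=> j i k l; apply: (etrans _ (esym (opprD _ _))); apply: (f_equal2 +%R).
  exact: (esym (opprB _ _)).
apply: (etrans _ (sumrN _ _ _)); apply: eq_bigr => m _.
exact: (esym (opprB _ _)).
Qed.

Definition cartan_vec_mx z (x : 'cV[R]_3) : 'M[R]_3 :=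
  \matrix_(i, j) \sum_k cartan_tensor F i j k z * x k 0.

(** The Cartan tensor term of [ccurvE] in coordinates; the leading inverse metric raises the row
    index. *)
Definition cartan_commutator z x y : 'M[R]_3 :=
  invmx (gmx F z) *m (cartan_vec_mx z y *m invmx (gmx F z) *m cartan_vec_mx z x
   - cartan_vec_mx z x *m invmx (gmx F z) *m cartan_vec_mx z y).

Definition cartanQ_explicit z : tensor4 R := fun j i k l =>
  cartan_commutator z (delta_mx k 0) (delta_mx l 0) i j.

Lemma cartan_vec_mx_delta z (x : 'cV[R]_3) :
  cartan_vec_mx z x = \sum_k x k 0 *: cartan_vec_mx z (delta_mx k 0).
Proof.
apply/matrixP => i j; rewrite mxE summxE; apply: eq_bigr => k _; rewrite !mxE.
rewrite (bigD1 k) //= big1 => [|l lk]; last by rewrite mxE (negPf lk) mulr0.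
by rewrite mxE !eqxx /= mulr1 addr0 mulrC.
Qed.

Lemma tensor_mx_cartanQ_explicit z x y :
  tensor_mx (cartanQ_explicit z) x y = cartan_commutator z x y.
Proof.
have sliceE k l : slice (cartanQ_explicit z) k l = cartan_commutator z (delta_mx k 0) (delta_mx l 0).
  by apply/matrixP => i j; rewrite mxE.
have H (x' y' : 'cV[R]_3) : cartan_vec_mx z y' *m invmx (gmx F z) *m cartan_vec_mx z x' =
   \sum_k \sum_l (x' k 0 * y' l 0) *: (cartan_vec_mx z (delta_mx l 0) *m invmx (gmx F z)
     *m cartan_vec_mx z (delta_mx k 0)).
  rewrite (cartan_vec_mx_delta z x') mulmx_sumr; apply: eq_bigr => k _.
  rewrite (cartan_vec_mx_delta z y') !mulmx_suml; apply: eq_bigr => l _.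
  by rewrite -!scalemxAl -scalemxAr scalerA mulrC.
rewrite tensor_mx_slice /cartan_commutator !H.
under eq_bigr do under eq_bigr do rewrite sliceE /cartan_commutator.
rewrite [X in _ - X]exchange_big -sumrB mulmx_sumr; apply: eq_bigr => k _.
rewrite -sumrB mulmx_sumr; apply: eq_bigr => l _.
by rewrite scalemxAr scalerBr [y l 0 * _]mulrC.
Qed.

Lemma cartanQ_explicit_skew z : skew_last (cartanQ_explicit z).
Proof.
move=> j i k l; rewrite /cartanQ_explicit /cartan_commutator -opprB mulmxN mxE.
by [].
Qed.

Lemma frame_comp_wedge T q V W (al be : 'I_3 -> one_form (V := FB)) (a' b' : FB -> 'cV[R]_3) b a :
  (forall c X, al c q X = a' X c 0) -> (forall c X, be c q X = b' X c 0) ->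
  \sum_c \sum_d frame_comp T q b a c d * wedge (al c) (be d) q V W =
  (invmx q.2 *m (tensor_mx T (q.2 *m a' V) (q.2 *m b' W)
     - tensor_mx T (q.2 *m a' W) (q.2 *m b' V)) *m q.2) a b.
Proof.
move=> aE bE; rewrite mulmxBr mulmxBl [RHS]mxE [X in _ = _ + X]mxE -!frame_compE -sumrB.
apply: eq_bigr => c _; rewrite -sumrB; apply: eq_bigr => d _.
by rewrite /wedge !aE !bE mulrBr.
Qed.

(** Skewness in the last two indices makes both terms of the wedge contribute equally, which cancels
    the factors 1/2 of [Rh] and [Qh]. *)
Lemma decomposition_rhs Rh Ph Qh q V W b a : frames O q -> skew_last Rh -> skew_last Qh ->
  2^-1 * (\sum_c \sum_d frame_comp Rh q b a c d * wedge (coframe c) (coframe d) q V W)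
  + \sum_c \sum_d frame_comp Ph q b a c d * wedge (coframe c) (coframe_v F d) q V W
  + 2^-1 * (\sum_c \sum_d frame_comp Qh q b a c d * wedge (coframe_v F c) (coframe_v F d) q V W)
  = (invmx q.2 *m (tensor_mx Rh V.1.1^T W.1.1^T
       + (tensor_mx Ph V.1.1^T (vform F q.1 W.1) - tensor_mx Ph W.1.1^T (vform F q.1 V.1))
       + tensor_mx Qh (vform F q.1 V.1) (vform F q.1 W.1)) *m q.2) a b.
Proof.
move=> fq sR sQ; have [Dq uq] := fq.
have cE c X : coframe c q X = cof q X c 0 by exact: coframeE.
have cvE c X : coframe_v F c q X = covf F q X c 0 by exact: coframe_vE.
rewrite (frame_comp_wedge Rh V W b a cE cE) (frame_comp_wedge Ph V W b a cE cvE).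
rewrite (frame_comp_wedge Qh V W b a cvE cvE).
have xE X : q.2 *m cof q X = X.1.1^T by rewrite /cof mulmxA mulmxV // mul1mx.
rewrite !xE !(frame_covf _ _ fq) (tensor_mx_skew _ _ sR) (tensor_mx_skew (vform F q.1 V.1) _ sQ).
rewrite !opprK.
move: (tensor_mx Rh _ _) (tensor_mx Ph _ _ - _) (tensor_mx Qh _ _) => A B C.
rewrite !mulmxDr !mulmxDl [RHS]mxE [X in _ = X + _]mxE.
move: (invmx q.2 *m A *m q.2) (invmx q.2 *m B *m q.2) (invmx q.2 *m C *m q.2) => A1 B1 C1.
by rewrite !mxE; field.
Qed.

(** Existence of a decomposition ensures that the choice in [cartanQ] satisfies its defining
    property. By [ccurvE] the parts [R] and [P] are the g-skew parts of the Chern curvatures, and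
    [Q] is the commutator. *)
Lemma cartan_decomposition z : D z -> curvature_decomposition F z
  (skew_tensor z (chernR F z)) (skew_tensor z (chernP F z)) (cartanQ_explicit z).
Proof.
move=> Dz; have sR := skew_last_skew_tensor z (@chernR_skew z).
have sQ := @cartanQ_explicit_skew z.
split=> // q V W b a SOq qz tV tW.
have aq : adapted O F q by split; rewrite ?qz.
have fq := adapted_frames aq; have [Dq uq] := fq.
rewrite (decomposition_rhs _ V W b a fq sR sQ) (cartan_curvE HF b a V W fq).
congr (fun_of_matrix _ a b); rewrite (ccurvE HF aq tV tW).
rewrite !tensor_mx_skew_tensor tensor_mx_cartanQ_explicit -qz.
have spE A B C : skew_part q.1 A + (skew_part q.1 B - skew_part q.1 C) =
    skew_part q.1 (A + B - C) by rewrite !skew_partD skew_partN addrA.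
rewrite spE -(curv_mxE HF V.1 W.1 Dq).
rewrite mulmxDr mulmxDl; congr (_ + _).
  (* Conjugation by an adapted frame turns the adjoint for [g] into the transpose. *)
  rewrite /skew_part -scalemxAr -scalemxAl; congr (_ *: _).
  rewrite mulmxBr mulmxBl /curv_frame; congr (_ - _).
  rewrite !trmx_mul !mulmxA (adapted_ginv HF aq) !mulmxA mulVmx // mul1mx.
  rewrite (adapted_g aq) -!mulmxA; congr (_ *m (_ *m _)).
  by rewrite mulVmx // mulmx1.
have cE X : cartan_vec_mx q.1 (vform F q.1 X.1) = cartan_mx F q.1 X.1 by [].
have ie : invmx q.2 *m invmx (gmx F q.1) = q.2^T.
  by rewrite (adapted_ginv HF aq) mulmxA mulVmx // mul1mx.
rewrite /cartan_commutator !cE mulmxA ie mulmxBr mulmxBl.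
by rewrite (adapted_ginv HF aq) /cartan_fmx !mulmxA.
Qed.

(** On vectors without horizontal part the [R] and [P] terms of a decomposition vanish. So the
    chosen one and the explicit one give the same [Q]. *)
Lemma cartanQ_mx z x y : D z -> tensor_mx (cartanQ F z) x y = cartan_commutator z x y.
Proof.
move=> Dz; rewrite -tensor_mx_cartanQ_explicit.
have [Rh [Ph [sR sQ dec]]] : exists Rh Ph, curvature_decomposition F z Rh Ph (cartanQ F z).
  apply: (@getPex _ (fun Qh => exists Rh Ph, curvature_decomposition F z Rh Ph Qh)).
  by exists (cartanQ_explicit z), (skew_tensor z (chernR F z)), (skew_tensor z (chernP F z)); exact: cartan_decomposition.
have [sR' sQ' dec'] := cartan_decomposition Dz.
have [E [aE lift]] := exists_adapted_lift HF Dz.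
have fE := adapted_frames aE; have [_ uE] := fE; rewrite /= in uE.
have F0 : F z != 0 by rewrite gt_eqF // (F_gt0 HF).
(* The factor [F z] compensates the division by [F] in [vform]. *)
pose vert (x : 'cV[R]_3) : TV := (0, F z *: x^T).
have vertE x' : vform F z (vert x') = x'.
  apply/matrixP => i j; rewrite (ord1 j) mxE /= !mxE big1 ?addr0 => [|k _]; last by rewrite mxE mulr0.
  by rewrite mulrC mulKf.
have [Bx tx] := lift (vert x); have [By ty] := lift (vert y).
apply: (can_inj (mulKVmx uE)); apply: (can_inj (mulmxK uE)).
apply/matrixP => a b.
have SOE : SO2_TM F (z, E) by have [_] := aE.
have e1 := dec (z, E) (vert x, Bx) (vert y, By) b a SOE erefl tx ty.
have e2 := dec' (z, E) (vert x, Bx) (vert y, By) b a SOE erefl tx ty.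
rewrite (decomposition_rhs _ _ _ _ _ fE sR sQ) in e1.
rewrite (decomposition_rhs _ _ _ _ _ fE sR' sQ') in e2.
have t0l T (y' : 'cV[R]_3) : tensor_mx T (0 : 'rV[R]_3)^T y' = 0.
  by rewrite trmx0; apply/matrixP => i j; rewrite !mxE big1 // => k _; rewrite big1 // => l _; rewrite mxE mulr0 mul0r.
by move: e1 e2; rewrite /= !t0l !vertE !subrr !add0r => -> .
Qed.

End CartanDecomposition.

(** * The kernel in an adapted frame *)

Section FrameComponents.
Context {R : realType}.
Local Notation TV := (TV R).
Local Notation FB := (FB R).
Variables (O : set 'rV[R]_3) (F : TV -> R).
Hypothesis HF : local_finsler O F.
Local Notation D := (slit O).
Variables p s : R.
Implicit Types (z v w : TV) (q V W : FB) (T : TV -> tensor4 R).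

Definition spin_mx T z : 'M[R]_3 := \matrix_(k, l) on_spin F s T k l z.
Definition spin_fmx T q : 'M[R]_3 := q.2^T *m spin_mx T q.1 *m q.2.

Lemma bilinear_mxE (A : 'M[R]_3) (x y : 'cV[R]_3) :
  (x^T *m A *m y) 0 0 = \sum_k \sum_l x k 0 * A k l * y l 0.
Proof.
rewrite mxE exchange_big; apply: eq_bigr => l _; rewrite mxE mulr_suml.
by apply: eq_bigr => k _; rewrite [x^T 0 k]mxE.
Qed.

(** Writes a curvature contracted with the spin tensor as the trace in which it enters
    [sigma_coord]. *)
Lemma spin_mxE T z (x y : 'cV[R]_3) :
  (x^T *m spin_mx T z *m y) 0 0 =
  \tr (SUmx F s z *m gmx F z *m tensor_mx (T z) x y).
Proof.
pose M := tensor_mx (T z) x y.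
have -> : \tr (SUmx F s z *m gmx F z *m M) =
    \sum_i \sum_j SUmx F s z i j * \sum_m g F j m z * M m i.
  apply: eq_bigr => i _; rewrite -mulmxA mxE; apply: eq_bigr => j _.
  by congr (_ * _); rewrite mxE.
transitivity (\sum_k \sum_l \sum_i \sum_j
    SUmx F s z i j * (lower F z (T z) i j k l * x k 0 * y l 0)).
  rewrite bilinear_mxE; apply: eq_bigr => k _; apply: eq_bigr => l _.
  rewrite [spin_mx _ _ k l]mxE /on_spin mulr_sumr mulr_suml; apply: eq_bigr => i _.
  rewrite mulr_sumr mulr_suml; apply: eq_bigr => j _; rewrite [SUmx _ _ _ i j]mxE.
  by move: (lower _ _ _ _ _ _ _) (spin_up _ _ _ _ _) => a b; ring.
rewrite exchange_big4; apply: eq_bigr => i _; apply: eq_bigr => j _.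
rewrite mulr_sumr.
transitivity (\sum_k \sum_l \sum_m SUmx F s z i j * (g F j m z * (T z i m k l * x k 0 * y l 0))).
  apply: eq_bigr => k _; apply: eq_bigr => l _; rewrite /lower !mulr_suml mulr_sumr.
  by apply: eq_bigr => m _; move: (g F j m z) (T z i m k l) => a b; ring.
transitivity (\sum_k \sum_m \sum_l SUmx F s z i j * (g F j m z * (T z i m k l * x k 0 * y l 0))).
  by apply: eq_bigr => k _; rewrite exchange_big.
rewrite exchange_big; apply: eq_bigr => m _; rewrite [M m i]mxE !mulr_sumr.
by apply: eq_bigr => k _; rewrite !mulr_sumr.
Qed.

(** The form sigma in frame components, unprimed for horizontal and primed for vertical ones; [A],
    [B], [C] are [R(S)], [P(S)], [Q(S)] and [J] is the spin tensor. *)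
Definition spin_pairing (A B C J : 'M[R]_3) (x x' y y' : 'cV[R]_3) : R :=
  p * ((x'^T *m y) 0 0 - (y'^T *m x) 0 0)
  + 2^-1 * ((x^T *m A *m y) 0 0 + (x^T *m B *m y') 0 0 - (y^T *m B *m x') 0 0)
  + 2^-1 * (x'^T *m C *m y') 0 0 - (x'^T *m J *m y') 0 0.

Lemma sigma_coord_frame q v w : adapted O F q -> F q.1 = 1 ->
  sigma_coord F p s q.1 v w =
  spin_pairing (spin_fmx (chernR F) q) (spin_fmx (chernP F) q) (spin_fmx (cartanQ F) q) (Jmx s)
    (invmx q.2 *m v.1^T) (invmx q.2 *m vform F q.1 v)
    (invmx q.2 *m w.1^T) (invmx q.2 *m vform F q.1 w).
Proof.
move=> aq F1; have fq := adapted_frames aq; have [Dq uq] := fq.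
have gu := gmx_unit HF Dq.
have fm (A : 'M[R]_3) (x y : 'cV[R]_3) : (invmx q.2 *m x)^T *m (q.2^T *m A *m q.2) *m (invmx q.2 *m y) = x^T *m A *m y.
  have iT : (invmx q.2)^T *m q.2^T = 1%:M by rewrite -trmx_mul mulmxV // trmx1.
  rewrite trmx_mul !mulmxA -(mulmxA x^T (invmx q.2)^T) iT mulmx1.
  by rewrite -(mulmxA _ q.2 (invmx q.2)) mulmxV // mulmx1.
have gm (x y : 'cV[R]_3) : (invmx q.2 *m x)^T *m (invmx q.2 *m y) = x^T *m gmx F q.1 *m y.
  by rewrite (adapted_g aq) trmx_mul !mulmxA.
have jm (x y : 'cV[R]_3) : (invmx q.2 *m x)^T *m Jmx s *m (invmx q.2 *m y) = x^T *m SLmx F s q.1 *m y.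
  by rewrite (adapted_spin_low s aq F1) trmx_mul !mulmxA.
rewrite /spin_pairing /spin_fmx !fm !gm jm !spin_mxE (cartanQ_mx HF _ _ Dq).
rewrite /sigma_coord (curv_mxE HF v w Dq) /cartan_commutator.
have t3 (S A B C : 'M[R]_3) : \tr (S *m (A + B - C)) = \tr (S *m A) + \tr (S *m B) - \tr (S *m C).
  by rewrite mulmxBr mulmxDr (linearB (@mxtrace R 3)) (linearD (@mxtrace R 3)).
have cE x : cartan_vec_mx F q.1 (vform F q.1 x) = cartan_mx F q.1 x by [].
have SUg M : SUmx F s q.1 *m gmx F q.1 *m (invmx (gmx F q.1) *m M) = SUmx F s q.1 *m M.
  by rewrite mulmxA -(mulmxA _ _ (invmx _)) mulmxV // mulmx1.
by rewrite t3 SUg !cE.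
Qed.

Lemma on_spin2E T q : adapted O F q -> F q.1 = 1 ->
  on_spin2 F s T q.1 = s * (spin_fmx T q ix1 ix2 - spin_fmx T q ix2 ix1).
Proof.
move=> aq F1.
have -> : on_spin2 F s T q.1 = \tr (spin_mx T q.1 *m (SUmx F s q.1)^T).
  by apply: eq_bigr => k _; rewrite mxE; apply: eq_bigr => l _; rewrite !mxE.
rewrite (adapted_spin_up HF s aq F1) trmx_mul trmxK trmx_mul.
have -> : s * (spin_fmx T q ix1 ix2 - spin_fmx T q ix2 ix1) = \tr (spin_fmx T q *m (Jmx s)^T).
  move: (spin_fmx T q) => A.
  by rewrite /mxtrace sum3 ![(A *m _) _ _]mxE !sum3 !mxE /spin_frame !kron_values; ring.
by rewrite /spin_fmx !mulmxA [LHS]mxtrace_mulC !mulmxA.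
Qed.

Lemma spin_trace T q : adapted O F q ->
  \sum_i \sum_j on_spin F s T i j q.1 * ginv F i j q.1 = \tr (spin_fmx T q).
Proof.
move=> aq; transitivity (\tr (spin_mx T q.1 *m (invmx (gmx F q.1))^T)).
  by apply: eq_bigr => i _; rewrite mxE; apply: eq_bigr => j _; rewrite !mxE.
rewrite (adapted_ginv HF aq) trmx_mul trmxK /spin_fmx !mulmxA [LHS]mxtrace_mulC.
by rewrite !mulmxA.
Qed.

(** As [Jmx s] lives on the first two indices, the trace is [2 s^2] times the determinant of the
    upper left two by two block. *)
Lemma spin_det T q : adapted O F q -> F q.1 = 1 ->
  \sum_i \sum_j \sum_k \sum_l on_spin F s T i k q.1 * on_spin F s T j l q.1 *
      spin_up F s i j q.1 * spin_up F s k l q.1 =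
  \tr ((spin_fmx T q)^T *m Jmx s *m spin_fmx T q *m (Jmx s)^T).
Proof.
move=> aq F1.
transitivity (\tr ((spin_mx T q.1)^T *m SUmx F s q.1 *m spin_mx T q.1 *m (SUmx F s q.1)^T)).
  rewrite exchange_big4; apply: eq_bigr => k _; rewrite mxE; apply: eq_bigr => l _.
  rewrite [(SUmx _ _ _)^T l k]mxE [SUmx _ _ _ k l]mxE [(_ *m spin_mx T q.1) k l]mxE mulr_suml.
  rewrite exchange_big; apply: eq_bigr => j _ /=.
  rewrite [(_ *m SUmx _ _ _) k j]mxE !mulr_suml; apply: eq_bigr => i _.
  rewrite [(spin_mx _ _)^T k i]mxE [spin_mx _ _ i k]mxE [spin_mx _ _ j l]mxE [SUmx _ _ _ i j]mxE.
  by move: (on_spin _ _ _ _ _ _) (on_spin _ _ _ _ _ _) => a b; ring.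
rewrite (adapted_spin_up HF s aq F1) /spin_fmx !trmx_mul !trmxK !mulmxA.
by rewrite [RHS]mxtrace_mulC [LHS]mxtrace_mulC !mulmxA [LHS]mxtrace_mulC !mulmxA.
Qed.

(** The transpose appears because [spin_mix] has its lower index first, whereas endomorphisms have
    the upper index as the row. *)
Lemma spin_mix_frame q : adapted O F q -> F q.1 = 1 ->
  (SLmx F s q.1 *m invmx (gmx F q.1))^T = q.2 *m (Jmx s)^T *m invmx q.2.
Proof.
move=> aq F1; have [_ uq] := adapted_frames aq.
rewrite (adapted_spin_low s aq F1) (adapted_ginv HF aq) !mulmxA.
rewrite -(mulmxA _ (invmx q.2) q.2) mulVmx // mulmx1 !trmx_mul !trmxK.
by rewrite !mulmxA.
Qed.

Lemma on_spin_mix_frame T q : adapted O F q ->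
  (spin_mx T q.1 *m invmx (gmx F q.1))^T = q.2 *m q.2^T *m (spin_mx T q.1)^T.
Proof. by move=> aq; rewrite (adapted_ginv HF aq) !trmx_mul !trmxK. Qed.

Definition char_hor_col z : 'cV[R]_3 := \col_i char_hor F p s i z.
Definition char_ver_col z : 'cV[R]_3 := \col_i char_ver F p s i z.

Lemma char_hor_frame q : adapted O F q -> F q.1 = 1 -> char_hor_col q.1 =
  q.2 *m (delta_mx ix3 0 + (2 * s * Sigma F p s q.1)^-1 *:
     ((Jmx s)^T *m (spin_fmx (chernR F) q)^T *m delta_mx ix3 0)).
Proof.
move=> aq F1; have fq := adapted_frames aq; have [Dq uq] := fq.
have uE : \col_i u F i q.1 = q.2 *m delta_mx ix3 0.
  by apply/matrixP => i j; rewrite (ord1 j) -colE !mxE (adapted_col3 i aq F1) /u /uvec F1 invr1 scale1r.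
transitivity (\col_i u F i q.1 + (2 * s * Sigma F p s q.1)^-1 *:
   ((SLmx F s q.1 *m invmx (gmx F q.1))^T *m (spin_mx (chernR F) q.1 *m invmx (gmx F q.1))^T
     *m \col_i u F i q.1)).
  apply/matrixP => i j; rewrite (ord1 j) [LHS]mxE /char_hor [RHS]mxE [X in _ = X + _]mxE.
  congr (_ + _); rewrite [RHS]mxE; congr (_ * _).
  rewrite -mulmxA [RHS]mxE; apply: eq_bigr => a _.
  rewrite [(_ *m \col__ _) a 0]mxE mulr_sumr; apply: eq_bigr => k _; rewrite -mulrA; congr (_ * (_ * _)).
  - rewrite [RHS]mxE [RHS]mxE; apply: eq_bigr => l _.
    by rewrite [SLmx _ _ _ _ _]mxE.
  - rewrite [RHS]mxE [RHS]mxE; apply: eq_bigr => l _.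
    by rewrite [spin_mx _ _ _ _]mxE.
  - by rewrite mxE.
rewrite uE mulmxDr; congr (_ + _); rewrite -scalemxAr; congr (_ *: _).
rewrite (spin_mix_frame aq F1) (on_spin_mix_frame _ aq) /spin_fmx !trmx_mul !trmxK !mulmxA.
by rewrite -(mulmxA _ (invmx q.2) q.2) mulVmx // mulmx1.
Qed.

Lemma char_ver_frame q : adapted O F q -> F q.1 = 1 -> char_ver_col q.1 =
  q.2 *m ((2 * s ^+ 2 * Delta F s q.1 * Sigma F p s q.1)^-1 *:
     ((Jmx s)^T *m (p%:M - 2^-1 *: (spin_fmx (chernP F) q)^T) *m (Jmx s)^T
        *m (spin_fmx (chernR F) q)^T *m delta_mx ix3 0)).
Proof.
move=> aq F1; have fq := adapted_frames aq; have [Dq uq] := fq.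
pose Sm := (SLmx F s q.1 *m invmx (gmx F q.1))^T.
pose Rm := (spin_mx (chernR F) q.1 *m invmx (gmx F q.1))^T.
pose Pm := (spin_mx (chernP F) q.1 *m invmx (gmx F q.1))^T.
have SmE i j : Sm i j = spin_mix F s j i q.1.
  by rewrite [LHS]mxE [LHS]mxE; apply: eq_bigr => l _; rewrite [SLmx _ _ _ _ _]mxE.
have RmE i j : Rm i j = on_spin_mix F s (chernR F) j i q.1.
  by rewrite [LHS]mxE [LHS]mxE; apply: eq_bigr => l _; rewrite [spin_mx _ _ _ _]mxE.
have PmE i j : Pm i j = on_spin_mix F s (chernP F) j i q.1.
  by rewrite [LHS]mxE [LHS]mxE; apply: eq_bigr => l _; rewrite [spin_mx _ _ _ _]mxE.
have MmE a b : (p%:M - 2^-1 *: Pm) a b =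
    p * kron R a b - 2^-1 * on_spin_mix F s (chernP F) b a q.1.
  rewrite [LHS]mxE [X in X + _]mxE [X in _ + X]mxE [X in - X]mxE PmE.
  by rewrite /kron mulr_natr.
pose U0 : 'cV[R]_3 := \col_i u F i q.1.
have U0E m : U0 m 0 = u F m q.1 by rewrite mxE.
transitivity ((2 * s ^+ 2 * Delta F s q.1 * Sigma F p s q.1)^-1 *:
   (Sm *m ((p%:M - 2^-1 *: Pm) *m (Sm *m (Rm *m U0))))).

  apply/matrixP => i j; rewrite (ord1 j) [LHS]mxE /char_ver [RHS]mxE; congr (_ * _).
  rewrite [RHS]mxE; apply: eq_bigr => a _; rewrite [(_ *m (_ *m _)) a 0]mxE [in RHS]mulr_sumr.
  apply: eq_bigr => b _; rewrite [(Sm *m _) b 0]mxE ![in RHS]mulr_sumr.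
  apply: eq_bigr => l _; rewrite [(Rm *m _) l 0]mxE ![in RHS]mulr_sumr.
  apply: eq_bigr => m _; rewrite !SmE RmE U0E MmE.
  move: (spin_mix F s a i q.1) (spin_mix F s l b q.1) (on_spin_mix F s (chernR F) m l q.1)
    (on_spin_mix F s (chernP F) b a q.1) (kron R a b) (u F m q.1) => x y r t k n.
  by ring.
have uE : U0 = q.2 *m delta_mx ix3 0.
  by apply/matrixP => i j; rewrite (ord1 j) -colE !mxE (adapted_col3 i aq F1) /u /uvec F1 invr1 scale1r.
rewrite -scalemxAr; congr (_ *: _).
rewrite uE /Sm /Rm /Pm (spin_mix_frame aq F1) !(on_spin_mix_frame _ aq).
have eP : invmx q.2 *m (p%:M - 2^-1 *: (q.2 *m q.2^T *m (spin_mx (chernP F) q.1)^T)) *m q.2 =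
    p%:M - 2^-1 *: (spin_fmx (chernP F) q)^T.
  rewrite mulmxBr mulmxBl mul_mx_scalar -scalemxAl mulVmx // scalemx1; congr (_ - _).
  rewrite -scalemxAr -scalemxAl; congr (_ *: _).
  by rewrite /spin_fmx !trmx_mul !trmxK !mulmxA mulVmx // mul1mx.
rewrite -eP /spin_fmx !trmx_mul !trmxK !mulmxA.
by rewrite -(mulmxA _ (invmx q.2) q.2 ) mulVmx // mulmx1.
Qed.

End FrameComponents.

(** * Contracted curvatures and coordinates of tangent vectors in an adapted frame *)

Section Kernel.
Context {R : realType}.
Local Notation TV := (TV R).
Local Notation FB := (FB R).
Variables (O : set 'rV[R]_3) (F : TV -> R).
Hypothesis HF : local_finsler O F.
Local Notation D := (slit O).
Variables p s : R.
Hypothesis s_neq0 : s != 0.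
Implicit Types (z v w : TV) (q V W : FB) (T : TV -> tensor4 R).

Lemma spin_fmx_entry T q a b : spin_fmx F s T q a b =
  \tr (SUmx F s q.1 *m gmx F q.1 *m
       tensor_mx (T q.1) (q.2 *m delta_mx a 0) (q.2 *m delta_mx b 0)).
Proof.
rewrite -spin_mxE.
have dE (A : 'M[R]_3) : A a b = ((delta_mx a 0 : 'cV[R]_3)^T *m A *m (delta_mx b 0 : 'cV[R]_3)) 0 0.
  by rewrite trmx_delta -rowE -colE !mxE.
rewrite [LHS]dE /spin_fmx [in RHS]trmx_mul; congr (fun_of_matrix _ 0 0).
by rewrite !mulmxA.
Qed.

Lemma spin_fmx_skew T q a b :
  (forall x y, tensor_mx (T q.1) y x = - tensor_mx (T q.1) x y) ->
  spin_fmx F s T q b a = - spin_fmx F s T q a b.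
Proof. by move=> sT; rewrite !spin_fmx_entry sT mulmxN (linearN (@mxtrace R 3)). Qed.

Lemma spin_fmx_chernR_skew q a b :
  spin_fmx F s (chernR F) q b a = - spin_fmx F s (chernR F) q a b.
Proof. by apply: spin_fmx_skew => x y; apply: tensor_mx_skew; exact: chernR_skew. Qed.

Lemma spin_fmx_cartanQ_skew q a b : D q.1 ->
  spin_fmx F s (cartanQ F) q b a = - spin_fmx F s (cartanQ F) q a b.
Proof.
move=> Dq; apply: spin_fmx_skew => x y; rewrite !(cartanQ_mx HF) // /cartan_commutator.
by rewrite -[RHS]mulmxN opprB.
Qed.

(* The contraction of the P-curvature with u is the Landsberg tensor, which is
   symmetric, hence annihilated by the spin tensor. *)
Lemma spin_fmx_chernP_row3 q b : adapted O F q -> F q.1 = 1 ->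
  spin_fmx F s (chernP F) q ix3 b = 0.
Proof.
move=> aq F1; have [Dq uq] := adapted_frames aq.
rewrite spin_fmx_entry -mulmxA; set y := q.2 *m delta_mx b 0.
have uE : q.2 *m delta_mx ix3 0 = q.1.2^T.
  by rewrite -colE; apply/matrixP => i j; rewrite (ord1 j) !mxE (adapted_col3 i aq F1).
rewrite uE; set G := gmx F q.1 *m _.
have GE a j : G a j = \sum_l (- F q.1 * y l 0) *
    \sum_m g F a m q.1 * (dy l (nconn F m j) q.1 - chern F m j l q.1).
  rewrite mxE; transitivity (\sum_m \sum_l (- F q.1 * y l 0) *
      (g F a m q.1 * (dy l (nconn F m j) q.1 - chern F m j l q.1))); last first.
    by rewrite exchange_big; apply: eq_bigr => l _; rewrite -mulr_sumr.
  apply: eq_bigr => m _; rewrite [tensor_mx _ _ _ m j]mxE exchange_big mulr_sumr.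
  apply: eq_bigr => l _ /=; rewrite -(sum_dy_chern_y HF m j l Dq).
  transitivity (gmx F q.1 a m * (- F q.1 * y l 0 *
      \sum_k dy l (chern F m j k) q.1 * q.1.2 0 k)); last by rewrite mulrCA.
  congr (_ * _); rewrite mulr_sumr; apply: eq_bigr => k _.
  rewrite [q.1.2^T k 0]mxE /chernP.
  by move: (dy l _ _) => t; ring.
have Gs : G^T = G.
  apply/matrixP => a j; rewrite mxE !GE; apply: eq_bigr => l _; congr (_ * _).
  exact: (landsberg_sym HF j a l Dq).
have Ss : (SUmx F s q.1)^T = - SUmx F s q.1.
  have Js : (Jmx s)^T = - Jmx s.
    by apply/matrixP => a c; rewrite !mxE /spin_frame; ring.
  by rewrite (adapted_spin_up HF s aq F1) !trmx_mul trmxK Js mulNmx mulmxN !mulmxA.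
have : \tr (SUmx F s q.1 *m G) = - \tr (SUmx F s q.1 *m G).
  rewrite -{1}mxtrace_tr trmx_mul Gs Ss mulmxN (linearN (@mxtrace R 3)) /=.
  by rewrite mxtrace_mulC.
by move: (\tr _) => t ?; lra.
Qed.

Lemma Delta_frame q : adapted O F q -> F q.1 = 1 ->
  Delta F s q.1 = s - 2^-1 * spin_fmx F s (cartanQ F) q ix1 ix2.
Proof.
move=> aq F1; have [Dq uq] := adapted_frames aq.
rewrite /Delta (on_spin2E HF s _ aq F1) (spin_fmx_cartanQ_skew ix1 ix2 Dq).
by move: (spin_fmx _ _ _ _ _ _) => Q; field.
Qed.

(** The third row of [P(S)] vanishes, so its trace is that of the upper left block, and the bracket
    is the determinant of [p - P(S)/2] on this block. *)
Lemma Sigma_frame q : adapted O F q -> F q.1 = 1 ->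
  let P := spin_fmx F s (chernP F) q in
  Sigma F p s q.1 = (Delta F s q.1)^-1 * (p ^+ 2 - 2^-1 * p * (P ix1 ix1 + P ix2 ix2)
      + 4^-1 * (P ix1 ix1 * P ix2 ix2 - P ix1 ix2 * P ix2 ix1))
    + 2^-1 * spin_fmx F s (chernR F) q ix1 ix2.
Proof.
move=> aq F1 P; have [Dq uq] := adapted_frames aq.
have P3 b : P ix3 b = 0 by exact: spin_fmx_chernP_row3.
rewrite /Sigma (on_spin2E HF s _ aq F1) (spin_fmx_chernR_skew q ix1 ix2).
rewrite (spin_trace HF s _ aq) (spin_det HF s _ aq F1) -/P.
have -> : \tr P = P ix1 ix1 + P ix2 ix2 by rewrite /mxtrace sum3 P3 addr0.
have -> : \tr (P^T *m Jmx s *m P *m (Jmx s)^T) =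
    2 * s ^+ 2 * (P ix1 ix1 * P ix2 ix2 - P ix1 ix2 * P ix2 ix1).
  move: P P3 => P P3.
  rewrite /mxtrace sum3 ![(_ *m (Jmx s)^T) _ _]mxE !sum3 ![(_ *m P) _ _]mxE !sum3.
  rewrite ![(P^T *m _) _ _]mxE !sum3 !mxE /spin_frame !kron_values; ring.
move: (Delta F s q.1)^-1 (spin_fmx F s (chernR F) q ix1 ix2) (P ix1 ix1) (P ix1 ix2) (P ix2 ix1) (P ix2 ix2).
by move=> d r a b c e; field.
Qed.

Definition horiz_coord q v : 'cV[R]_3 := invmx q.2 *m v.1^T.
Definition vert_coord q v : 'cV[R]_3 := invmx q.2 *m vform F q.1 v.

(** Where [F] is 1 this inverts [horiz_coord] and [vert_coord]: subtracting [N x] undoes the passage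
    from [dy] to [δy]. *)
Definition of_coord q (x y : 'cV[R]_3) : TV := ((q.2 *m x)^T,
  \row_i ((q.2 *m y) i 0 - \sum_j nconn F i j q.1 * (q.2 *m x) j 0)).

Lemma of_coordK q x y : frames O q -> F q.1 = 1 ->
  horiz_coord q (of_coord q x y) = x /\ vert_coord q (of_coord q x y) = y.
Proof.
move=> [Dq uq] F1; split; first by rewrite /horiz_coord /= trmxK mulKmx.
rewrite /vert_coord.
have -> : vform F q.1 (of_coord q x y) = q.2 *m y; last by rewrite mulKmx.
apply/matrixP => i j; rewrite (ord1 j) mxE F1 divr1 /= [(\row__ _) 0 i]mxE.
by under [X in _ + X]eq_bigr do rewrite [_^T 0 _]mxE; rewrite subrK.
Qed.

Lemma coord_inj q v w : frames O q -> F q.1 = 1 ->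
  horiz_coord q v = horiz_coord q w -> vert_coord q v = vert_coord q w -> v = w.
Proof.
move=> [Dq uq] F1 /(can_inj (mulKVmx uq)) /trmx_inj e1 /(can_inj (mulKVmx uq)) e2.
case: v w e1 e2 => v1 v2 [w1 w2] /= <- /matrixP e2; congr (_, _); apply/rowP => i.
by have := e2 i 0; rewrite !mxE /= F1 !divr1 => /addIr.
Qed.

Lemma vformZ z k v : vform F z (k *: v) = k *: vform F z v.
Proof.
apply/matrixP => i j; rewrite (ord1 j) !mxE /= mulrA mulrDr; congr ((_ + _) / _).
by rewrite mulr_sumr; apply: eq_bigr => l _; rewrite mxE mulrCA.
Qed.

Lemma vformD z v w : vform F z (v + w) = vform F z v + vform F z w.
Proof.
apply/matrixP => i j; rewrite (ord1 j) !mxE /= -mulrDl addrACA -big_split; congr ((_ + _) / _).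
by apply: eq_bigr => l _; rewrite mxE mulrDr.
Qed.

Lemma coordZ q k v : horiz_coord q (k *: v) = k *: horiz_coord q v /\
  vert_coord q (k *: v) = k *: vert_coord q v.
Proof.
split; last by rewrite /vert_coord vformZ -scalemxAr.
by rewrite /horiz_coord /= linearZ /= -scalemxAr.
Qed.

Lemma fst_comb (a b : 'I_3 -> R) (H K : 'I_3 -> TV) j :
  (\sum_i a i *: H i + \sum_i b i *: K i).1 0 j =
  \sum_i a i * (H i).1 0 j + \sum_i b i * (K i).1 0 j.
Proof. by rewrite !sum3 /= !mxE. Qed.

Lemma snd_comb (a b : 'I_3 -> R) (H K : 'I_3 -> TV) j :
  (\sum_i a i *: H i + \sum_i b i *: K i).2 0 j =
  \sum_i a i * (H i).2 0 j + \sum_i b i * (K i).2 0 j.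
Proof. by rewrite !sum3 /= !mxE. Qed.

Lemma char_vec_coord q : adapted O F q -> F q.1 = 1 ->
  (char_vec F p s q.1).1^T = char_hor_col F p s q.1 /\
  vform F q.1 (char_vec F p s q.1) = char_ver_col F p s q.1.
Proof.
move=> aq F1; set z := q.1.
have h1 j : (char_vec F p s z).1 0 j = char_hor F p s j z.
  apply: (etrans (fst_comb (fun i => char_hor F p s i z) (fun i => char_ver F p s i z)
      (fun i => hor_vec F i z) (fun i => ver_vec R i) j)).
  rewrite [X in _ + X]big1 => [|i _]; last by rewrite mxE mulr0.
  rewrite addr0 -[RHS](sum_kron (fun l => char_hor F p s l z)).
  by apply: eq_bigr => i _; rewrite mxE eqxx /= mulrC /kron eq_sym.
have h2 j : (char_vec F p s z).2 0 j =
    - (\sum_k nconn F j k z * char_hor F p s k z) + char_ver F p s j z.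
  have bE i : bv R i 0 j = kron R j i by rewrite mxE eqxx.
  have nE i : (- (\sum_j nconn F j i z *: bv R j)) 0 j = - nconn F j i z.
    rewrite mxE summxE; congr (- _); rewrite -[RHS](sum_kron (fun l => nconn F l i z)).
    by apply: eq_bigr => l _; rewrite mxE mxE eqxx /= mulrC /kron eq_sym.
  have -> : (char_vec F p s z).2 0 j = \sum_i char_hor F p s i z * (- (\sum_j nconn F j i z *: bv R j)) 0 j
     + \sum_i char_ver F p s i z * bv R i 0 j.
    exact: (snd_comb (fun i => char_hor F p s i z) (fun i => char_ver F p s i z)
      (fun i => hor_vec F i z) (fun i => ver_vec R i)).
  rewrite -sumrN; congr (_ + _); first by apply: eq_bigr => i _; rewrite nE; ring.
  rewrite -[RHS](sum_kron (fun l => char_ver F p s l z)).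
  by apply: eq_bigr => i _; rewrite bE kronC mulrC.
split; apply/matrixP => i j; rewrite (ord1 j); first by rewrite mxE [RHS]mxE h1.
rewrite [LHS]mxE F1 divr1 h2 [RHS]mxE.
under [X in _ + X = _]eq_bigr do rewrite h1.
by rewrite addrAC addNr add0r.
Qed.

End Kernel.

Lemma ord3_cases (i : 'I_3) : [\/ i = ix1, i = ix2 | i = ix3].
Proof.
by case: i => -[|[|[|//]]] ?; [constructor 1|constructor 2|constructor 3]; apply: val_inj.
Qed.

(** * The linear system for the kernel *)

Section KernelSystem.
Context {K : realFieldType}.
Variables (p r12 r13 r23 P11 P12 P21 P22 D S : K).

Definition kernel_pairing (x1 x2 x3 x1' x2' y1 y2 y3 y1' y2' : K) : K :=
  p * (x1' * y1 - y1' * x1 + x2' * y2 - y2' * x2)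
  + 2^-1 * (r12 * (x1 * y2 - x2 * y1) + r13 * (x1 * y3 - x3 * y1) + r23 * (x2 * y3 - x3 * y2))
  + 2^-1 * (P11 * (x1 * y1' - y1 * x1') + P12 * (x1 * y2' - y1 * x2')
     + P21 * (x2 * y1' - y2 * x1') + P22 * (x2 * y2' - y2 * x2'))
  - D * (x1' * y2' - x2' * y1').

(** The coefficients of [y1], [y2], [y3], [y2'], [y1'] in the pairing. With [M = p - P/2], whose
    off-diagonal entries are written as differences from 0, the first two equations prescribe
    [M x'], and the last two say [D x' = J M^T x] for the quarter turn [J]. *)
Definition kernel_system (x1 x2 x3 x1' x2' : K) : Prop :=
  [/\ (p - 2^-1 * P11) * x1' + (0 - 2^-1 * P12) * x2' = 2^-1 * (r12 * x2 + r13 * x3),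
      (0 - 2^-1 * P21) * x1' + (p - 2^-1 * P22) * x2' = 2^-1 * (r23 * x3 - r12 * x1),
      r13 * x1 + r23 * x2 = 0 &
   [/\ D * x1' = - ((0 - 2^-1 * P12) * x1 + (p - 2^-1 * P22) * x2) &
      D * x2' = (p - 2^-1 * P11) * x1 + (0 - 2^-1 * P21) * x2]].

Lemma kernel_pairing_system x1 x2 x3 x1' x2' :
  (forall y1 y2 y3 y1' y2', kernel_pairing x1 x2 x3 x1' x2' y1 y2 y3 y1' y2' = 0)
  <-> kernel_system x1 x2 x3 x1' x2'.
Proof.
split=> [H|[a1 a2 a3 [b1 b2]] y1 y2 y3 y1' y2'].
  have h1 := H 1 0 0 0 0; have h2 := H 0 1 0 0 0; have h3 := H 0 0 1 0 0.
  have h4 := H 0 0 0 1 0; have h5 := H 0 0 0 0 1.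
  by move: h1 h2 h3 h4 h5; rewrite /kernel_pairing => h1 h2 h3 h4 h5; split; [| | |split]; lra.
have -> : kernel_pairing x1 x2 x3 x1' x2' y1 y2 y3 y1' y2' =
   y1 * ((p - 2^-1 * P11) * x1' + (0 - 2^-1 * P12) * x2' - 2^-1 * (r12 * x2 + r13 * x3))
 + y2 * ((0 - 2^-1 * P21) * x1' + (p - 2^-1 * P22) * x2' - 2^-1 * (r23 * x3 - r12 * x1))
 + y3 * (2^-1 * (r13 * x1 + r23 * x2))
 + y1' * (D * x2' - ((p - 2^-1 * P11) * x1 + (0 - 2^-1 * P21) * x2))
 - y2' * (D * x1' + ((0 - 2^-1 * P12) * x1 + (p - 2^-1 * P22) * x2)).
  by rewrite /kernel_pairing; field.
by rewrite a1 a2 a3 b1 b2 !subrr addNr !mulr0 !addr0 subr0.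
Qed.

Hypotheses (D0 : D != 0) (S0 : S != 0).
Hypothesis rel : D * (S - 2^-1 * r12) =
  (p - 2^-1 * P11) * (p - 2^-1 * P22) - 4^-1 * (P12 * P21).

(** Multiplying the first two equations by [D] and inserting the last two, [M J M^T = det M J]
    leaves one unknown in each equation; by [rel], [det M = D (S - r12/2)], and the term with [r12]
    cancels. *)
Lemma kernel_system_unique x1 x2 x3 x1' x2' : kernel_system x1 x2 x3 x1' x2' ->
  x1 = x3 * (r23 / (2 * S)) /\ x2 = x3 * (- r13 / (2 * S)).
Proof.
move=> [a1 a2 _ [b1 b2]].
have e2 : D * (S * x2 + 2^-1 * (r13 * x3)) = 0.
  have : D * ((p - 2^-1 * P11) * x1' + (0 - 2^-1 * P12) * x2') = - (D * (S - 2^-1 * r12)) * x2.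
    transitivity ((p - 2^-1 * P11) * (D * x1') + (0 - 2^-1 * P12) * (D * x2')); first by ring.
    by rewrite b1 b2 rel; field.
  by rewrite a1 => e; lra.
have e1 : D * (S * x1 - 2^-1 * (r23 * x3)) = 0.
  have : D * ((0 - 2^-1 * P21) * x1' + (p - 2^-1 * P22) * x2') = (D * (S - 2^-1 * r12)) * x1.
    transitivity ((0 - 2^-1 * P21) * (D * x1') + (p - 2^-1 * P22) * (D * x2')); first by ring.
    by rewrite b1 b2 rel; field.
  by rewrite a2 => e; lra.
move/eqP: e1; rewrite mulf_eq0 (negPf D0) /= subr_eq0 => /eqP e1.
move/eqP: e2; rewrite mulf_eq0 (negPf D0) /= addr_eq0 => /eqP e2.
by split; apply: (mulfI S0); rewrite ?e1 ?e2; field.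
Qed.

Lemma kernel_system_solution c1' c2' :
  let c1 := r23 / (2 * S) in let c2 := - r13 / (2 * S) in
  D * c1' = - ((0 - 2^-1 * P12) * c1 + (p - 2^-1 * P22) * c2) ->
  D * c2' = (p - 2^-1 * P11) * c1 + (0 - 2^-1 * P21) * c2 ->
  kernel_system c1 c2 1 c1' c2'.
Proof.
move=> c1 c2 b1 b2; have S1 : S * c1 = 2^-1 * r23 by rewrite /c1; field.
have S2 : S * c2 = - (2^-1 * r13) by rewrite /c2; field.
split=> //.
- apply: (mulfI D0).
  transitivity ((p - 2^-1 * P11) * (D * c1') + (0 - 2^-1 * P12) * (D * c2')); first by ring.
  transitivity (- (D * (S - 2^-1 * r12)) * c2); first by rewrite b1 b2 rel; field.
  transitivity (- D * (S * c2) + 2^-1 * D * r12 * c2); first by ring.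
  by rewrite S2; field.
- apply: (mulfI D0).
  transitivity ((0 - 2^-1 * P21) * (D * c1') + (p - 2^-1 * P22) * (D * c2')); first by ring.
  transitivity ((D * (S - 2^-1 * r12)) * c1); first by rewrite b1 b2 rel; field.
  transitivity (D * (S * c1) - 2^-1 * D * r12 * c1); first by ring.
  by rewrite S1; field.
(* The pair [(c1, c2)] is proportional to [(r23, - r13)], so the third equation holds. *)
- by rewrite /c1 /c2; field.
Qed.

End KernelSystem.

Section KernelInFrame.
Context {R : realType}.
Local Notation TV := (TV R).
Local Notation FB := (FB R).
Variables (O : set 'rV[R]_3) (F : TV -> R).
Hypothesis HF : local_finsler O F.
Local Notation D := (slit O).
Variables p s : R.
Hypothesis s_neq0 : s != 0.
Implicit Types (z v w X Y : TV).
Variable q : FB.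
Hypotheses (aq : adapted O F q) (F1 : F q.1 = 1).
Hypothesis lift : forall v, exists B : 'M[R]_3, T_SO2_TM F q (v, B).

Let fq := adapted_frames aq.
Let r := spin_fmx F s (chernR F) q.
Let P := spin_fmx F s (chernP F) q.
Let Del := Delta F s q.1.
Let Sig := Sigma F p s q.1.

Lemma T_SM_coord v : T_SM F q.1 v <-> vert_coord F q v ix3 0 = 0.
Proof.
have [B tB] := lift v; have := covf3 HF aq F1 tB.
have -> : covf F q (v, B) = vert_coord F q v by [].
by rewrite /T_SM /= => ->.
Qed.

Lemma sigma_coord_explicit v w : T_SM F q.1 v -> T_SM F q.1 w ->
  let x := horiz_coord q v in let x' := vert_coord F q v in
  let y := horiz_coord q w in let y' := vert_coord F q w in
  sigma_coord F p s q.1 v w =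
    p * (x' ix1 0 * y ix1 0 - y' ix1 0 * x ix1 0 + x' ix2 0 * y ix2 0 - y' ix2 0 * x ix2 0)
    + 2^-1 * (r ix1 ix2 * (x ix1 0 * y ix2 0 - x ix2 0 * y ix1 0)
       + r ix1 ix3 * (x ix1 0 * y ix3 0 - x ix3 0 * y ix1 0)
       + r ix2 ix3 * (x ix2 0 * y ix3 0 - x ix3 0 * y ix2 0))
    + 2^-1 * (P ix1 ix1 * (x ix1 0 * y' ix1 0 - y ix1 0 * x' ix1 0)
       + P ix1 ix2 * (x ix1 0 * y' ix2 0 - y ix1 0 * x' ix2 0)
       + P ix2 ix1 * (x ix2 0 * y' ix1 0 - y ix2 0 * x' ix1 0)
       + P ix2 ix2 * (x ix2 0 * y' ix2 0 - y ix2 0 * x' ix2 0))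
    - Del * (x' ix1 0 * y' ix2 0 - x' ix2 0 * y' ix1 0).
Proof.
move=> /T_SM_coord v3 /T_SM_coord w3 x x' y y'; have [Dq uq] := fq.
rewrite (sigma_coord_frame HF p s v w aq F1) -/r -/P -/(horiz_coord q v) -/(horiz_coord q w).
rewrite -/(vert_coord F q v) -/(vert_coord F q w) -/x -/x' -/y -/y'.
rewrite /Del (Delta_frame HF s_neq0 aq F1).
have P3 b : P ix3 b = 0 by exact: (spin_fmx_chernP_row3 HF s b aq F1).
have rs a b : r b a = - r a b by exact: spin_fmx_chernR_skew.
have Qs a b := spin_fmx_cartanQ_skew HF s a b Dq.
have dot (a b : 'cV[R]_3) : (a^T *m b) 0 0 = a ix1 0 * b ix1 0 + a ix2 0 * b ix2 0 + a ix3 0 * b ix3 0.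
  by rewrite mxE sum3 ![a^T _ _]mxE.
rewrite /spin_pairing !bilinear_mxE !dot !sum3.
rewrite -/x' in v3; rewrite -/y' in w3; rewrite v3 w3 !P3.
rewrite (rs ix1 ix2) (rs ix1 ix3) (rs ix2 ix3) (Qs ix1 ix2) (Qs ix1 ix3) (Qs ix2 ix3).
have r0 a : r a a = 0 by have := rs a a; lra.
have Q0 a : spin_fmx F s (cartanQ F) q a a = 0.
  by have := Qs a a; move: (spin_fmx _ _ _ _ _ _) => t ?; lra.
rewrite !r0 !Q0.
have J0 a b : Jmx s a b = spin_frame s a b by rewrite mxE.
rewrite !J0 /spin_frame !kron_values.
move: (spin_fmx F s (cartanQ F) q) r P x x' y y' {v3 w3 P3 rs Qs r0 Q0 J0 dot} => C r' P' x x' y y'.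
by field.
Qed.

(** In the frame the spin tensor is [s] times a quarter turn in the plane of e_1, e_2 and kills e_3;
    the powers of [s] in [char_hor] and [char_ver] cancel against it. *)
Lemma char_coord : Del != 0 -> Sig != 0 ->
  let c := horiz_coord q (char_vec F p s q.1) in
  let c' := vert_coord F q (char_vec F p s q.1) in
  [/\ c ix1 0 = r ix2 ix3 / (2 * Sig), c ix2 0 = - r ix1 ix3 / (2 * Sig), c ix3 0 = 1 &
  [/\ Del * c' ix1 0 = - ((0 - 2^-1 * P ix1 ix2) * c ix1 0 + (p - 2^-1 * P ix2 ix2) * c ix2 0),
    Del * c' ix2 0 = (p - 2^-1 * P ix1 ix1) * c ix1 0 + (0 - 2^-1 * P ix2 ix1) * c ix2 0 &
    c' ix3 0 = 0]].
Proof.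
move=> D0 S0 c c'; have [Dq uq] := fq.
have [e1 e2] := char_vec_coord p s aq F1.
have rs a b : r b a = - r a b by exact: spin_fmx_chernR_skew.
have r0 a : r a a = 0 by have := rs a a; lra.
pose w : 'cV[R]_3 := (Jmx s)^T *m r^T *m delta_mx ix3 0.
have rE a : (r^T *m (delta_mx ix3 0 : 'cV[R]_3)) a 0 = r ix3 a by rewrite -colE !mxE.
have JE (b : 'cV[R]_3) : [/\ ((Jmx s)^T *m b) ix1 0 = - s * b ix2 0,
   ((Jmx s)^T *m b) ix2 0 = s * b ix1 0 & ((Jmx s)^T *m b) ix3 0 = 0].
  by split; rewrite mxE sum3 !mxE /spin_frame !kron_values; ring.
have [w1 w2 w3] : [/\ w ix1 0 = s * r ix2 ix3, w ix2 0 = - s * r ix1 ix3 & w ix3 0 = 0].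
  rewrite /w -mulmxA; have [-> -> ->] := JE (r^T *m delta_mx ix3 0).
  by rewrite !rE (rs ix2 ix3) (rs ix1 ix3); split=> //; ring.
have cE : c = delta_mx ix3 0 + (2 * s * Sig)^-1 *: w.
  by rewrite /c /horiz_coord e1 (char_hor_frame HF p s aq F1) mulKmx.
have c'E : c' = (2 * s ^+ 2 * Del * Sig)^-1 *: ((Jmx s)^T *m (p%:M - 2^-1 *: P^T) *m w).
  by rewrite /c' /vert_coord e2 (char_ver_frame HF p s aq F1) mulKmx // /w !mulmxA.
have c1 : c ix1 0 = r ix2 ix3 / (2 * Sig).
  by rewrite cE [LHS]mxE [X in X + _]mxE [X in _ + X]mxE w1 /=; field; rewrite s_neq0 S0.
have c2 : c ix2 0 = - r ix1 ix3 / (2 * Sig).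
  by rewrite cE [LHS]mxE [X in X + _]mxE [X in _ + X]mxE w2 /=; field; rewrite s_neq0 S0.
have c3 : c ix3 0 = 1.
  by rewrite cE [LHS]mxE [X in X + _]mxE [X in _ + X]mxE w3 /= mulr0 addr0.
have ME a : ((p%:M - 2^-1 *: P^T) *m w) a 0 =
   (p * kron R a ix1 - 2^-1 * P ix1 a) * w ix1 0 + (p * kron R a ix2 - 2^-1 * P ix2 a) * w ix2 0.
  rewrite mxE sum3 w3 mulr0 addr0.
  have ME' (A : 'M[R]_3) b : (p%:M - 2^-1 *: A^T) a b = p * kron R a b - 2^-1 * A b a.
    by rewrite !mxE /kron mulr_natr.
  by rewrite !ME'.
have c'k a : c' a 0 = (2 * s ^+ 2 * Del * Sig)^-1 * ((Jmx s)^T *m ((p%:M - 2^-1 *: P^T) *m w)) a 0.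
  by rewrite c'E [LHS]mxE mulmxA.
have [J1 J2 J3] := JE ((p%:M - 2^-1 *: P^T) *m w).
split=> //; split.
- rewrite c'k J1 ME w1 w2 !kron_values c1 c2; field.
  by rewrite s_neq0 S0 D0.
- rewrite c'k J2 ME w1 w2 !kron_values c1 c2; field.
  by rewrite s_neq0 S0 D0.
- by rewrite c'k J3 mulr0.
Qed.

Lemma Sigma_relation : Del != 0 -> Del * (Sig - 2^-1 * r ix1 ix2) =
  (p - 2^-1 * P ix1 ix1) * (p - 2^-1 * P ix2 ix2) - 4^-1 * (P ix1 ix2 * P ix2 ix1).
Proof.
move=> D0; rewrite /Sig (Sigma_frame HF p s_neq0 aq F1) -/r -/P -/Del addrK mulrA mulfV //.
by move: (P _ _) (P _ _) (P _ _) (P _ _) => a b c d; field.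
Qed.

(* In a frame the kernel is given by a two by two linear system whose
   determinant is Del * Sig. *)
Lemma kernel_sigma_coord X : Del != 0 -> Sig != 0 -> T_SM F q.1 X ->
  (forall Y, T_SM F q.1 Y -> sigma_coord F p s q.1 X Y = 0) <->
  exists t : R, X = t *: char_vec F p s q.1.
Proof.
move=> D0 S0 tX; have [c1 c2 c3 [d1 d2 d3]] := char_coord D0 S0.
have rel := Sigma_relation D0.
move: c1 c2 c3 d1 d2 d3; set c := horiz_coord q _; set c' := vert_coord F q _ => c1 c2 c3 d1 d2 d3.
pose sys := kernel_system p (r ix1 ix2) (r ix1 ix3) (r ix2 ix3)
  (P ix1 ix1) (P ix1 ix2) (P ix2 ix1) (P ix2 ix2) Del.
have csys : sys (c ix1 0) (c ix2 0) 1 (c' ix1 0) (c' ix2 0).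
  by rewrite c1 c2; apply: (kernel_system_solution D0 S0 rel); rewrite -c1 -c2.
have EZ t (a : 'cV[R]_3) i : (t *: a) i 0 = t * a i 0 by rewrite mxE.
split; last first.
  case=> t Xt Y tY; rewrite (sigma_coord_explicit tX tY).
  have [hX vX] := coordZ F q t (char_vec F p s q.1).
  rewrite -Xt -/c in hX; rewrite -Xt -/c' in vX.
  rewrite hX vX !EZ.
  have /kernel_pairing_system H : sys (t * c ix1 0) (t * c ix2 0) (t * c ix3 0) (t * c' ix1 0) (t * c' ix2 0).
    have [a1 a2 a3 [b1 b2]] := csys; rewrite c3.
    split; [| | |split].
    - by rewrite !(mulrCA _ t) -mulrDr a1; ring.
    - by rewrite !(mulrCA _ t) -mulrDr a2; ring.
    - by rewrite !(mulrCA _ t) -mulrDr a3 mulr0.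
    - by rewrite !(mulrCA _ t) b1; ring.
    - by rewrite !(mulrCA _ t) b2; ring.
  exact: H.
move=> ker.
pose x := horiz_coord q X; pose x' := vert_coord F q X.
have x3 : x' ix3 0 = 0 by apply/T_SM_coord.
exists (x ix3 0).
have xsys : sys (x ix1 0) (x ix2 0) (x ix3 0) (x' ix1 0) (x' ix2 0).
  apply/kernel_pairing_system => y1 y2 y3 y1' y2'.
  pose y : 'cV[R]_3 := \col_i (y1 * kron R i ix1 + y2 * kron R i ix2 + y3 * kron R i ix3).
  pose y' : 'cV[R]_3 := \col_i (y1' * kron R i ix1 + y2' * kron R i ix2).
  have [hY vY] := of_coordK y y' fq F1.
  have tY : T_SM F q.1 (of_coord F q y y').
    by apply/T_SM_coord; rewrite vY mxE !kron_values; ring.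
  have := ker _ tY; rewrite (sigma_coord_explicit tX tY) hY vY -/x -/x'.
  have -> : y ix1 0 = y1 by rewrite mxE !kron_values; ring.
  have -> : y ix2 0 = y2 by rewrite mxE !kron_values; ring.
  have -> : y ix3 0 = y3 by rewrite mxE !kron_values; ring.
  have -> : y' ix1 0 = y1' by rewrite mxE !kron_values; ring.
  have -> // : y' ix2 0 = y2' by rewrite mxE !kron_values; ring.
have [x1 x2] := kernel_system_unique D0 S0 rel xsys.
have [hX vX] := coordZ F q (x ix3 0) (char_vec F p s q.1).
have xE : x = x ix3 0 *: c.
  apply/matrixP => i j; rewrite (ord1 j) EZ.
  have [->|->|->] := ord3_cases i; [by rewrite c1|by rewrite c2|by rewrite c3 mulr1].
apply: (coord_inj fq F1); rewrite ?hX ?vX; first exact: xE.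
apply/matrixP => i j; rewrite (ord1 j) EZ -/x' -/c'.
have [_ _ _ [xb1 xb2]] := xsys; have [_ _ _ [b1 b2]] := csys.
have [->|->|->] := ord3_cases i; last by rewrite x3 d3 mulr0.
- apply: (mulfI D0); rewrite mulrCA b1 xb1 xE !EZ.
  by rewrite c3; ring.
- apply: (mulfI D0); rewrite mulrCA b2 xb2 xE !EZ.
  by rewrite c3; ring.
Qed.

End KernelInFrame.

(** * Closedness and rank *)

Section Pullback.
Context {R : realType}.
Local Notation TV := (TV R).
Local Notation FB := (FB R).
Implicit Types (z v w : TV) (q V W : FB) (f : FB -> R).
Variables (S : set FB) (oS : open S) (U : set TV) (oU : open U) (e : TV -> 'M[R]_3).
Hypothesis se : msmooth U e.
Hypothesis US : forall z, U z -> S (z, e z).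

Lemma FB_basis V : V = ((V.1, 0) : FB) + \sum_i \sum_j V.2 i j *: ((0, delta_mx i j) : FB).
Proof.
have fstE (f : 'I_3 -> FB) : (\sum_i f i).1 = \sum_i (f i).1 by rewrite !sum3.
have sndE (f : 'I_3 -> FB) : (\sum_i f i).2 = \sum_i (f i).2 by rewrite !sum3.
case: V => v B; apply/pair_equal_spec; split=> /=.
  rewrite fstE big1 ?addr0 // => i _; rewrite fstE big1 // => j _ /=.
  by rewrite scaler0.
rewrite sndE add0r [LHS]matrix_sum_delta; apply: eq_bigr => i _.
by rewrite sndE; apply: eq_bigr.
Qed.

Lemma derive_FB_basis f q V : differentiable f q ->
  'D_V f q = 'D_((V.1, 0) : FB) f q + \sum_i \sum_j V.2 i j * 'D_((0, delta_mx i j) : FB) f q.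
Proof.
move=> df; rewrite deriveE // [in LHS](FB_basis V) linearD linear_sum /= deriveE //.
congr (_ + _); apply: eq_bigr => i _; rewrite linear_sum; apply: eq_bigr => j _.
by rewrite linearZ /= deriveE.
Qed.

(** Expanded in fixed directions, so that derivatives of [f] on [S] are again evaluated along the
    section and the induction on the order of smoothness goes through. *)
Lemma derive_along_section f z v : smooth_on S f -> U z ->
  'D_v (fun y => f (y, e y)) z = 'D_((v, 0) : FB) f (z, e z)
   + \sum_i \sum_j 'D_v (fun y => e y i j) z * 'D_((0, delta_mx i j) : FB) f (z, e z).
Proof.
move=> sf Uz; have df := smooth_differentiable sf (US Uz).
rewrite (derive_section v se Uz df) (derive_FB_basis _ df) /=.
by congr (_ + _); apply: eq_bigr => i _; apply: eq_bigr => j _; rewrite mxE.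
Qed.

Lemma smooth_along_section f : smooth_on S f -> smooth_on U (fun y => f (y, e y)).
Proof.
move=> sf k; elim: k f sf => [|k IH] f sf.
  move=> z Uz; apply: differentiable_continuous.
  have df := smooth_differentiable sf (US Uz).
  apply: (@differentiable_comp _ _ _ _ (fun y : TV => (y, e y) : FB) f) df.
  apply: differentiable_pair; first exact: ex_diff.
  exact: msmooth_differentiable se Uz.
split=> [z Uz|v].
  have df := smooth_differentiable sf (US Uz).
  apply: (@differentiable_comp _ _ _ _ (fun y : TV => (y, e y) : FB) f) df.
  apply: differentiable_pair; first exact: ex_diff.
  exact: msmooth_differentiable se Uz.
apply: (@Ck_ext _ _ k U (fun z => 'D_((v, 0) : FB) f (z, e z)
   + \sum_i \sum_j 'D_v (fun y => e y i j) z * 'D_((0, delta_mx i j) : FB) f (z, e z))) => //.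
  by move=> z Uz; rewrite derive_along_section.
apply: CkD => //; first exact: (IH _ (smooth_derive _ sf)).
have CkS3 (h : 'I_3 -> TV -> R) : (forall i, Ck k U (h i)) -> Ck k U (fun z => \sum_i h i z).
  move=> ch; apply: (@Ck_ext _ _ k U (fun z => h ix1 z + h ix2 z + h ix3 z)) => //.
    by move=> z _; rewrite sum3.
  by apply: CkD => //; apply: CkD.
apply: (CkS3 _) => i; apply: (CkS3 _) => j; apply: CkM => //.
  exact: (smooth_derive v (se i j) k).
exact: (IH _ (smooth_derive _ sf)).
Qed.

Variable al : one_form (V := FB).
Hypothesis sal : forall V, smooth_on S (al ^~ V).
Hypothesis lal : forall q, S q -> scalar (al q).

Definition pullback : one_form (V := TV) := fun z v => al (z, e z) (v, Dm v e z).

Lemma form_basis q V : S q -> al q V = al q (V.1, 0) + \sum_i \sum_j V.2 i j * al q (0, delta_mx i j).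
Proof.
move=> Sq; have l := lal Sq.
have lD x y : al q (x + y) = al q x + al q y by have := l 1 x y; rewrite !scale1r mul1r.
have l0 : al q 0 = 0 by have := l 1 0 0; rewrite scaler0 addr0 mul1r => /eqP; rewrite -subr_eq subrr eq_sym => /eqP.
have lZ a x : al q (a *: x) = a * al q x by have := l a x 0; rewrite l0 !addr0.
have lS (h : 'I_3 -> FB) : al q (\sum_i h i) = \sum_i al q (h i) by rewrite !sum3 !lD.
rewrite {1}(FB_basis V) lD lS; congr (_ + _); apply: eq_bigr => i _.
by rewrite lS; apply: eq_bigr => j _; rewrite lZ.
Qed.

Lemma pullback_basis z v : U z -> pullback z v =
  al (z, e z) (v, 0) + \sum_i \sum_j 'D_v (fun y => e y i j) z * al (z, e z) (0, delta_mx i j).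
Proof.
move=> Uz; rewrite /pullback (form_basis _ (US Uz)) /=.
by congr (_ + _); apply: eq_bigr => i _; apply: eq_bigr => j _; rewrite mxE.
Qed.

Lemma smooth_pullback v : smooth_on U (pullback ^~ v).
Proof.
apply: (smooth_ext oU (f := fun z => al (z, e z) (v, 0)
   + \sum_i \sum_j 'D_v (fun y => e y i j) z * al (z, e z) (0, delta_mx i j))).
  by move=> z Uz; rewrite pullback_basis.
apply: smoothD => //; first exact: (smooth_along_section (sal _)).
apply: smooth_sum => // i; apply: smooth_sum => // j; apply: smoothM => //.
  exact: (smooth_derive v (se i j)).
exact: (smooth_along_section (sal _)).
Qed.

Lemma pullback_scalar z : U z -> scalar (pullback z).
Proof.
move=> Uz a v w; rewrite /pullback -(lal (US Uz)).
have -> : Dm (a *: v + w) e z = a *: Dm v e z + Dm w e z.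
  apply/matrixP => i j; rewrite !mxE.
  have de := smooth_differentiable (se i j) Uz.
  by rewrite !(deriveE _ de) linearP.
by [].
Qed.

(** The argument [Dm w e] also varies and contributes a second derivative of [e]. That term is
    symmetric in [v] and [w] and cancels in [d1_pullback]. *)
Lemma derive_pullback z v w : U z -> 'D_v (pullback ^~ w) z =
  'D_((v, Dm v e z) : FB) (al ^~ (w, Dm w e z)) (z, e z)
   + al (z, e z) (0, Dm v (Dm w e) z).
Proof.
move=> Uz; have Sz := US Uz.
have sD i j := smooth_derive w (se i j).
have sa V := smooth_along_section (sal V).
have sp i j := smoothM oU (sD i j) (sa (0, delta_mx i j)).
have sp1 i := smooth_sum (index_enum 'I_3) xpredT oU (sp i).
have sp2 := smooth_sum (index_enum 'I_3) xpredT oU sp1.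
rewrite (derive_congr v oU Uz (fun y Uy => pullback_basis w Uy)).
rewrite (sderiveD v (sa (w, 0)) sp2 Uz) (sderive_sum v sp1 Uz).
under eq_bigr do rewrite (sderive_sum v (sp _) Uz).
under eq_bigr do under eq_bigr do rewrite (sderiveM v (sD _ _) (sa _) Uz).
have dal V : 'D_v (fun y => al (y, e y) V) z = 'D_((v, Dm v e z) : FB) (al ^~ V) (z, e z).
  exact: derive_section (smooth_differentiable (sal V) Sz).
rewrite dal; under eq_bigr do under eq_bigr do rewrite dal.
have -> : 'D_((v, Dm v e z) : FB) (al ^~ (w, Dm w e z)) (z, e z) =
   'D_((v, Dm v e z) : FB) (al ^~ (w, 0)) (z, e z)
   + \sum_i \sum_j 'D_w (fun y => e y i j) z * 'D_((v, Dm v e z) : FB) (al ^~ (0, delta_mx i j)) (z, e z).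
  set X := ((v, Dm v e z) : FB).
  have sq i j := smoothM oS (smooth_cst ('D_w (fun y => e y i j) z) oS) (sal (0, delta_mx i j)).
  have sq1 i := smooth_sum (index_enum 'I_3) xpredT oS (sq i).
  have sq2 := smooth_sum (index_enum 'I_3) xpredT oS sq1.
  have E q : S q -> al q (w, Dm w e z) = al q (w, 0)
     + \sum_i \sum_j 'D_w (fun y => e y i j) z * al q (0, delta_mx i j).
    move=> Sq; rewrite (form_basis _ Sq) /=; congr (_ + _).
    by apply: eq_bigr => i _; apply: eq_bigr => j _; rewrite mxE.
  rewrite (derive_congr X oS Sz E) (sderiveD X (sal (w, 0)) sq2 Sz) (sderive_sum X sq1 Sz).
  congr (_ + _); apply: eq_bigr => i _; rewrite (sderive_sum X (sq i) Sz).
  by apply: eq_bigr => j _; rewrite (sderiveZ _ X (sal _) Sz).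
rewrite -addrA; congr (_ + _).
rewrite (form_basis _ Sz) /=.
have -> : al (z, e z) ((0, 0) : FB) = 0.
  have := lal Sz 1 0 0; rewrite scaler0 addr0 mul1r => /eqP.
  by rewrite -subr_eq subrr eq_sym => /eqP.
rewrite add0r -big_split; apply: eq_bigr => i _ /=.
rewrite -big_split; apply: eq_bigr => j _ /=.
congr (_ + _ * _); rewrite mxE; congr (derive _ z v).
by apply/funext => y; rewrite mxE.
Qed.

Lemma d1_pullback z v w : U z -> d1 pullback z v w =
  d1 al (z, e z) (v, Dm v e z) (w, Dm w e z).
Proof.
move=> Uz; rewrite /d1 (derive_pullback v w Uz) (derive_pullback w v Uz).
rewrite (Dm_comm oU v w se Uz).
have sub2r (a b t : R) : a + t - (b + t) = a - b by ring.
exact: sub2r.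
Qed.

End Pullback.

Section ExactForms.
Context {R : realType} {V : normedModType R}.
Variables (U : set V) (oU : open U) (b : one_form (V := V)).
Hypothesis sb : forall v, smooth_on U (b ^~ v).

Lemma smooth_d1 : (forall z, U z -> scalar (b z)) -> smooth_two_form U (d1 b).
Proof.
move=> lb; split=> [z v Uz a w w'|z v w _|v w].
- rewrite /d1.
  have -> : 'D_v (b ^~ (a *: w + w')) z = a * 'D_v (b ^~ w) z + 'D_v (b ^~ w') z.
    have E y : U y -> b y (a *: w + w') = a * b y w + b y w' by move=> Uy; rewrite (lb _ Uy).
    rewrite (derive_congr v oU Uz E).
    rewrite (sderiveD v (smoothM oU (smooth_cst a oU) (sb w)) (sb w') Uz).
    by rewrite (sderiveZ a v (sb w) Uz).
  have df := smooth_differentiable (sb v) Uz.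
  have -> : 'D_(a *: w + w') (b ^~ v) z = a * 'D_w (b ^~ v) z + 'D_w' (b ^~ v) z.
    by rewrite !(deriveE _ df) linearP.
  move: ('D_v _ z) ('D_v _ z) ('D_w _ z) ('D_w' _ z) => c d e f.
  ring.
- by rewrite /d1 opprB.
- by apply: smoothB => //; apply: smooth_derive; exact: sb.
Qed.

Lemma d2_d1 z u v w : U z -> d2 (d1 b) z u v w = 0.
Proof.
move=> Uz; have sd x y := smooth_derive x (sb y).
rewrite /d2 /d1 (sderiveB u (sd v w) (sd w v) Uz) (sderiveB v (sd u w) (sd w u) Uz).
rewrite (sderiveB w (sd u v) (sd v u) Uz).
rewrite (derive_comm u v oU Uz (sb w)) (derive_comm u w oU Uz (sb v)).
rewrite (derive_comm v w oU Uz (sb u)).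
move: ('D_v _ z) ('D_w _ z) ('D_w _ z) => x y t; ring.
Qed.

End ExactForms.

(** Rows annihilated by the matrix are the coordinates of the vectors of the span that pair to zero
    with it, hence the multiples of the coordinate row of [k]. *)
Lemma rank_bilinear_form (K : fieldType) (vT : vectType K) n (b : n.-tuple vT)
    (B : vT -> vT -> K) (k : vT) : free b -> k \in <<b>>%VS -> k != 0 ->
    (forall a v v' w, B (a *: v + v') w = a * B v w + B v' w) ->
    (forall a v w w', B v (a *: w + w') = a * B v w + B v w') ->
    (forall v, v \in <<b>>%VS -> (forall w, w \in <<b>>%VS -> B v w = 0) <-> exists t, v = t *: k) ->
  \rank (\matrix_(i < n, j < n) B (tnth b i) (tnth b j)) = n.-1.
Proof.
move=> fb kb k0 Bl Br kerB; set A := \matrix_(_, _) _.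
have B0l w : B 0 w = 0.
  have := Bl 1 0 0 w; rewrite scaler0 addr0 mul1r => /eqP.
  by rewrite -subr_eq subrr eq_sym => /eqP.
have B0r v : B v 0 = 0.
  have := Br 1 v 0 0; rewrite scaler0 addr0 mul1r => /eqP.
  by rewrite -subr_eq subrr eq_sym => /eqP.
have Bsl c w : B (\sum_i c i *: tnth b i) w = \sum_i c i * B (tnth b i) w.
  by apply: (big_ind2 (fun v x => B v w = x)) => [|v x v' x' <- <-|i _] //;
    [rewrite -[v]scale1r Bl mul1r scale1r|rewrite -[_ *: _]addr0 Bl B0l addr0].
have Bsr c v : B v (\sum_i c i *: tnth b i) = \sum_i c i * B v (tnth b i).
  by apply: (big_ind2 (fun w x => B v w = x)) => [|w x w' x' <- <-|i _] //;
    [rewrite -[w]scale1r Br mul1r scale1r|rewrite -[_ *: _]addr0 Br B0r addr0].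
have span v : v \in <<b>>%VS -> v = \sum_i coord b i v *: tnth b i.
  by move=> vb; rewrite [LHS](coord_span vb); apply: eq_bigr => i _; rewrite (tnth_nth 0).
have in_span c : \sum_i c i *: tnth b i \in <<b>>%VS.
  by apply: memv_suml => i _; apply: memvZ; apply: memv_span; apply: mem_tnth.
pose comb (w : 'rV[K]_n) := \sum_i w 0 i *: tnth b i.
pose wk : 'rV[K]_n := \row_i coord b i k.
have combk : comb wk = k by rewrite [RHS](span _ kb); apply: eq_bigr => i _; rewrite mxE.
have combK w : \row_i coord b i (comb w) = w.
  apply/rowP => i; rewrite mxE; transitivity (coord b i (\sum_j w 0 j *: b`_j)).
    by congr (coord b i _); apply: eq_bigr => j _; rewrite (tnth_nth 0).
  exact: coord_sum_free.
have kerA (w : 'rV[K]_n) : w *m A = 0 <-> exists t, comb w = t *: k.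
  rewrite -(kerB _ (in_span _)); split=> [wA v vb|H].
    rewrite (span v vb) Bsr big1 // => j _; rewrite Bsl.
    have := congr1 (fun u : 'rV[K]_n => u 0 j) wA; rewrite !mxE => e.
    rewrite (_ : \sum_i _ = 0) ?mulr0 // -[RHS]e; apply: eq_bigr => i _.
    by rewrite [A i j]mxE.
  apply/rowP => j; rewrite !mxE -[RHS](H (tnth b j)); last by apply: memv_span; apply: mem_tnth.
  by rewrite Bsl; apply: eq_bigr => i _; rewrite [A i j]mxE.
have wk0 : wk != 0.
  apply: contraNneq k0 => e; rewrite -combk /comb big1 // => i _.
  by rewrite e mxE scale0r.
have ekA : \rank (kermx A) = 1%N.
  apply/eqP; rewrite -(_ : \rank wk = 1%N); last by rewrite rank_rV wk0.
  apply/eqP/eqmx_rank/andP; split; last first.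
    by apply/sub_kermxP/kerA; exists 1; rewrite combk scale1r.
  apply/row_subP => i; have /kerA [t e] : row i (kermx A) *m A = 0.
    by rewrite -row_mul mulmx_ker row0.
  rewrite -(combK (row i _)) e; apply/sub_rVP; exists t.
  by apply/rowP => j; rewrite !mxE linearZ.
have := mxrank_ker A; rewrite ekA => e.
by have := rank_leq_row A; move: (\rank A) e => m e lm; rewrite -subn1 e subKn.
Qed.

(** * The potential, uniqueness of the descended form, and its kernel *)

Section Potential.
Context {R : realType}.
Local Notation TV := (TV R).
Local Notation FB := (FB R).
Variables (O : set 'rV[R]_3) (F : TV -> R).
Hypothesis HF : local_finsler O F.
Local Notation D := (slit O).
Variables p s : R.
Implicit Types (z v w : TV) (q V W : FB).
Let oU := open_frames HF.

Lemma potentialE q V : frames O q ->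
  potential F p s q V = p * cof q V ix3 0 + s * kh F q V ix2 ix1.
Proof. by move=> fq; rewrite /potential coframeE (cartan_formE HF). Qed.

Lemma smooth_potential V : smooth_on (frames O) (potential F p s ^~ V).
Proof.
apply: (smooth_ext oU (f := fun q => p * cof q V ix3 0 + s * kh F q V ix2 ix1)).
  by move=> q fq; rewrite potentialE.
apply: smoothD => //.
  exact: (smoothM oU (smooth_cst p oU) (msmooth_cof HF V ix3 0)).
exact: (smoothM oU (smooth_cst s oU) (msmooth_kh HF V ix2 ix1)).
Qed.

Lemma gamP z a v w : gam F z (a *: v + w) = a *: gam F z v + gam F z w.
Proof.
apply/matrixP => i j; rewrite !mxE mulr_sumr -big_split; apply: eq_bigr => k _ /=.
by rewrite !mxE mulrDr mulrCA.
Qed.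

Lemma cartan_mxP z a v w :
  cartan_mx F z (a *: v + w) = a *: cartan_mx F z v + cartan_mx F z w.
Proof.
apply/matrixP => i j; rewrite mxE [RHS]mxE [X in _ = X + _]mxE.
rewrite [cartan_mx F z v i j]mxE [cartan_mx F z w i j]mxE mulr_sumr -big_split.
apply: eq_bigr => k _ /=; rewrite vformD vformZ [X in _ * X]mxE [X in _ * (X + _)]mxE.
by rewrite mulrDr mulrCA.
Qed.

Lemma khP q a V W : kh F q (a *: V + W) = a *: kh F q V + kh F q W.
Proof.
have oP : om F q (a *: V + W) = a *: om F q V + om F q W.
  rewrite /om /= gamP mulmxDl -scalemxAl addrACA -scalerDr mulmxDr.
  by rewrite -scalemxAr.
have cP : cartan_fmx F q (a *: V + W) = a *: cartan_fmx F q V + cartan_fmx F q W.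
  by rewrite /cartan_fmx /= cartan_mxP mulmxDr mulmxDl -scalemxAr -scalemxAl.
by rewrite /kh oP cP scalerDr addrACA.
Qed.

Lemma potential_scalar q : frames O q -> scalar (potential F p s q).
Proof.
move=> fq a V W; rewrite !potentialE // khP /cof linearP /= mulmxDr -scalemxAr.
by rewrite !mxE; ring.
Qed.

(** Homogeneity with factor 2 forces [F (x, 0) = 0], so the zero section does not meet SM. *)
Lemma SM_slit z : SM F O z -> D z.
Proof.
move=> [Oz F1]; split=> //; apply/eqP => y0.
have := lf_homogeneous HF 0 Oz (ltr0Sn R 1); rewrite scaler0 -y0 -surjective_pairing F1.
by rewrite mulr1 => ?; lra.
Qed.

Lemma SM_adapted q : SO2_SM F O q -> adapted O F q.
Proof. by move=> [Sq /SM_slit Dq]. Qed.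


(* In a local adapted frame, sigma is the exterior derivative of the pull-back
   of the potential. *)
Lemma local_primitive z0 : SM F O z0 -> exists U b,
  [/\ open U, U z0, smooth_two_form U b,
      forall z u v w, U z -> d2 b z u v w = 0 &
      forall z v w, U z -> SM F O z -> T_SM F z v -> T_SM F z w ->
        b z v w = sigma_coord F p s z v w].
Proof.
move=> S0; have [U [e [oU1 Uz0 sUD se ae]]] := exists_local_frame HF (SM_slit S0).
have US z : U z -> frames O (z, e z) by move=> /ae/adapted_frames.
have sb v := smooth_pullback oU1 se US smooth_potential potential_scalar v.
have lb := pullback_scalar se US potential_scalar.
exists U, (d1 (pullback e (potential F p s))); split=> //.
- exact: (smooth_d1 oU1 sb lb).
- by move=> z u v w Uz; exact: (d2_d1 oU1 sb u v w Uz).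
move=> z v w Uz [_ F1] tv tw.
rewrite (d1_pullback oU oU1 se US smooth_potential potential_scalar v w Uz).
have tX x := section_tangent HF x oU1 se Uz ae.
rewrite -(sigma_potential HF p s (ae z Uz) F1 (tX v) (tX w) tv tw).
exact: (sigma_frameE HF p s (ae z Uz) F1 (tX v) (tX w) tv tw).
Qed.

Lemma descends_sigma_coord : descends F O (sigma_frame F p s) (sigma_coord F p s).
Proof.
move=> q V W Sq [tV sV] [tW sW]; have aq := SM_adapted Sq; have [_ [_ F1]] := Sq.
by rewrite (sigma_frameE HF p s aq F1 tV tW sV sW).
Qed.

(** [descends] constrains sigma through lifts only; since tangent vectors of SM lift, its values on
    them are determined. *)
Lemma descends_unique sigma z v w : descends F O (sigma_frame F p s) sigma ->
  SM F O z -> T_SM F z v -> T_SM F z w -> sigma z v w = sigma_coord F p s z v w.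
Proof.
move=> ds Sz tv tw; have [E [aE lift]] := exists_adapted_lift HF (SM_slit Sz).
have [[B tB] [C tC]] := (lift v, lift w).
have SE : SO2_SM F O (z, E) by case: aE.
rewrite (ds (z, E) (v, B) (w, C) SE) //.
by rewrite -(descends_sigma_coord (q := (z, E)) (V := (v, B)) (W := (w, C)) SE).
Qed.

Lemma descends_potential sigma : descends F O (sigma_frame F p s) sigma ->
  descends F O (d1 (potential F p s)) sigma.
Proof.
move=> ds q V W Sq TV TW; rewrite (ds q V W Sq TV TW).
have [tV sV] := TV; have [tW sW] := TW; have [_ [_ F1]] := Sq.
exact: (sigma_potential HF p s (SM_adapted Sq) F1 tV tW sV sW).
Qed.

Lemma closed_sigma S sigma : S `<=` SM F O ->
  descends F O (sigma_frame F p s) sigma -> closed_two_form_on S (T_SM F) sigma.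
Proof.
move=> sS ds z0 /sS S0; have [U [b [oU1 Uz0 sb db eb]]] := local_primitive S0.
exists U, b; split=> //; last by move=> z u v w Uz *; exact: db.
split=> // z v w Uz Sz tv tw; have SMz := sS z Sz.
by rewrite (eb z v w Uz SMz tv tw) (descends_unique ds SMz tv tw).
Qed.

Lemma two_form_sigma S sigma : S `<=` SM F O ->
  descends F O (sigma_frame F p s) sigma -> two_form_on S (T_SM F) sigma.
Proof.
move=> sS ds z Sz; have [U [b [Uz e _]]] := closed_sigma sS ds Sz.
by exists U, b.
Qed.

Hypothesis s_neq0 : s != 0.

Lemma kernel_sigma sigma z X : descends F O (sigma_frame F p s) sigma ->
  SM_reg F p s O z -> T_SM F z X ->
  (ker_form (T_SM F) sigma z X <-> exists X3 : R, X = X3 *: char_vec F p s z).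
Proof.
move=> ds [Sz D0 S0] tX; have [_ F1] := Sz.
have [E [aE lift]] := exists_adapted_lift HF (SM_slit Sz).
rewrite -(kernel_sigma_coord (q := (z, E)) HF s_neq0 aE F1 lift D0 S0 tX).
split=> [[_ H] Y tY|H]; first by rewrite -(descends_unique ds Sz tX tY) H.
by split=> // Y tY; rewrite (descends_unique ds Sz tX tY) H.
Qed.

Lemma char_vec_tangent z : SM_reg F p s O z ->
  T_SM F z (char_vec F p s z) /\ char_vec F p s z != 0.
Proof.
move=> [Sz D0 S0]; have [_ F1] := Sz.
have [E [aE lift]] := exists_adapted_lift HF (SM_slit Sz).
have [_ _ c3 [_ _ c3']] := char_coord (q := (z, E)) HF s_neq0 aE F1 D0 S0.
split; first by apply/(T_SM_coord HF aE F1 lift).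
apply: contra_eq_neq c3 => ->.
by rewrite /horiz_coord linear0 mulmx0 mxE eq_sym oner_eq0.
Qed.

(** By Euler's relation [dF] takes the value [F = 1] on the radial vertical vector, so its kernel is
    a hyperplane in dimension six. *)
Lemma dim_T_SM z : SM F O z -> exists U : {vspace TV},
  \dim U = 5%N /\ forall X, T_SM F z X <-> X \in U.
Proof.
move=> Sz; have Dz := SM_slit Sz; have [_ F1] := Sz.
have df := smooth_differentiable (lf_smooth HF) Dz.
pose f := linfun ('d F z : TV -> R^o).
have fE X : f X = 'D_X F z by rewrite lfunE /= deriveE.
exists (lker f); split; last by move=> X; rewrite memv_ker fE; split=> [/eqP|/eqP].
have radial : f ((0, z.2) : TV) = 1.
  rewrite fE; have eF : euler D 1%:R F.
    apply: (@euler_homogeneous _ _ 1 F (lf_smooth HF)).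
    move=> -[x y] k [/= Ox _] k0.
    by rewrite expr1 (lf_homogeneous HF).
  rewrite -F1 -[RHS]mul1r -(eF z Dz).
  rewrite (derive_coord _ df) /=.
  rewrite -[RHS]add0r; apply: (f_equal2 +%R); last exact: erefl.
  by apply: big1 => i _; rewrite mxE; exact: mul0r.
have img : limg f = fullv.
  apply/eqP; rewrite eqEsubv subvf /=; apply/subvP => y _.
  have -> : y = f (y *: ((0, z.2) : TV)) by rewrite linearZ /= radial; exact: esym (mulr1 y).
  exact: memv_img (memvf _).
have := limg_ker_dim f fullv; rewrite capfv img !dimvf => e.
have dE : dim TV = 6%N by rewrite (_ : dim TV = dim 'rV[R]_3 + dim 'rV[R]_3)%N // dim_matrix.
have : (\dim (lker f) + 1 = 6)%N := etrans e dE.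
by rewrite addn1 => -[].
Qed.

Lemma rank_sigma sigma z : descends F O (sigma_frame F p s) sigma ->
  SM_reg F p s O z -> rank_form (T_SM F) sigma z 4.
Proof.
move=> ds rz; have [Sz _ _] := rz; have [V [dV tV]] := dim_T_SM Sz.
have [tk k0] := char_vec_tangent rz.
(* Off the tangent spaces sigma is arbitrary and need not be bilinear; bilinearity is taken from the
   local extension [b]. *)
have [U [b [_ Uz [b1 b2 _] _ eb]]] := local_primitive Sz.
have fb := basis_free (vbasisP V); have sb := span_basis (vbasisP V).
exists (\dim V), (vbasis V); rewrite sb; split=> //.
have eA v w : v \in V -> w \in V -> b z v w = sigma z v w.
  move=> /tV tv /tV tw; rewrite (descends_unique ds Sz tv tw); exact: eb.
have -> : 4%N = (\dim V).-1 by rewrite dV.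
have inV i : tnth (vbasis V) i \in V by apply: vbasis_mem; exact: mem_tnth.
have -> : \matrix_(i, j) sigma z (tnth (vbasis V) i) (tnth (vbasis V) j)
     = \matrix_(i, j) b z (tnth (vbasis V) i) (tnth (vbasis V) j).
  by apply/matrixP => i j; rewrite !mxE eA.
apply: (rank_bilinear_form fb (k := char_vec F p s z)); rewrite ?sb //.
- exact/tV.
- move=> a v v' w; rewrite (b2 _ (a *: v + v')) // (b1 _ _ Uz) (b2 _ v) // (b2 _ v') //.
  by rewrite mulrN opprD.
- by move=> a v w w'; rewrite (b1 _ _ Uz).
move=> v vV; have tv := vV; move/tV in tv.
rewrite -(kernel_sigma ds rz tv); split=> [H|[_ H] w wV].
  by split=> // w /tV wV; rewrite -eA // H.
by rewrite eA // H //; apply/tV.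
Qed.

End Potential.

Lemma finsler_local (R : realType) (M : topologicalType) (At : oriented_atlas R M)
  (F : finsler At) (c : chart_index At) : local_finsler (chart_img c) (F c).
Proof.
split; [exact: chart_img_open|exact: F_ge0|exact: F_smooth|exact: F_homogeneous|exact: F_convex].
Qed.

Theorem theorem4p12 (R : realType) (M : topologicalType)
  (M_hausdorff : hausdorff_space M) (M_countable : @second_countable M)
  (At : oriented_atlas R M) (F : finsler At) (p s : R)
  (p_gt0 : 0 < p) (s_neq0 : s != 0) (c : chart_index At) :
  let O : set 'rV[R]_3 := chart_img c in
  (exists sigma : TV R -> TV R -> TV R -> R,
     two_form_on (SM (F c) O) (T_SM (F c)) sigma /\
     descends (F c) O (sigma_frame (F c) p s) sigma) /\
  (forall sigma : TV R -> TV R -> TV R -> R,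
     descends (F c) O (sigma_frame (F c) p s) sigma ->
     [/\ descends (F c) O (d1 (potential (F c) p s)) sigma,
         (forall z X, SM_reg (F c) p s O z -> T_SM (F c) z X ->
            (ker_form (T_SM (F c)) sigma z X <->
             exists X3 : R, X = X3 *: char_vec (F c) p s z)) &
         presymplectic (SM_reg (F c) p s O) (T_SM (F c)) sigma 4]).
Proof.
move=> O; have HF := finsler_local F c.
have reg : SM_reg (F c) p s O `<=` SM (F c) O by move=> z [].
split=> [|sigma ds].
  have ds := descends_sigma_coord HF p s.
  by exists (sigma_coord (F c) p s); split=> //; exact: (two_form_sigma HF (@subset_refl _ _) ds).
split; first exact: (descends_potential HF ds).
  by move=> z X; exact: (kernel_sigma HF s_neq0 ds).
split; [exact: (two_form_sigma HF reg ds)|exact: (closed_sigma HF reg ds)|].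
by move=> z; exact: (rank_sigma HF s_neq0 ds).
Qed.
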